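(* Let $E$ be any $n$-dimensional Banach space. Then $$d_{QSK}(\max(E))\ge\frac{\sqrt n}{4}.$$
   Context: An operator space is a closed subspace of $B(H)$ for some Hilbert space $H$; $\|\cdot\|_{cb}$ is the completely bounded norm and $d_{cb}(E,F)=\inf\{\|u\|_{cb}\|u^{-1}\|_{cb}\}$ over all linear isomorphisms $u\colon E\to F$. For a Banach space $E$, $\max(E)$ denotes $E$ equipped with its maximal operator space structure, which is characterized by the isometric identity $cb(\max(E),F)=B(E,F)$ for every operator space $F$ (i.e. every bounded linear map $v\colon E\to F$ satisfies $\|v\|_{cb(\max(E),F)}=\|v\|$). For a finite dimensional operator space $E$, $d_{QSK}(E)=\inf\{d_{cb}(E,F)\}$, where the infimum runs over all operator spaces $F$ of the form $F=E_1/E_2$ with $E_2\subset E_1\subset K$ closed subspaces and $\dim E=\dim F$. Here $K$ is the algebra of compact operators on $\ell_2$, and $E_1/E_2$ has the quotient operator space structure $M_n(E_1/E_2)=M_n(E_1)/M_n(E_2)$. *)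

(* Defs.v *)
From HB Require Import structures.
From mathcomp Require Import all_boot all_order all_algebra.
From mathcomp Require Import generic_quotient ring_quotient sesquilinear.
From mathcomp Require Import complex ring lra.
From mathcomp Require Import all_classical all_reals all_analysis.

Set Implicit Arguments.
Unset Strict Implicit.
Unset Printing Implicit Defensive.

Import Order.TTheory GRing.Theory Num.Theory.
Import numFieldNormedType.Exports.

Local Open Scope classical_set_scope.
Local Open Scope ring_scope.
Local Open Scope complex_scope.

(* Norms on spaces over R[i] take values in R[i]; [rnorm] is the same number
   read in R. *)
Definition rnorm (R : realType) (V : normedModType R[i]) (x : V) : R :=
  complex.Re `|x|.

Section RnormTheory.
Context {R : realType} {V : normedModType R[i]}.
Implicit Types x y : V.

Lemma rnormE x : (rnorm x)%:C = `|x|.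
Proof. by rewrite /rnorm RRe_real// normr_real. Qed.

Lemma rnorm_ge0 x : 0 <= rnorm x.
Proof. by rewrite -ler0c rnormE. Qed.

Lemma rnorm0 : rnorm (0 : V) = 0.
Proof. by rewrite /rnorm normr0. Qed.

Lemma rnorm0_eq0 x : rnorm x = 0 -> x = 0.
Proof. by move=> x0; apply/normr0_eq0; rewrite -rnormE x0. Qed.

Lemma ler_rnormD x y : rnorm (x + y) <= rnorm x + rnorm y.
Proof. by rewrite -lecR rmorphD/= !rnormE ler_normD. Qed.

Lemma rnormZ (a : R[i]) x : rnorm (a *: x) = Normc.normc a * rnorm x.
Proof.
apply: (@complexI R). rewrite rmorphM/= !rnormE normrZ.
by [].
Qed.

Lemma rnormN x : rnorm (- x) = rnorm x.
Proof. by rewrite /rnorm normrN. Qed.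

End RnormTheory.

(* A form in [{dot H for Num.conj}] is positive definite, linear in its first
   argument and conjugate-linear in its second one. *)
HB.mixin Record CompleteNormedModule_isHilbert (R : realType) H
    of CompleteNormedModule R[i] H := {
  hdot : {dot H for Num.conj};
  hdotxx : forall x : H, hdot x x = `|x| ^+ 2
}.

#[short(type="hilbertType")]
HB.structure Definition Hilbert (R : realType) :=
  {H of CompleteNormedModule R[i] H & CompleteNormedModule_isHilbert R H}.

Definition opnorm (R : realType) (V W : normedModType R[i]) (f : V -> W)
    : \bar R :=
  ereal_sup [set (rnorm (f x))%:E | x in [set x : V | rnorm x <= 1]].

Section BoundedOperators.
Context {R : realType} (H : normedModType R[i]).

Definition is_bop : {pred H -> H} := [pred f | `[< linear f /\ continuous f >]].

Lemma is_bop_submod : submod_closed is_bop.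
Proof.
split=> [|a f g /asboolP[lf cf] /asboolP[lg cg]]; apply/asboolP; split.
- by move=> a x y; rewrite /= scaler0 addr0.
- exact: cst_continuous.
- move=> b x y; rewrite !fctE lf lg !scalerDr !scalerA (mulrC a b).
  by rewrite -!addrA; congr (_ + _); rewrite addrCA.
- move=> x; apply: cvgD; last exact: cg.
  by apply: cvgZr; exact: cf.
Qed.

HB.instance Definition _ := GRing.isSubmodClosed.Build _ _ is_bop is_bop_submod.

Record bop : Type := Bop { bop_fun :> H -> H ; _ : bop_fun \in is_bop }.

HB.instance Definition _ := [isSub for bop_fun].
HB.instance Definition _ := [Choice of bop by <:].
HB.instance Definition _ := [SubChoice_isSubLmodule of bop by <:].

End BoundedOperators.

Section BoundedOperatorsNorm.
Context {R : realType} {H : normedModType R[i]}.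
Implicit Types f g : bop H.

Lemma bop_linear f : linear f.
Proof. by case: f => f /= /asboolP[]. Qed.

Lemma bop_continuous f : continuous f.
Proof. by case: f => f /= /asboolP[]. Qed.

HB.instance Definition _ f :=
  GRing.isLinear.Build R[i] H H _ (bop_fun f) (bop_linear f).

Lemma bopDE f g x : (f + g) x = f x + g x. Proof. by []. Qed.

Lemma bopZE a f x : (a *: f) x = a *: f x. Proof. by []. Qed.

Lemma bopP f g : f =1 g -> f = g.
Proof. by move=> fg; apply/val_inj/funext. Qed.

Lemma bop_bounded f : exists M : R, forall x, rnorm (f x) <= M * rnorm x.
Proof.
have /linear_boundedP fb :=
  @continuous_linear_bounded _ _ _ 0 f (@bop_continuous f 0).
have [M [Mr Mf]] := fb; exists (complex.Re M + 1) => x.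
have /Mf/(_ x) : M < M + 1 by rewrite ltrDl.
rewrite -!rnormE -[M in M + 1](RRe_real Mr) -(rmorph1 (real_complex R)).
by rewrite -rmorphD -rmorphM lecR.
Qed.

Definition bnorm f : R := fine (opnorm f).

Lemma opnorm_ge0 f : (0 <= opnorm f)%E.
Proof.
apply: ereal_sup_ubound => /=; exists 0; first by rewrite rnorm0 ler01.
by rewrite linear0 rnorm0.
Qed.

Lemma opnorm_bop f : opnorm f = (bnorm f)%:E.
Proof.
rewrite fineK// ge0_fin_numE ?opnorm_ge0//.
have [M fM] := bop_bounded f; apply: (@le_lt_trans _ _ `|M|%:E); last first.
  exact: ltry.
apply: ge_ereal_sup => _ [x /= x1 <-]; rewrite lee_fin (le_trans (fM x))//.
rewrite (le_trans (ler_norm _))// normrM (ger0_norm (rnorm_ge0 x)).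
by rewrite ler_piMr.
Qed.

Lemma bnorm_ge0 f : 0 <= bnorm f.
Proof. by rewrite -lee_fin -opnorm_bop opnorm_ge0. Qed.

Lemma rnorm_bop_le f x : rnorm (f x) <= bnorm f * rnorm x.
Proof.
have [->|x0] := eqVneq x 0; first by rewrite linear0 rnorm0 mulr0.
have nx0 : 0 < rnorm x.
  rewrite lt_neqAle rnorm_ge0 andbT; apply: contraNneq x0 => /esym.
  by move=> /rnorm0_eq0 ->.
rewrite -ler_pdivrMr// -lee_fin -opnorm_bop; apply: ereal_sup_ubound => /=.
have nV : Normc.normc ((rnorm x)^-1)%:C = (rnorm x)^-1.
  by rewrite /= expr0n addr0 sqrtr_sqr ger0_norm// invr_ge0 ltW.
exists (((rnorm x)^-1)%:C *: x).
  by rewrite rnormZ nV mulVf// gt_eqF.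
by rewrite linearZ rnormZ nV mulrC.
Qed.

Lemma bnorm_le f (M : R) :
  (forall x, rnorm x <= 1 -> rnorm (f x) <= M) -> bnorm f <= M.
Proof.
move=> fM; rewrite -lee_fin -opnorm_bop; apply: ge_ereal_sup => _ [x x1 <-].
by rewrite lee_fin fM.
Qed.

Let bopnorm f : R[i] := (bnorm f)%:C.

Let bopnormD f g : bopnorm (f + g) <= bopnorm f + bopnorm g.
Proof.
rewrite -rmorphD lecR; apply: bnorm_le => x x1; rewrite bopDE.
rewrite (le_trans (ler_rnormD _ _))// lerD// (le_trans (rnorm_bop_le _ _))//.
  by rewrite ler_piMr ?bnorm_ge0.
by rewrite ler_piMr ?bnorm_ge0.
Qed.

Let bnormZ_le (a : R[i]) f : bnorm (a *: f) <= Normc.normc a * bnorm f.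
Proof.
have a0 : 0 <= Normc.normc a by rewrite -ler0c; exact: (normr_ge0 a).
apply: bnorm_le => x x1; rewrite bopZE rnormZ ler_wpM2l//.
by rewrite (le_trans (rnorm_bop_le _ _))// ler_piMr ?bnorm_ge0.
Qed.

Let bopnormZ (a : R[i]) f : bopnorm (a *: f) = `|a| * bopnorm f.
Proof.
rewrite -[`|a|]/(Normc.normc a)%:C -rmorphM; congr (_%:C).
apply/eqP; rewrite eq_le bnormZ_le/=.
have [->|a0] := eqVneq a 0.
  by rewrite Normc.normc0 mul0r bnorm_ge0.
have na0 : 0 < Normc.normc a by rewrite -ltcR; have := a0; rewrite -normr_gt0.
rewrite -ler_pdivlMl// -Normc.normcV.
by rewrite -[f in leLHS](scalerK a0) bnormZ_le.
Qed.

Let bopnorm0_eq0 f : bopnorm f = 0 -> f = 0.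
Proof.
move=> /(@complexI R) f0; apply: bopP => x; apply: rnorm0_eq0.
apply/eqP; rewrite eq_le rnorm_ge0 andbT.
by rewrite (le_trans (rnorm_bop_le _ _))// f0 mul0r.
Qed.

HB.instance Definition _ := Lmodule_isNormed.Build R[i] (bop H)
  bopnormD bopnormZ bopnorm0_eq0.

Lemma rnorm_bop f : (rnorm f)%:E = opnorm f.
Proof. by rewrite opnorm_bop. Qed.

End BoundedOperatorsNorm.

Record subspace (K : pzRingType) (V : lmodType K) := Subspace {
  subspace_pred :> {pred V} ;
  subspace_closed : submod_closed subspace_pred
}.

HB.instance Definition _ (K : pzRingType) (V : lmodType K) (S : subspace V) :=
  GRing.isSubmodClosed.Build K V (subspace_pred S) (subspace_closed S).

Section SubspaceType.
Context {K : pzRingType} {V : lmodType K} (S : subspace V).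

Record subspace_type : Type := SubspaceElt {
  subspace_val :> V ;
  subspace_valP : subspace_val \in subspace_pred S
}.

HB.instance Definition _ := [isSub for subspace_val].
HB.instance Definition _ := [Choice of subspace_type by <:].
HB.instance Definition _ := [SubChoice_isSubLmodule of subspace_type by <:].

End SubspaceType.

Section LmoduleQuotient.
Context {K : pzRingType} {V : lmodType K} (W : subspace V).
Local Open Scope quotient_scope.

Definition lquot : Type := Quotient.quot (subspace_pred W).

HB.instance Definition _ := EqQuotient.on lquot.
HB.instance Definition _ := GRing.Zmodule.on lquot.

Definition lquot_scale (a : K) := lift_op1 lquot ( *:%R a).

Lemma pi_lquot_scale (a : K) :
  {morph \pi_lquot : x / a *: x >-> lquot_scale a x}.
Proof.
move=> x; unlock lquot_scale; apply/eqP; rewrite -Quotient.idealrBE -scalerBr.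
by rewrite rpredZ// Quotient.idealrBE reprK.
Qed.

Let pi_lquotD : {morph \pi_lquot : x y / x + y}.
Proof. exact: pi_addr. Qed.

Lemma lquot_scaleA a b (x : lquot) :
  lquot_scale a (lquot_scale b x) = lquot_scale (a * b) x.
Proof. by elim/quotW: x => x; rewrite -!pi_lquot_scale scalerA. Qed.

Lemma lquot_scale1 : left_id 1 lquot_scale.
Proof. by elim/quotW => x; rewrite -pi_lquot_scale scale1r. Qed.

Lemma lquot_scaleDr : right_distributive lquot_scale +%R.
Proof.
move=> a; elim/quotW => x; elim/quotW => y.
by rewrite -pi_lquotD -!pi_lquot_scale -pi_lquotD scalerDr.
Qed.

Lemma lquot_scaleDl (x : lquot) :
  {morph lquot_scale^~ x : a b / a + b}.
Proof.
elim/quotW: x => x a b.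
by rewrite -!pi_lquot_scale -pi_lquotD scalerDl.
Qed.

HB.instance Definition _ := GRing.Zmodule_isLmodule.Build K lquot
  lquot_scaleA lquot_scale1 lquot_scaleDr lquot_scaleDl.

Definition lquot_pi : V -> lquot := \pi_lquot.

Lemma lquot_pi_linear : linear lquot_pi.
Proof. by move=> a x y; rewrite /lquot_pi pi_lquotD pi_lquot_scale. Qed.

HB.instance Definition _ :=
  GRing.isLinear.Build K V lquot _ lquot_pi lquot_pi_linear.

Lemma lquot_pi_surj (y : lquot) : exists x, lquot_pi x = y.
Proof. by exists (repr y); rewrite /lquot_pi reprK. Qed.

Lemma lquot_piP (x y : V) : reflect (lquot_pi x = lquot_pi y) (x - y \in W).
Proof. by rewrite Quotient.idealrBE; exact: eqP. Qed.

End LmoduleQuotient.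

Lemma normc_sq (R : rcfType) (z : R[i]) :
  Normc.normc z ^+ 2 = complex.Re z ^+ 2 + complex.Im z ^+ 2.
Proof. by case: z => a b /=; rewrite sqr_sqrtr// addr_ge0// sqr_ge0. Qed.

Lemma ReB (R : rcfType) : {morph @complex.Re R : z w / z - w}.
Proof. by move=> [? ?] [? ?]. Qed.

Lemma ImB (R : rcfType) : {morph @complex.Im R : z w / z - w}.
Proof. by move=> [? ?] [? ?]. Qed.

Section ComplexSeries.
Context {R : realType}.
Implicit Types (u v : nat -> R[i]).

Definition csummable u : Prop :=
  cvgn [series complex.Re (u k)]_k /\ cvgn [series complex.Im (u k)]_k.

Definition csum u : R[i] :=
  limn [series complex.Re (u k)]_k +i* limn [series complex.Im (u k)]_k.

Let lincomb (f g : R^nat) (a b : R) : cvgn (series f) -> cvgn (series g) ->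
  cvgn [series a * f k + b * g k]_k /\
  limn [series a * f k + b * g k]_k = a * limn (series f) + b * limn (series g).
Proof.
move=> cf cg; rewrite -[X in series X]/((a *: f) + (b *: g)).
split; first by apply: is_cvg_seriesD; exact: is_cvg_seriesZ.
by rewrite lim_seriesD; [rewrite !lim_seriesZ|exact: is_cvg_seriesZ..].
Qed.

Let cRe (a : R[i]) u : [series complex.Re (a * u k)]_k =
  [series complex.Re a * complex.Re (u k) + - complex.Im a * complex.Im (u k)]_k.
Proof.
by congr (series _); apply/funext => k /=; case: a => p q; case: (u k) => r t /=; rewrite mulNr.
Qed.

Let cIm (a : R[i]) u : [series complex.Im (a * u k)]_k =
  [series complex.Re a * complex.Im (u k) + complex.Im a * complex.Re (u k)]_k.
Proof. by congr (series _); apply/funext => k /=; case: a => p q; case: (u k). Qed.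

Lemma csumZ a u : csummable u ->
  csummable (fun k => a * u k) /\ csum (fun k => a * u k) = a * csum u.
Proof.
move=> [ru iu]; rewrite /csummable /csum cRe cIm.
have [cr lr] := lincomb (complex.Re a) (- complex.Im a) ru iu.
have [ci li] := lincomb (complex.Re a) (complex.Im a) iu ru.
split; first by split; [exact: cr|exact: ci].
by rewrite lr li; case: a {cr ci lr li} => x y; rewrite mulNr.
Qed.

Lemma csumD u v : csummable u -> csummable v ->
  csummable (fun k => u k + v k) /\
  csum (fun k => u k + v k) = csum u + csum v.
Proof.
move=> [ru iu] [rv iv]; rewrite /csummable /csum.
have -> : [series complex.Re (u k + v k)]_k =
    series ((fun k => complex.Re (u k)) + (fun k => complex.Re (v k))).
  by congr (series _); apply/funext => k; rewrite fctE /=; case: (u k) (v k) => [? ?] [? ?].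
have -> : [series complex.Im (u k + v k)]_k =
    series ((fun k => complex.Im (u k)) + (fun k => complex.Im (v k))).
  by congr (series _); apply/funext => k; rewrite fctE /=; case: (u k) (v k) => [? ?] [? ?].
by split; [split; exact: is_cvg_seriesD|rewrite !lim_seriesD].
Qed.

Lemma csum_conj u : csummable u ->
  csum (fun k => Num.conj (u k)) = Num.conj (csum u).
Proof.
move=> [ru iu]; rewrite /csum /=; congr (_ +i* _).
  by congr (limn (series _)); apply/funext => k /=; case: (u k).
rewrite -lim_seriesN//; congr (limn (series _)); apply/funext => k.
by rewrite fctE /=; case: (u k).
Qed.

End ComplexSeries.

Section L2.
Context {R : realType}.
Local Notation sq z := (Normc.normc z ^+ 2).

Definition is_l2 : {pred nat -> R[i]^o} :=
  [pred x | `[< cvgn [series sq (x k)]_k >]].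

Let sq_ge0 (z : R[i]) : 0 <= sq z. Proof. exact: sqr_ge0. Qed.

Let sqM (a z : R[i]) : sq (a * z) = sq a * sq z.
Proof. by rewrite Normc.normcM exprMn. Qed.

Let sqD_le (t : R) (z w : R[i]) : 0 < t ->
  sq (z + w) <= (1 + t) * sq z + (1 + t^-1) * sq w.
Proof.
move=> t0; case: z w => [a b] [c d]; rewrite !normc_sq /=.
have H (p q : R) : (p + q) ^+ 2 <= (1 + t) * p ^+ 2 + (1 + t^-1) * q ^+ 2.
  rewrite -subr_ge0.
  have -> : (1 + t) * p ^+ 2 + (1 + t^-1) * q ^+ 2 - (p + q) ^+ 2 =
            t^-1 * (t * p - q) ^+ 2.
    by field; rewrite gt_eqF.
  by rewrite mulr_ge0 ?sqr_ge0// invr_ge0 ltW.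
by rewrite (le_trans (lerD (H a c) (H b d)))// !mulrDr addrACA.
Qed.

Let cvg_lin (f g : R^nat) (a b : R) : cvgn (series f) -> cvgn (series g) ->
  cvgn [series a * f k + b * g k]_k.
Proof.
move=> cf cg; rewrite -[X in series X]/((a *: f) + (b *: g)).
by apply: is_cvg_seriesD; exact: is_cvg_seriesZ.
Qed.

Lemma is_l2_submod : submod_closed is_l2.
Proof.
split=> [|a x y /asboolP cx /asboolP cy]; apply/asboolP.
  rewrite (_ : [series _]_k = cst 0); first exact: is_cvg_cst.
  apply/funext => n; rewrite /series/= big1// => k _.
  by rewrite -[LHS]/(sq (0 : R[i])) Normc.normc0 expr0n.
apply: (@series_le_cvg R _
  (fun k => (1 + 1) * sq a * sq (x k) + (1 + 1^-1) * sq (y k))).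
- by move=> k; exact: sq_ge0.
- move=> k /=; rewrite invr1; apply: addr_ge0; apply: mulr_ge0.
  + by apply: mulr_ge0; [exact: addr_ge0|exact: sq_ge0].
  + exact: sq_ge0.
  + exact: addr_ge0.
  + exact: sq_ge0.
- move=> k; rewrite -mulrA -sqM; exact: sqD_le.
- exact: cvg_lin.
Qed.

HB.instance Definition _ := GRing.isSubmodClosed.Build _ _ is_l2 is_l2_submod.

Record l2 : Type := L2 { l2_seq :> nat -> R[i]^o ; _ : l2_seq \in is_l2 }.

HB.instance Definition _ := [isSub for l2_seq].
HB.instance Definition _ := [Choice of l2 by <:].
HB.instance Definition _ := [SubChoice_isSubLmodule of l2 by <:].

Implicit Types x y z : l2.

Lemma l2P x : cvgn [series sq (x k)]_k.
Proof. by case: x => x /= /asboolP. Qed.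

Lemma l2DE x y k : (x + y) k = x k + y k. Proof. by []. Qed.
Lemma l2ZE a x k : (a *: x) k = a * x k. Proof. by []. Qed.
Lemma l2_inj x y : (x : nat -> R[i]^o) =1 y -> x = y.
Proof. by move=> xy; apply/val_inj/funext. Qed.

Let bound_cvg (u : R^nat) x y :
  (forall k, `|u k| <= sq (x k) + sq (y k)) -> cvgn (series u).
Proof.
move=> uxy; apply: normed_cvg; apply: (@series_le_cvg R _
  (fun k => 1 * sq (x k) + 1 * sq (y k))).
- by move=> k; exact: normr_ge0.
- by move=> k /=; rewrite !mul1r; apply: addr_ge0; exact: sq_ge0.
- by move=> k /=; rewrite !mul1r; exact: uxy.
- by apply: cvg_lin; exact: l2P.
Qed.

Lemma l2_csummable x y : csummable (fun k => x k * Num.conj (y k)).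
Proof.
split; apply: (@bound_cvg _ x y) => k /=;
  case: (x k) (y k) => [a b] [c d]; rewrite !normc_sq /= ler_norml;
  have := (sqr_ge0 a, sqr_ge0 b, sqr_ge0 c, sqr_ge0 d);
  have := (sqr_ge0 (a + c), sqr_ge0 (a - c), sqr_ge0 (b + d), sqr_ge0 (b - d));
  have := (sqr_ge0 (a + d), sqr_ge0 (a - d), sqr_ge0 (b + c), sqr_ge0 (b - c));
  move=> [[[? ?] ?] ?] [[[? ?] ?] ?] [[[? ?] ?] ?];
  apply/andP; split; lra.
Qed.

Definition l2_dot x y : R[i] := csum (fun k => x k * Num.conj (y k)).

Let sqn x : R := limn [series sq (x k)]_k.

Let nd_sqn x : nondecreasing_seq [series sq (x k)]_k.
Proof. by apply: nondecreasing_series => k _ _; exact: sq_ge0. Qed.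

Let sq_le_sqn x k : sq (x k) <= sqn x.
Proof.
apply: le_trans (nondecreasing_cvgn_le (@nd_sqn x) (@l2P x) k.+1).
by rewrite seriesSr/= lerDr sumr_ge0.
Qed.

Let sqn_ge0 x : 0 <= sqn x. Proof. exact: le_trans (sq_le_sqn x 0). Qed.

Lemma l2_dotxx x : l2_dot x x = (limn [series sq (x k)]_k)%:C.
Proof.
rewrite /l2_dot /csum; congr (_ +i* _).
  congr (limn (series _)); apply/funext => k.
  by rewrite /= normc_sq; case: (x k) => a b /=; ring.
rewrite (_ : [series _]_k = cst 0) ?lim_cst//.
apply/funext => n; rewrite /series/= big1// => k _.
by rewrite /=; case: (x k) => a b /=; ring.
Qed.

Let l2_dot_linear y : linear_for *%R (l2_dot^~ y).
Proof.
move=> a x z; rewrite /l2_dot.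
have [sx <-] := csumZ a (l2_csummable x y).
have [_ <-] := csumD sx (l2_csummable z y).
by congr csum; apply/funext => k; rewrite l2DE l2ZE mulrDl mulrA.
Qed.

Let l2_dotC x y : l2_dot x y = Num.conj (l2_dot y x).
Proof.
rewrite /l2_dot -csum_conj; last exact: l2_csummable.
by congr csum; apply/funext => k; rewrite rmorphM/= conjCK mulrC.
Qed.

Let l2_dot_linearr x : linear_for (Num.conj \; *%R) (l2_dot x).
Proof.
move=> a y z; rewrite l2_dotC l2_dot_linear rmorphD rmorphM/=.
by rewrite -!l2_dotC.
Qed.

HB.instance Definition _ := @bilinear_isBilinear.Build R[i] l2 l2 _ *%R
  (Num.conj \; *%R) l2_dot (conj l2_dot_linear l2_dot_linearr).

Let l2_dot_herm x y :
  l2_dot x y = (-1) ^+ false * Num.conj (l2_dot y x).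
Proof. by rewrite expr0 mul1r -l2_dotC. Qed.

HB.instance Definition _ := @isHermitianSesquilinear.Build R[i] l2 false
  Num.conj l2_dot l2_dot_herm.

Let l2_dot_gt0 x : x != 0 -> 0 < l2_dot x x.
Proof.
apply: contraNT => x0; apply/eqP/l2_inj => k; apply/Normc.eq0_normc/eqP.
rewrite -sqrf_eq0 eq_le sq_ge0 andbT (le_trans (sq_le_sqn x k))//.
by rewrite leNgt -ltcR -/(sqn x) -l2_dotxx.
Qed.

HB.instance Definition _ := @isDotProduct.Build R[i] l2 l2_dot l2_dot_gt0.

Definition l2_norm x : R := Num.sqrt (limn [series sq (x k)]_k).

Let l2_norm_sq x : l2_norm x ^+ 2 = sqn x.
Proof. by rewrite sqr_sqrtr//; exact: sqn_ge0. Qed.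

Let l2_norm_ge0 x : 0 <= l2_norm x. Proof. exact: sqrtr_ge0. Qed.
Local Hint Resolve l2_norm_ge0 : core.

Let l2_norm0 x : l2_norm x = 0 -> x = 0.
Proof.
move=> x0; apply/l2_inj => k; apply/Normc.eq0_normc/eqP.
by rewrite -sqrf_eq0 eq_le sq_ge0 andbT (le_trans (sq_le_sqn x k))// -l2_norm_sq
  x0 expr0n.
Qed.

Let l2_normZr (a : R[i]) x : l2_norm (a *: x) = Normc.normc a * l2_norm x.
Proof.
have na0 : 0 <= Normc.normc a by rewrite -ler0c; exact: (normr_ge0 a).
apply/eqP; rewrite -(eqrXn2 (n := 2)) ?mulr_ge0// exprMn !l2_norm_sq.
rewrite /sqn (_ : [series _]_k = series ((sq a) *: (fun k => sq (x k)))).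
  by rewrite lim_seriesZ//; exact: l2P.
by congr (series _); apply/funext => k; exact: sqM.
Qed.

Let l2_normDr x y : l2_norm (x + y) <= l2_norm x + l2_norm y.
Proof.
have [/l2_norm0 ->|x0] := eqVneq (l2_norm x) 0.
  by rewrite add0r lerDr.
have [/l2_norm0 ->|y0] := eqVneq (l2_norm y) 0.
  by rewrite addr0 lerDl.
have px : 0 < l2_norm x by rewrite lt_neqAle eq_sym x0 l2_norm_ge0.
have py : 0 < l2_norm y by rewrite lt_neqAle eq_sym y0 l2_norm_ge0.
set t := l2_norm y / l2_norm x.
have t0 : 0 < t by rewrite divr_gt0.
rewrite -(ler_pXn2r (n := 2)) ?nnegrE ?addr_ge0//.
have -> : (l2_norm x + l2_norm y) ^+ 2 =
    (1 + t) * l2_norm x ^+ 2 + (1 + t^-1) * l2_norm y ^+ 2.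
  by rewrite /t; field; rewrite x0 y0.
rewrite !l2_norm_sq /sqn -!/(_ *: limn _) -!lim_seriesZ; try exact: l2P.
rewrite -lim_seriesD; try by apply: is_cvg_seriesZ; exact: l2P.
apply: lim_series_le => [||k].
- exact: l2P.
- by apply: is_cvg_seriesD; apply: is_cvg_seriesZ; exact: l2P.
- exact: sqD_le.
Qed.

Let l2_normD x y : (l2_norm (x + y))%:C <= (l2_norm x)%:C + (l2_norm y)%:C.
Proof. by rewrite -rmorphD lecR. Qed.

Let l2_normZ (a : R[i]) x : (l2_norm (a *: x))%:C = `|a| * (l2_norm x)%:C.
Proof. by rewrite l2_normZr rmorphM. Qed.

Let l2_norm_eq0 x : (l2_norm x)%:C = 0 -> x = 0.
Proof. by move=> /(@complexI R) /l2_norm0. Qed.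

HB.instance Definition _ := Lmodule_isNormed.Build R[i] l2
  l2_normD l2_normZ l2_norm_eq0.

Lemma l2_normE x : `|x| = (l2_norm x)%:C. Proof. by []. Qed.

Let psum_le x (e : R) n : l2_norm x <= e ->
  \sum_(0 <= k < n) sq (x k) <= e ^+ 2.
Proof.
move=> xe; apply: le_trans (nondecreasing_cvgn_le (@nd_sqn x) (@l2P x) n) _.
have e0 : 0 <= e := le_trans (l2_norm_ge0 x) xe.
by rewrite -/(sqn x) -l2_norm_sq lerXn2r ?nnegrE.
Qed.

Let sq_le_norm x k : Normc.normc (x k) <= l2_norm x.
Proof.
rewrite -(ler_pXn2r (n := 2)) ?nnegrE//; last first.
  by rewrite -ler0c; exact: (normr_ge0 (x k)).
by rewrite l2_norm_sq.
Qed.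

Lemma l2_complete (F : set_system l2) : ProperFilter F -> cauchy F -> cvg F.
Proof.
move=> FF /cauchy_ballP Fc.
have FcR (e : R) : 0 < e -> exists A, F A /\
    forall x y, A x -> A y -> l2_norm (x - y) <= e.
  move=> e0; have := Fc e%:C; rewrite (ltcR 0) => /(_ e0)[[A B]/= [FA FB] AB].
  exists (A `&` B); split; first exact: filterI.
  move=> x y [Ax _] [_ By]; have := AB (x, y) (conj Ax By).
  by rewrite -ball_normE/= l2_normE ltcR => /ltW.
have part (p : R[i] -> R) : (forall z : R[i], `|p z| <= Normc.normc z) ->
    {morph p : z w / z - w} -> forall k, cvg ((fun x : l2 => p (x k)) @ F).
  move=> pn pB k; apply: R_complete; apply/cauchyP => e e0.
  have [A [FA Ae]] := FcR (e / 2) ltac:(by rewrite divr_gt0).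
  have [y Ay] := filter_ex FA; exists (p (y k)).
  suff : F [set x : l2 | ball (p (y k)) e (p (x k))] by [].
  apply: filterS FA => x Ax; rewrite /= -ball_normE/= -pB.
  rewrite (le_lt_trans (pn _))// (le_lt_trans (sq_le_norm (y - x) k))//.
  by rewrite (le_lt_trans (Ae _ _ Ay Ax))// gtr_pMr// invf_lt1 ?ltr1n.
have cvRe k : cvg ((fun x : l2 => complex.Re (x k)) @ F).
  apply: part => [[a b]|]; last exact: ReB.
  by rewrite /= -sqrtr_sqr ler_sqrt ?addr_ge0 ?sqr_ge0// lerDl sqr_ge0.
have cvIm k : cvg ((fun x : l2 => complex.Im (x k)) @ F).
  apply: part => [[a b]|]; last exact: ImB.
  by rewrite /= -sqrtr_sqr ler_sqrt ?addr_ge0 ?sqr_ge0// lerDr sqr_ge0.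
pose z k : R[i]^o := lim ((fun x : l2 => complex.Re (x k)) @ F) +i*
                     lim ((fun x : l2 => complex.Im (x k)) @ F).
have psum_z x (e : R) : (\forall y \near F, l2_norm (x - y) <= e) ->
    forall n, \sum_(0 <= k < n) sq (x k - z k) <= e ^+ 2.
  move=> xe n.
  apply: (@cvgr_to_le _ F _ R (fun y : l2 => \sum_(0 <= k < n) sq (x k - y k))).
    rewrite big_mkord (_ : (fun y : l2 => _) = (fun y : l2 =>
      \sum_(k < n) ((complex.Re (x k) - complex.Re (y k)) ^+ 2 +
                    (complex.Im (x k) - complex.Im (y k)) ^+ 2))); last first.
      apply/funext => y; rewrite big_mkord; apply: eq_bigr => k _.
      by rewrite normc_sq !ReB !ImB.
    rewrite (eq_bigr (fun k : 'I_n => (complex.Re (x k) - complex.Re (z k)) ^+ 2 +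
                    (complex.Im (x k) - complex.Im (z k)) ^+ 2)); last first.
      by move=> k _; rewrite normc_sq !ReB !ImB.
    apply: cvg_big => [|k _]; first exact: add_continuous.
    apply: cvgD.
      by rewrite expr2; apply: cvgM; (apply: cvgB; [exact: cvg_cst|exact: cvRe]).
    by rewrite expr2; apply: cvgM; (apply: cvgB; [exact: cvg_cst|exact: cvIm]).
  by apply: filterS xe => y; exact: psum_le.
have series_z x (e : R) : (\forall y \near F, l2_norm (x - y) <= e) ->
    cvgn [series sq (x k - z k)]_k.
  move=> /psum_z xe; apply: nondecreasing_is_cvgn.
    by apply: nondecreasing_series => k _ _; exact: sq_ge0.
  by exists (e ^+ 2) => _ [n _ <-]; exact: xe.
have zl2 : z \in is_l2.
  have [A [FA A1]] := FcR 1 ltr01; have [x Ax] := filter_ex FA.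
  have /series_z zx : \forall y \near F, l2_norm (x - y) <= 1.
    by apply: filterS FA => y; exact: A1.
  have -> : z = l2_seq x - (fun k => x k - z k).
    by apply/funext => k; rewrite !fctE opprB addrC subrK.
  by rewrite rpredB//; [exact: valP|exact/asboolP].
apply/cvg_ex; exists (L2 zl2); apply/cvgrPdist_le => e e0.
have eE : e = (complex.Re e)%:C by rewrite RRe_real// gtr0_real.
move: e0; rewrite eE (ltcR 0) => e0.
have [A [FA Ae]] := FcR _ e0; apply: (filterS _ FA) => x Ax.
have xe : \forall y \near F, l2_norm (x - y) <= complex.Re e.
  by apply: filterS FA => y; exact: Ae.
rewrite distrC l2_normE lecR -(ler_pXn2r (n := 2)) ?nnegrE ?(ltW e0)//.
rewrite l2_norm_sq; apply: limr_le; first exact: l2P.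
by apply: nearW => n; exact: psum_z.
Qed.

HB.instance Definition _ := Uniform_isComplete.Build l2 l2_complete.

Let l2_hdotxx x : l2_dot x x = `|x| ^+ 2.
Proof. by rewrite l2_normE -rmorphXn/= l2_norm_sq l2_dotxx. Qed.

HB.instance Definition _ :=
  CompleteNormedModule_isHilbert.Build R l2 l2_hdotxx.

End L2.
Arguments l2 : clear implicits.

Section MatrixNorms.
Context {R : realType}.

(* The norm of M_k(B(H)) = B(H^k), where H^k is the Hilbert space direct sum of
   k copies of H; on 1 x 1 matrices this is the operator norm. *)
Definition mxop_norm (H : hilbertType R) (k : nat) (A : 'M[bop H]_k) : R :=
  sup [set Num.sqrt (\sum_i rnorm (\sum_j A i j (xi j)) ^+ 2) |
       xi in [set xi : 'I_k -> H | \sum_j rnorm (xi j) ^+ 2 <= 1]].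

Lemma has_sup_mxop_norm (H : hilbertType R) (k : nat) (A : 'M[bop H]_k) :
  has_sup [set Num.sqrt (\sum_i rnorm (\sum_j A i j (xi j)) ^+ 2) |
           xi in [set xi : 'I_k -> H | \sum_j rnorm (xi j) ^+ 2 <= 1]].
Proof.
split.
  exists (Num.sqrt (\sum_i rnorm (\sum_j A i j 0) ^+ 2)), (fun=> 0) => //=.
  by rewrite big1// => j _; rewrite rnorm0 expr0n.
exists (Num.sqrt (\sum_i (\sum_j bnorm (A i j)) ^+ 2)) => _ [xi /= xi1 <-].
have xij j : rnorm (xi j) <= 1.
  rewrite -(ler_pXn2r (n := 2)) ?nnegrE ?rnorm_ge0// expr1n.
  rewrite (le_trans _ xi1)// (bigD1 j)//= lerDl sumr_ge0// => i _.
  exact: sqr_ge0.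
rewrite ler_wsqrtr// ler_sum// => i _.
have Ai : 0 <= \sum_j bnorm (A i j) by rewrite sumr_ge0// => j _; exact: bnorm_ge0.
rewrite lerXn2r ?nnegrE ?rnorm_ge0//.
apply: (@le_trans _ _ (\sum_j rnorm (A i j (xi j)))).
  elim/big_ind2 : _ => [|x y z t xy zt|//]; first by rewrite rnorm0.
  by rewrite (le_trans (ler_rnormD _ _))// lerD.
apply: ler_sum => j _; rewrite (le_trans (rnorm_bop_le _ _))//.
by rewrite ler_piMr ?bnorm_ge0.
Qed.

Definition mxnorms (V : lmodType R[i]) : Type := forall k : nat, 'M[V]_k -> R.

Definition sub_mxnorms (H : hilbertType R) (S : subspace (bop H)) :
    mxnorms (subspace_type S) :=
  fun k A => mxop_norm (map_mx val A).

Definition cbnorm (V W : lmodType R[i]) (M : mxnorms V) (N : mxnorms W)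
    (u : V -> W) : \bar R :=
  ereal_sup [set t | exists k (A : 'M[V]_k),
                       M k A <= 1 /\ t = (N k (map_mx u A))%:E].

Definition dcb (V W : lmodType R[i]) (M : mxnorms V) (N : mxnorms W) : \bar R :=
  ereal_inf [set t | exists (u : {linear V -> W}) (v : {linear W -> V}),
    [/\ cancel u v, cancel v u & t = (cbnorm M N u * cbnorm N M v)%E]].

Definition has_dim (n : nat) (V : lmodType R[i]) : Prop :=
  inhabited (Vector.axiom n V).

End MatrixNorms.

Record opspace (R : realType) := OpSpace {
  ops_hilbert : hilbertType R ;
  ops_subspace : subspace (bop ops_hilbert) ;
  ops_closed : closed [set` ops_subspace]
}.

Definition ops_type (R : realType) (F : opspace R) : lmodType R[i] :=
  subspace_type (ops_subspace F).

Definition ops_mxnorms (R : realType) (F : opspace R) : mxnorms (ops_type F) :=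
  @sub_mxnorms R (ops_hilbert F) (ops_subspace F).

Section MaximalStructure.
Context {R : realType}.

(* M makes V an operator space, i.e. it comes from a linear identification of V
   with a closed subspace of some B(H). *)
Definition is_opspace_structure (V : lmodType R[i]) (M : mxnorms V) : Prop :=
  exists (F : opspace R) (j : {linear V -> ops_type F}),
    bijective j /\ forall k (A : 'M[V]_k), M k A = ops_mxnorms (map_mx j A).

(* (E, M) is max(E): an operator space structure on the normed space E such that
   cb(max(E), F) = B(E, F) isometrically for every operator space F. *)
Definition is_max (E : normedModType R[i]) (M : mxnorms E) : Prop :=
  [/\ is_opspace_structure M,
      forall x : E, M 1%N (const_mx x) = rnorm x
    & forall (F : opspace R) (v : {linear E -> ops_type F}),
        continuous (fun x => val (v x)) ->
        cbnorm M (@ops_mxnorms R F) v = opnorm (fun x => val (v x))].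

End MaximalStructure.

Section Quotients.
Context {R : realType}.

Definition compact_op (H : normedModType R[i]) : set (bop H) :=
  [set f | precompact [set f x | x in [set x : H | rnorm x <= 1]]].

Section OpQuotient.
Context (H : hilbertType R) (E1 E2 : subspace (bop H)).

Definition rel_pred : {pred subspace_type E1} :=
  [pred x | val x \in subspace_pred E2].

Lemma rel_pred_submod : submod_closed rel_pred.
Proof.
split=> [|a x y]; rewrite !inE; first exact: rpred0.
by move=> xE yE; rewrite /= rpredD ?rpredZ.
Qed.

(* When E2 is included in E1, this is E2 viewed as a subspace of E1. *)
Definition rel_subspace : subspace (subspace_type E1) :=
  Subspace rel_pred_submod.

Definition op_quot : lmodType R[i] := lquot rel_subspace.

(* M_k(E1 / E2) = M_k(E1) / M_k(E2). *)
Definition quot_mxnorms : mxnorms op_quot :=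
  fun k B => inf [set sub_mxnorms A | A in
    [set A : 'M[subspace_type E1]_k | map_mx (lquot_pi rel_subspace) A = B]].

End OpQuotient.

Definition dQSK (V : lmodType R[i]) (M : mxnorms V) : \bar R :=
  ereal_inf [set t | exists E1 E2 : subspace (bop (l2 R)),
    [/\ closed [set` E1] /\ closed [set` E2],
        {subset E2 <= E1},
        [set` E1] `<=` @compact_op (l2 R),
        exists n, has_dim n V /\ has_dim n (op_quot E1 E2)
      & t = dcb M (@quot_mxnorms (l2 R) E1 E2)]].

End Quotients.

(* Main.v *)
Require Import Defs.
From HB Require Import structures.
From mathcomp Require Import all_boot all_order all_algebra all_fingroup.
From mathcomp Require Import complex ring lra finmap.
From mathcomp Require Import all_classical all_reals all_analysis.

(** Why the bound holds.  Let u : max(E) -> E1/E2 be a linear isomorphism with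
    inverse v, where E1 consists of compact operators, and let a, b be the
    completely bounded norms of u and v.  Two ingredients meet.

    Geometry of E ([two_summing_identity]): the identity of an n-dimensional
    space has 2-summing norm at least sqrt n, in the following trace form.  Up
    to epsilon there are vectors x_k and functionals beta_k with
    sum_k |x_k|^2 <= 1, sum_k |beta_k(y)|^2 <= n |y|^2 and
    sum_k beta_k(x_k) = n.

    Matrices that pass for free unitaries ([asymptotically_free_compact]): for
    given compact operators f_k there are N x N matrices b_k, almost
    orthonormal for the normalised trace, such that both
    |sum_k b_k (x) f_k| <= 2 (sum_k |f_k|^2)^(1/2) and
    |sum_k t_k b_k| <= 2 (sum_k |t_k|^2)^(1/2) hold up to epsilon.

    Lift u(x_k) to compact operators f_k in E1 with |f_k| <= a |x_k|.  Then
    sum_k b_k (x) f_k has norm at most 2a, hence so does its image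
    sum_k b_k (x) u(x_k) in M_N(E1/E2), and applying v shows that
    sum_k b_k (x) x_k has norm at most 2ab in M_N(max(E)).  On the other hand
    w(y) = sum_l beta_l(y) conj(b_l) is a linear map from E to B(l2) of norm at
    most 2 sqrt n, so its completely bounded norm on max(E) is at most 2 sqrt n.
    Evaluating sum_k b_k (x) w(x_k) on the maximally entangled unit vector
    N^(-1/2) sum_h e_h (x) e_h gives
    N^(-1) sum_(k,l) beta_l(x_k) tr(b_k b_l^* ), which is close to
    sum_k beta_k(x_k) = n.  Therefore n <= 2 sqrt n * 2ab, which is the claim.
    Compactness of the f_k is essential: the b_k are chosen after them and need
    only deal with a finite dimensional part of them, whereas no choice of the
    b_k works for all bounded operators at once, as sum_k b_k (x) conj(b_k) has
    norm about the number of terms.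

    Construction of the b_k.  On a Cayley graph of large girth, translation by
    r involutive generators gives permutation matrices a_k which, on
    functions supported near one vertex, act as on the r-regular tree.  There
    T = sum_k a_k (x) z_k, with z_k Hermitian and sum_k z_k^2 <= K^2, is at most
    2K in norm ([perm_sum_tree_bound]): split the neighbours of a vertex into
    its parent and its children.  Globally T can be larger, but T^q applied to
    a point mass only sees a ball of radius q, so T^q has Hilbert-Schmidt norm at
    most (2K)^q (N D)^(1/2), where D is the size of the z_k.  A Tikhonov
    regularisation ([regularised_inverse]) produces X close to the identity
    such that T^q (X (x) 1) has norm at most const(D) (2K)^q.  As the
    constant does not depend on q, log-convexity of q |-> |T^q eta| yields
    |T (X (x) 1)| <= 2K up to epsilon when q is large, and b_k = a_k X. *)

Set Implicit Arguments.
Unset Strict Implicit.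
Unset Printing Implicit Defensive.

Import Order.TTheory GRing.Theory Num.Theory.
Import numFieldNormedType.Exports.

Local Open Scope ring_scope.
Local Open Scope complex_scope.

(** * Complex matrices with the Frobenius inner product *)

Lemma sum_CauchySchwarz (R : realFieldType) (I : finType) (f g : I -> R) :
  (\sum_i f i * g i) ^+ 2 <= (\sum_i f i ^+ 2) * (\sum_i g i ^+ 2).
Proof.
set A := \sum_i f i ^+ 2; set B := \sum_i g i ^+ 2; set P := \sum_i _.
have A0 : 0 <= A by apply: sumr_ge0 => i _; exact: sqr_ge0.
have H : 0 <= A * (A * B - P ^+ 2).
  have -> : A * (A * B - P ^+ 2) = \sum_i (A * g i - P * f i) ^+ 2.
    have -> : \sum_i (A * g i - P * f i) ^+ 2 =
        A ^+ 2 * B - 2 * A * P * P + P ^+ 2 * A.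
      rewrite (eq_bigr (fun i => A ^+ 2 * g i ^+ 2 + ((- 2 * A * P) * (f i * g i)
        + P ^+ 2 * f i ^+ 2))); last by move=> i _; ring.
      by rewrite !big_split /= -!mulr_sumr -/A -/B -/P; ring.
    by ring.
  by apply: sumr_ge0 => i _; exact: sqr_ge0.
have [A1|] := ltrP 0 A; first by rewrite -subr_ge0 -(pmulr_rge0 _ A1).
move=> A1; have /eqP : A = 0 by apply/eqP; rewrite eq_le A1.
rewrite /A psumr_eq0 => [/allP f0|i _]; last exact: sqr_ge0.
have -> : P = 0.
  rewrite /P big1 // => i _; have := f0 i (mem_index_enum i).
  by rewrite sqrf_eq0 => /eqP ->; rewrite mul0r.
by rewrite expr0n mulr_ge0 // sumr_ge0 // => i _; exact: sqr_ge0.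
Qed.

Section ComplexModulus.
Variable R : rcfType.
Local Notation C := R[i].
Local Notation nc := (@Normc.normc R).

Lemma normc_ge0 (a : C) : 0 <= nc a.
Proof. by rewrite -ler0c; exact: (normr_ge0 a). Qed.

Lemma normc_sum (I : Type) (s : seq I) (P : pred I) (f : I -> C) :
  nc (\sum_(i <- s | P i) f i) <= \sum_(i <- s | P i) nc (f i).
Proof.
rewrite -lecR rmorph_sum /=; exact: (ler_norm_sum s f P).
Qed.

Lemma normcB (a b : C) : nc (a - b) = nc (b - a).
Proof. by apply: (@complexI R); exact: (distrC a b). Qed.

Lemma normcD (a b : C) : nc (a + b) <= nc a + nc b.
Proof. by rewrite -lecR rmorphD; exact: (ler_normD a b). Qed.

Lemma normc_conj (a : C) : nc (conjc a) = nc a.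
Proof. by case: a => x y /=; rewrite sqrrN. Qed.

Lemma normc_prod (I : finType) (f : I -> C) :
  nc (\prod_i f i) = \prod_i nc (f i).
Proof. by apply: big_morph; [exact: Normc.normcM|exact: Normc.normc1]. Qed.

Lemma normcX (a : C) k : nc (a ^+ k) = nc a ^+ k.
Proof.
by elim: k => [|k IH]; rewrite ?expr0 ?Normc.normc1 // !exprS Normc.normcM IH.
Qed.

Lemma normc_real (a : R) : 0 <= a -> nc a%:C = a.
Proof. by move=> a0 /=; rewrite expr0n addr0 sqrtr_sqr ger0_norm. Qed.

End ComplexModulus.

Section Frobenius.
Variable R : rcfType.
Local Notation C := R[i].
Local Notation nc := (@Normc.normc R).

(** Norms and adjoints are governed by the real part of the Frobenius inner
    product, which keeps the estimates inside the ordered field R. *)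
Definition frob_redot m n (A B : 'M[C]_(m, n)) : R :=
  \sum_i \sum_j (complex.Re (A i j) * complex.Re (B i j) +
                 complex.Im (A i j) * complex.Im (B i j)).

Definition frob_sq m n (A : 'M[C]_(m, n)) : R :=
  \sum_i \sum_j Normc.normc (A i j) ^+ 2.

Definition adjmx m n (A : 'M[C]_(m, n)) : 'M[C]_(n, m) :=
  \matrix_(i, j) conjc (A j i).

Lemma frob_redotxx m n (A : 'M[C]_(m, n)) : frob_redot A A = frob_sq A.
Proof.
by apply: eq_bigr => i _; apply: eq_bigr => j _; rewrite normc_sq !expr2.
Qed.

Lemma frob_sq_ge0 m n (A : 'M[C]_(m, n)) : 0 <= frob_sq A.
Proof. by do 2!apply: sumr_ge0 => ? _; exact: sqr_ge0. Qed.

Lemma frob_sq_eq0 m n (A : 'M[C]_(m, n)) : frob_sq A = 0 -> A = 0.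
Proof.
move/eqP; rewrite psumr_eq0 => [/allP H|i _]; last first.
  by apply: sumr_ge0 => ? _; exact: sqr_ge0.
apply/matrixP => i j; rewrite mxE; apply/Normc.eq0_normc/eqP.
have := H i (mem_index_enum i); rewrite psumr_eq0 => [/allP K|? _]; last first.
  exact: sqr_ge0.
by have := K j (mem_index_enum j); rewrite sqrf_eq0.
Qed.

Lemma frob_redotC m n (A B : 'M[C]_(m, n)) : frob_redot A B = frob_redot B A.
Proof. by apply: eq_bigr => i _; apply: eq_bigr => j _; ring. Qed.

Lemma frob_redotDl m n (A B D : 'M[C]_(m, n)) :
  frob_redot (A + B) D = frob_redot A D + frob_redot B D.
Proof.
rewrite -big_split; apply: eq_bigr => i _; rewrite -big_split /=.
apply: eq_bigr => j _; rewrite mxE.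
by case: (A i j) (B i j) => [? ?] [? ?] /=; ring.
Qed.

Lemma frob_redotDr m n (A B D : 'M[C]_(m, n)) :
  frob_redot D (A + B) = frob_redot D A + frob_redot D B.
Proof. by rewrite !(frob_redotC D) frob_redotDl. Qed.

Lemma frob_redot0l m n (D : 'M[C]_(m, n)) : frob_redot 0 D = 0.
Proof. by rewrite /frob_redot big1// => i _; rewrite big1// => j _;
  rewrite mxE !mul0r addr0. Qed.

Lemma frob_redot_suml m n (I : finType) (P : pred I)
    (A : I -> 'M[C]_(m, n)) (D : 'M[C]_(m, n)) :
  frob_redot (\sum_(i | P i) A i) D = \sum_(i | P i) frob_redot (A i) D.
Proof.
by elim/big_rec2 : _ => [|i y1 y2 _ <-]; [exact: frob_redot0l|exact: frob_redotDl].
Qed.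

Lemma frob_redot_sumr m n (I : finType) (P : pred I)
    (A : I -> 'M[C]_(m, n)) (D : 'M[C]_(m, n)) :
  frob_redot D (\sum_(i | P i) A i) = \sum_(i | P i) frob_redot D (A i).
Proof. by rewrite frob_redotC frob_redot_suml; apply: eq_bigr => i _;
  rewrite frob_redotC. Qed.

Lemma frob_redotZl m n (a : R) (A D : 'M[C]_(m, n)) :
  frob_redot (a%:C *: A) D = a * frob_redot A D.
Proof.
rewrite mulr_sumr; apply: eq_bigr => i _; rewrite mulr_sumr.
apply: eq_bigr => j _; rewrite mxE; case: (A i j) => ? ? /=; ring.
Qed.

Lemma frob_redotZr m n (a : R) (A D : 'M[C]_(m, n)) :
  frob_redot D (a%:C *: A) = a * frob_redot D A.
Proof. by rewrite frob_redotC frob_redotZl frob_redotC. Qed.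

Lemma frob_sq0 m n : frob_sq (0 : 'M[C]_(m, n)) = 0.
Proof. by rewrite -frob_redotxx frob_redot0l. Qed.

Lemma frob_sqD m n (A B : 'M[C]_(m, n)) :
  frob_sq (A + B) = frob_sq A + 2 * frob_redot A B + frob_sq B.
Proof. by rewrite -!frob_redotxx frob_redotDl !frob_redotDr (frob_redotC B A);
  ring. Qed.

Lemma frob_sqZ m n (a : C) (A : 'M[C]_(m, n)) :
  frob_sq (a *: A) = Normc.normc a ^+ 2 * frob_sq A.
Proof.
rewrite mulr_sumr; apply: eq_bigr => i _; rewrite mulr_sumr.
by apply: eq_bigr => j _; rewrite mxE Normc.normcM exprMn.
Qed.

Lemma frob_sqN m n (A : 'M[C]_(m, n)) : frob_sq (- A) = frob_sq A.
Proof.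
apply: eq_bigr => i _; apply: eq_bigr => j _.
by rewrite mxE !normc_sq; case: (A i j) => ? ? /=; ring.
Qed.

Lemma frob_sqD_le2 m n (A B : 'M[C]_(m, n)) :
  frob_sq (A + B) <= 2 * frob_sq A + 2 * frob_sq B.
Proof.
have := frob_sq_ge0 (A - B); have := frob_sqD A B; have := frob_sqD A (- B).
have -> : frob_redot A (- B) = - frob_redot A B.
  by rewrite -scaleN1r (_ : -1 = (-1 : R)%:C) ?frob_redotZr ?mulN1r //
    rmorphN rmorph1.
by rewrite frob_sqN; lra.
Qed.

Lemma frob_redot_AGM m n (A B : 'M[C]_(m, n)) (t : R) : 0 < t ->
  2 * frob_redot A B <= t * frob_sq A + t^-1 * frob_sq B.
Proof.
move=> t0; have := frob_sq_ge0 (t%:C *: A - B).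
have -> : frob_sq (t%:C *: A - B) =
  t * (t * frob_sq A + t^-1 * frob_sq B - 2 * frob_redot A B).
  rewrite -scaleN1r (_ : -1 = (-1 : R)%:C); last by rewrite rmorphN rmorph1.
  rewrite -!frob_redotxx !(frob_redotDl, frob_redotDr, frob_redotZl,
    frob_redotZr) (frob_redotC B A).
  by field; rewrite gt_eqF.
by rewrite pmulr_rge0 // subr_ge0.
Qed.

Lemma frob_sqD_le m n (A B : 'M[C]_(m, n)) (t : R) : 0 < t ->
  frob_sq (A + B) <= (1 + t) * frob_sq A + (1 + t^-1) * frob_sq B.
Proof. by move=> t0; rewrite frob_sqD; have := frob_redot_AGM A B t0; lra. Qed.

Lemma frob_sq_sum_le m n (I : finType) (A : I -> 'M[C]_(m, n)) :
  frob_sq (\sum_i A i) <= #|I|%:R * \sum_i frob_sq (A i).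
Proof.
have [I0|I0] := posnP #|I|.
  rewrite big1 ?frob_sq0 ?I0 ?mul0r // => i _.
  by have := card0_eq I0 i; rewrite inE.
have c0 : (0 : R) < #|I|%:R by rewrite ltr0n.
set w := \sum_i A i.
have H : \sum_i 2 * frob_redot (A i) w <=
    \sum_i (#|I|%:R * frob_sq (A i) + #|I|%:R^-1 * frob_sq w).
  by apply: ler_sum => i _; exact: frob_redot_AGM.
move: H; rewrite -mulr_sumr -frob_redot_suml frob_redotxx big_split /= -mulr_sumr.
have -> : \sum_(i : I) #|I|%:R^-1 * frob_sq w = frob_sq w.
  by rewrite sumr_const -[LHS]mulr_natl mulrA divff ?mul1r ?gt_eqF.
by lra.
Qed.

Lemma frob_redot_CauchySchwarz m n (A B : 'M[C]_(m, n)) :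
  frob_redot A B ^+ 2 <= frob_sq A * frob_sq B.
Proof.
have H := frob_sq_ge0 ((frob_sq B)%:C *: A - (frob_redot A B)%:C *: B).
have E : frob_sq ((frob_sq B)%:C *: A - (frob_redot A B)%:C *: B) =
   frob_sq B * (frob_sq A * frob_sq B - frob_redot A B ^+ 2).
  rewrite -scaleNr -rmorphN -!frob_redotxx !(frob_redotDl, frob_redotDr,
    frob_redotZl, frob_redotZr).
  by rewrite (frob_redotC B A) !frob_redotxx; ring.
rewrite E in H.
have [B1|] := ltrP 0 (frob_sq B); first by rewrite -subr_ge0 -(pmulr_rge0 _ B1).
move=> B1; have /frob_sq_eq0 -> : frob_sq B = 0.
  by apply/eqP; rewrite eq_le B1 frob_sq_ge0.
by rewrite frob_redotC frob_redot0l expr0n mulr_ge0// frob_sq_ge0.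
Qed.

Lemma frob_sq_row m n (A : 'M[C]_(m, n)) : frob_sq A = \sum_i frob_sq (row i A).
Proof.
by apply: eq_bigr => i _; rewrite /frob_sq big_ord1; apply: eq_bigr => j _;
  rewrite mxE.
Qed.

Lemma frob_sq_col m n (A : 'M[C]_(m, n)) : frob_sq A = \sum_j frob_sq (col j A).
Proof.
rewrite /frob_sq exchange_big; apply: eq_bigr => j _; apply: eq_bigr => i _.
by rewrite big_ord1 mxE.
Qed.

Lemma frob_sq_cV n (v : 'cV[C]_n) : frob_sq v = \sum_i nc (v i 0) ^+ 2.
Proof. by apply: eq_bigr => i _; rewrite big_ord1. Qed.

Lemma frob_sq_rowsub m n (f : 'I_m -> 'I_m) (A : 'M[C]_(m, n)) :
  injective f -> frob_sq (rowsub f A) = frob_sq A.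
Proof.
move=> fi; rewrite [RHS](reindex_inj fi) /=; apply: eq_bigr => i _.
by apply: eq_bigr => j _; rewrite mxE.
Qed.

Lemma frob_sq_row_mx m n1 n2 (A : 'M[C]_(m, n1)) (B : 'M[C]_(m, n2)) :
  frob_sq (row_mx A B) = frob_sq A + frob_sq B.
Proof.
rewrite -big_split; apply: eq_bigr => i _ /=; rewrite big_split_ord /=.
by congr (_ + _); apply: eq_bigr => j _; rewrite ?row_mxEl ?row_mxEr.
Qed.

Lemma frob_sq_delta N (h : 'I_N) : frob_sq (delta_mx h 0 : 'cV[C]_N) = 1.
Proof.
rewrite frob_sq_cV (bigD1 h) //= big1 => [|i ih].
  by rewrite mxE !eqxx Normc.normc1 expr1n addr0.
by rewrite mxE (negPf ih) Normc.normc0 expr0n.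
Qed.

(** Submultiplicativity of the Hilbert-Schmidt norm. *)
Lemma frob_sq_mulmx_le m n p (A : 'M[C]_(m, n)) (x : 'M[C]_(n, p)) :
  frob_sq (A *m x) <= frob_sq A * frob_sq x.
Proof.
rewrite /frob_sq mulr_suml; apply: ler_sum => i _; rewrite exchange_big /= mulr_sumr.
apply: ler_sum => j _; rewrite mxE.
apply: (@le_trans _ _ ((\sum_k nc (A i k) * nc (x k j)) ^+ 2)).
  rewrite lerXn2r ?nnegrE ?normc_ge0 //.
    by apply: sumr_ge0 => k _; rewrite mulr_ge0 ?normc_ge0.
  apply: le_trans (normc_sum _ _ _) _; apply: ler_sum => k _.
  by rewrite Normc.normcM.
exact: sum_CauchySchwarz.
Qed.

Lemma frob_redot_mulmxl m n p (A : 'M[C]_(m, n)) (B : 'M[C]_(n, p)) D :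
  frob_redot (A *m B) D = frob_redot B (adjmx A *m D).
Proof.
rewrite /frob_redot.
transitivity (\sum_i \sum_j \sum_k complex.Re (A i k * B k j * conjc (D i j))).
  apply: eq_bigr => i _; apply: eq_bigr => j _; rewrite mxE.
  rewrite -(raddf_sum (@complex.Re R : {additive _ -> _})) -mulr_suml.
  by case: (\sum_k _) (D i j) => [? ?] [? ?] /=; ring.
transitivity (\sum_k \sum_j \sum_i complex.Re (A i k * B k j * conjc (D i j))).
  under eq_bigr do rewrite exchange_big /=.
  rewrite exchange_big /=; apply: eq_bigr => k _; rewrite exchange_big //=.
apply: eq_bigr => k _; apply: eq_bigr => j _; rewrite mxE.
rewrite -(raddf_sum (@complex.Re R : {additive _ -> _})).
under eq_bigr do rewrite mulrAC mulrC.
under [in RHS]eq_bigr do rewrite mxE.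
have -> : \sum_i B k j * (A i k * conjc (D i j)) =
   B k j * conjc (\sum_i conjc (A i k) * D i j).
  rewrite rmorph_sum mulr_sumr; apply: eq_bigr => i _.
  by rewrite rmorphM /= conjcK.
by case: (B k j) (\sum_i _) => [? ?] [? ?] /=; ring.
Qed.

Lemma adjmxK m n (A : 'M[C]_(m, n)) : adjmx (adjmx A) = A.
Proof. by apply/matrixP => i j; rewrite !mxE conjcK. Qed.

Lemma adjmx_mul m n p (A : 'M[C]_(m, n)) (B : 'M[C]_(n, p)) :
  adjmx (A *m B) = adjmx B *m adjmx A.
Proof.
apply/matrixP => i j; rewrite !mxE rmorph_sum; apply: eq_bigr => k _.
by rewrite !mxE rmorphM mulrC.
Qed.

Lemma adjmxZ m n (a : C) (A : 'M[C]_(m, n)) : adjmx (a *: A) = conjc a *: adjmx A.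
Proof. by apply/matrixP => i j; rewrite !mxE rmorphM. Qed.

Lemma adjmx0 m n : adjmx (0 : 'M[C]_(m, n)) = 0.
Proof. by apply/matrixP => i j; rewrite !mxE conjc0. Qed.

Lemma adjmx_block m n p q (A : 'M[C]_(m, n)) (B : 'M[C]_(m, p))
    (D : 'M[C]_(q, n)) (E : 'M[C]_(q, p)) :
  adjmx (block_mx A B D E) = block_mx (adjmx A) (adjmx D) (adjmx B) (adjmx E).
Proof.
have aE a b (X : 'M[C]_(a, b)) : adjmx X = map_mx (@conjc R) X^T.
  by apply/matrixP => i j; rewrite !mxE.
by rewrite !aE tr_block_mx map_block_mx.
Qed.

Lemma adjmx_inv n (G : 'M[C]_n) : G \in unitmx -> adjmx G = G ->
  adjmx (invmx G) = invmx G.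
Proof.
move=> Gu GH.
have E : adjmx (invmx G) *m G = 1%:M.
  rewrite -{2}GH -adjmx_mul mulmxV //; apply/matrixP => i j.
  by rewrite !mxE eq_sym rmorph_nat.
by rewrite -[LHS]mulmx1 -(mulmxV Gu) mulmxA E mul1mx.
Qed.

Lemma adjmx_mul00 n (v : 'cV[C]_n) : (adjmx v *m v) 0 0 = (frob_sq v)%:C.
Proof.
rewrite mxE /frob_sq rmorph_sum /=; apply: eq_bigr => i _.
rewrite big_ord1 mxE normc_sq; apply/eqP; rewrite eq_complex.
by case: (v i 0) => a b /=; apply/andP; split; apply/eqP; ring.
Qed.

Lemma frob_redot_adjmx m n (A B : 'M[C]_(m, n)) :
  frob_redot (adjmx A) (adjmx B) = frob_redot A B.
Proof.
rewrite /frob_redot exchange_big; apply: eq_bigr => i _; apply: eq_bigr => j _.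
by rewrite !mxE; case: (A i j) (B i j) => [? ?] [? ?] /=; ring.
Qed.

Lemma frob_redot_mulmxr m n p (A : 'M[C]_(m, n)) (B : 'M[C]_(n, p)) D :
  frob_redot (A *m B) D = frob_redot A (D *m adjmx B).
Proof. by rewrite -frob_redot_adjmx adjmx_mul frob_redot_mulmxl adjmxK
  -frob_redot_adjmx adjmx_mul !adjmxK. Qed.

(** A matrix and its adjoint have the same operator norm: for y = A^* x,
    |y|^2 = <x, A y> <= c^(1/2) |x| |y|. *)
Lemma adjmx_bound n (Z : 'M[C]_n) (c : R) :
  (forall x : 'cV_n, frob_sq (Z *m x) <= c * frob_sq x) ->
  forall x : 'cV_n, frob_sq (adjmx Z *m x) <= c * frob_sq x.
Proof.
move=> Zc x; set y := adjmx Z *m x.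
have [y0|yn] := eqVneq (frob_sq y) 0.
  have := Zc x; have := frob_sq_ge0 (Z *m x); rewrite y0; lra.
have yp : 0 < frob_sq y by rewrite lt_neqAle eq_sym yn frob_sq_ge0.
have : frob_sq y ^+ 2 <= frob_sq x * (c * frob_sq y).
  rewrite -{1}frob_redotxx {1}/y frob_redot_mulmxl adjmxK.
  by apply: le_trans (frob_redot_CauchySchwarz _ _) _; rewrite ler_wpM2l ?frob_sq_ge0.
by rewrite expr2 mulrA ler_pM2r // mulrC.
Qed.

Definition frob_dot m n (A B : 'M[C]_(m, n)) : C :=
  \sum_i \sum_j A i j * conjc (B i j).

Lemma frob_dotBl m n (A B D : 'M[C]_(m, n)) :
  frob_dot (A - B) D = frob_dot A D - frob_dot B D.
Proof.
rewrite -sumrB; apply: eq_bigr => i _; rewrite -sumrB; apply: eq_bigr => j _.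
by rewrite !mxE mulrBl.
Qed.

Lemma frob_dotBr m n (A B D : 'M[C]_(m, n)) :
  frob_dot D (A - B) = frob_dot D A - frob_dot D B.
Proof.
rewrite -sumrB; apply: eq_bigr => i _; rewrite -sumrB; apply: eq_bigr => j _.
by rewrite !mxE rmorphB mulrBr.
Qed.

Lemma frob_dot_CauchySchwarz m n (A B : 'M[C]_(m, n)) :
  nc (frob_dot A B) ^+ 2 <= frob_sq A * frob_sq B.
Proof.
rewrite /frob_dot /frob_sq !pair_bigA /=.
apply: le_trans (sum_CauchySchwarz _ _).
rewrite lerXn2r ?nnegrE ?normc_ge0 //.
  by apply: sumr_ge0 => i _; rewrite mulr_ge0 ?normc_ge0.
apply: le_trans (normc_sum _ _ _) _; apply: ler_sum => i _.
by rewrite Normc.normcM normc_conj.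
Qed.

Lemma frob_dot_le m n (A B : 'M[C]_(m, n)) (a b : R) : 0 <= a -> 0 <= b ->
  frob_sq A <= a ^+ 2 -> frob_sq B <= b ^+ 2 -> nc (frob_dot A B) <= a * b.
Proof.
move=> a0 b0 Aa Bb; rewrite -(ler_pXn2r (n := 2)) ?nnegrE ?normc_ge0 ?mulr_ge0 //.
by rewrite exprMn (le_trans (frob_dot_CauchySchwarz _ _)) // ler_pM ?frob_sq_ge0.
Qed.

End Frobenius.

(** * Regularised inverses *)

Section Tikhonov.
Variable R : rcfType.
Local Notation C := R[i].

(** Tikhonov regularisation.  X xi is the minimiser of
    |eta - xi|^2 + s sum_j |A_j eta|^2, that is X = (1 + s M)^-1 with
    M = sum_j A_j^* A_j.  It moves xi little where the A_j are small, and the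
    A_j composed with X are at most s^(-1/2) everywhere, as for a spectral
    projection of M, but without diagonalising M. *)
Lemma regularised_inverse N p (J : finType) (A : J -> 'M[C]_(p, N)) (s : R) :
  0 < s -> exists X : 'M[C]_N, forall xi : 'cV_N,
  [/\ frob_sq (X *m xi) <= frob_sq xi,
      s * \sum_j frob_sq (A j *m (X *m xi)) <= frob_sq xi
    & frob_sq (X *m xi - xi) <= s * \sum_j frob_sq (A j *m xi)].
Proof.
move=> s0; pose M := \sum_j adjmx (A j) *m A j.
pose U : 'M[C]_N := 1%:M + s%:C *: M.
have dM (a b : 'cV[C]_N) :
  frob_redot (M *m a) b = \sum_j frob_redot (A j *m a) (A j *m b).
  rewrite mulmx_suml frob_redot_suml; apply: eq_bigr => j _.
  by rewrite -mulmxA frob_redot_mulmxl adjmxK.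
have UE (a : 'cV[C]_N) : U *m a = a + s%:C *: (M *m a).
  by rewrite mulmxDl mul1mx scalemxAl.
have dMM (a : 'cV[C]_N) : frob_redot a (M *m a) = \sum_j frob_sq (A j *m a).
  by rewrite frob_redotC dM; apply: eq_bigr => j _; rewrite frob_redotxx.
have S0 (a : 'cV[C]_N) : 0 <= \sum_j frob_sq (A j *m a).
  by apply: sumr_ge0 => j _; exact: frob_sq_ge0.
have sU (a : 'cV[C]_N) : frob_sq (U *m a) =
    frob_sq a + 2 * s * (\sum_j frob_sq (A j *m a)) + s ^+ 2 * frob_sq (M *m a).
  by rewrite UE -[LHS]frob_redotxx !(frob_redotDl, frob_redotDr, frob_redotZl,
    frob_redotZr) !frob_redotxx
    (frob_redotC (M *m a)) dMM; ring.
have Uu : U \in unitmx.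
  rewrite -unitmx_tr -row_free_unit -kermx_eq0; apply/rowV0P => v /sub_kermxP vU.
  have /(congr1 trmx) : v *m U^T = 0 by [].
  rewrite trmx_mul trmxK trmx0 => Uv; apply: trmx_inj; rewrite trmx0.
  apply: frob_sq_eq0; apply/eqP; rewrite eq_le frob_sq_ge0 andbT.
  have := sU v^T; rewrite Uv frob_sq0.
  have := S0 v^T; have := frob_sq_ge0 (M *m v^T); have := sqr_ge0 s => a b c.
  have := mulr_ge0 (ltW s0) c; have := mulr_ge0 a b; lra.
exists (invmx U) => xi; set e := invmx U *m xi.
have -> : xi = U *m e by rewrite mulKVmx.
have m0 := frob_sq_ge0 (M *m e).
have sM : 0 <= s ^+ 2 * frob_sq (M *m e) by rewrite mulr_ge0 // sqr_ge0.
have sA := mulr_ge0 (ltW s0) (S0 e).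
split.
- by rewrite sU; lra.
- by rewrite sU; have := frob_sq_ge0 e; lra.
rewrite {1}UE opprD addrA subrr add0r frob_sqN frob_sqZ normc_real ?(ltW s0) //.
have -> : \sum_j frob_sq (A j *m (U *m e)) = \sum_j frob_sq (A j *m e) +
    2 * s * frob_sq (M *m e) + s ^+ 2 * \sum_j frob_sq (A j *m (M *m e)).
  rewrite -[in RHS](frob_redotxx (M *m e)) dM !mulr_sumr -!big_split /=.
  apply: eq_bigr => j _; rewrite UE mulmxDr -scalemxAr.
  by rewrite -[LHS]frob_redotxx !(frob_redotDl, frob_redotDr, frob_redotZl,
    frob_redotZr) !frob_redotxx
    (frob_redotC (A j *m (M *m e))); ring.
have := mulr_ge0 (mulr_ge0 (sqr_ge0 s) (ltW s0)) (S0 (M *m e)).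
have := sA; rewrite !mulrDr; set a := \sum_j _; set b := \sum_j _ => *.
by nra.
Qed.

End Tikhonov.

(** * Involutions acting locally as on a regular tree *)

Section Walk.
Local Open Scope nat_scope.
Variables (r L : nat).

Definition reduced (w : seq 'I_r) : bool := sorted [rel a b | a != b] w.

(** Left multiplication by the k-th generator in the free product of r copies
    of Z/2, on reduced words. *)
Definition walk (k : 'I_r) (w : seq 'I_r) : seq 'I_r :=
  if w is a :: w' then if a == k then w' else k :: w else [:: k].

Lemma reduced_walk k w : reduced w -> reduced (walk k w).
Proof.
case: w => //= a w; case: (eqVneq a k) => [_|ak].
  by apply: path_sorted.
by rewrite /reduced /= eq_sym ak.
Qed.

Lemma walkK k w : reduced w -> walk k (walk k w) = w.
Proof.
case: w => [|a w] /=; first by rewrite eqxx.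
case: (eqVneq a k) => [->|ak _]; last by rewrite /= eqxx.
by case: w => [|b w] //= /andP[/negPf]; rewrite eq_sym => ->.
Qed.

(** Staying put both at the boundary of the ball of radius L and on words that
    are not reduced makes this an involution of a finite set. *)
Definition bwalk (k : 'I_r) (w : L.-bseq 'I_r) : L.-bseq 'I_r :=
  if reduced w then insubd w (walk k w) else w.

Lemma val_bwalk k (w : L.-bseq 'I_r) : reduced w ->
  bwalk k w = (if size (walk k w) <= L then walk k w else w) :> seq 'I_r.
Proof. by move=> rw; rewrite /bwalk rw val_insubd. Qed.

Lemma bwalkK k : involutive (bwalk k).
Proof.
move=> w; have [rw|rw] := boolP (reduced w); last first.
  by rewrite /bwalk (negPf rw) (negPf rw).
have H := val_bwalk k rw; apply: val_inj => /=.
case: ifPn H => [sL H|sL H].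
  rewrite val_bwalk H ?reduced_walk // walkK // ifT //.
  exact: (valP w).
by rewrite val_bwalk H // (negPf sL).
Qed.

End Walk.

Section TreeLike.
Local Open Scope nat_scope.

(** The involutions are right translations on the group Gamma of all
    permutations of the words of length at most L.  Seen from g, the place of h
    is the word (g^-1 h)(empty word); multiplying h by a generator moves this
    word along the tree, faithfully as long as it stays shorter than L.
    [S q g h] says that the word is reduced of length at most q, and [hd g h] is
    its first letter.  Passing from words to Gamma makes all vertices g
    alike, which words near the boundary of the ball are not. *)
Lemma tree_like_involutions (r L : nat) :
  exists N (sg : 'I_r -> 'I_N -> 'I_N) (S : nat -> 'I_N -> 'I_N -> bool)
    (hd : 'I_N -> 'I_N -> option 'I_r),
  [/\ 0 < N, forall k, involutive (sg k),
      forall g, S 0 g g /\ hd g g = None,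
      forall q g h k, q < L -> S q g h -> S q.+1 g (sg k h)
    & forall q g h k, q < L -> S q g h -> hd g h != Some k ->
        hd g (sg k h) = Some k].
Proof.
pose V := L.-bseq 'I_r; pose G := {perm V}.
pose e : V := [bseq].
pose a k : G := perm (inv_inj (@bwalkK r L k)).
pose N := #|G|.
pose pos (g h : G) : V := (g^-1 * h)%g e.
pose sg k (h : 'I_N) : 'I_N := enum_rank (enum_val h * a k)%g.
pose p (g h : 'I_N) : V := pos (enum_val g) (enum_val h).
have psg g h k : p g (sg k h) = bwalk k (p g h).
  by rewrite /p /sg /pos enum_rankK mulgA permM permE.
exists N, sg, (fun q g h => reduced (p g h) && (size (p g h) <= q)),
  (fun g h => ohead (p g h)); split.
- by apply/card_gt0P; exists 1%g.
- move=> k h; rewrite /sg enum_rankK -mulgA (_ : (a k * a k)%g = 1%g).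
    by rewrite mulg1 enum_valK.
  by apply/permP => w; rewrite permM !permE bwalkK.
- by move=> g; rewrite /p /pos mulVg perm1.
- move=> q g h k qL /andP[rp sp]; rewrite psg val_bwalk //.
  have st : size (walk k (p g h)) <= q.+1.
    case: (val (p g h)) sp => [|b w] //= sw.
    by case: ifP => //= _; exact: leqW (ltnW sw).
  by rewrite (leq_trans st qL) reduced_walk.
- move=> q g h k qL /andP[rp sp] hk; rewrite psg val_bwalk //.
  move: sp hk; case: (val (p g h)) => [|b w] //= sw bk.
    by rewrite (leq_ltn_trans _ qL).
  have -> : (b == k) = false by apply: contraNF bk => /eqP ->.
  by rewrite /= (leq_ltn_trans sw qL).
Qed.

End TreeLike.

(** * Sums of Hermitian matrices over tree-like involutions *)

(** [S q g h] reads: h lies in the ball of radius q around g.  [hd g h] is the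
    label of the edge leading from h back towards g. *)
Section PermSum.
Variables (R : realType).
Local Notation C := R[i].
Variables (N D r L : nat) (sg : 'I_r -> 'I_N -> 'I_N).
Variables (S : nat -> 'I_N -> 'I_N -> bool) (hd : 'I_N -> 'I_N -> option 'I_r).
Hypothesis sgK : forall k, involutive (sg k).
Hypothesis S0 : forall g, S 0 g g.
Hypothesis SS : forall q g h k, (q < L)%N -> S q g h -> S q.+1 g (sg k h).
Hypothesis hdS : forall q g h k, (q < L)%N -> S q g h -> hd g h != Some k ->
        hd g (sg k h) = Some k.
Variables (z : 'I_r -> 'M[C]_D) (K : R).
Hypothesis K0 : 0 < K.
Hypothesis zH : forall k, adjmx (z k) = z k.
Hypothesis zK : forall v : 'rV_D, \sum_k frob_sq (v *m z k) <= K ^+ 2 * frob_sq v.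

(** The hypothesis zK bounds the map v |-> (v z_k)_k; as the z_k are Hermitian,
    this is the adjoint of (v_k)_k |-> sum_k v_k z_k. *)
Lemma frob_sq_row_bound (P : pred 'I_r) (v : 'I_r -> 'rV[C]_D) :
  frob_sq (\sum_(k | P k) v k *m z k) <= K ^+ 2 * \sum_(k | P k) frob_sq (v k).
Proof.
set w := \sum_(k | P k) _.
have K2 : 0 < K ^+ 2 by rewrite exprn_gt0.
have H : \sum_(k | P k) 2 * frob_redot (v k) (w *m z k) <=
    \sum_(k | P k) (K ^+ 2 * frob_sq (v k) + K ^- 2 * frob_sq (w *m z k)).
  by apply: ler_sum => i _; exact: frob_redot_AGM.
have E : \sum_(k | P k) 2 * frob_redot (v k) (w *m z k) = 2 * frob_sq w.
  rewrite -frob_redotxx {1}/w frob_redot_suml mulr_sumr; apply: eq_bigr => k _.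
  by rewrite frob_redot_mulmxr zH.
rewrite E big_split /= -!mulr_sumr in H.
have : K ^- 2 * \sum_(k | P k) frob_sq (w *m z k) <= frob_sq w.
  rewrite ler_pdivrMl //; apply: le_trans (zK w).
  by rewrite [leRHS](bigID P) /= lerDl sumr_ge0 // => k _; exact: frob_sq_ge0.
by lra.
Qed.

(** The operator sum_k a_k (x) z_k, where a_k permutes coordinates by [sg k]; a
    vector of C^N (x) C^D is an N x D matrix. *)
Definition perm_sum (x : 'M[C]_(N, D)) : 'M[C]_(N, D) :=
  \sum_k rowsub (sg k) x *m z k.

Lemma row_perm_sum x h : row h (perm_sum x) = \sum_k row (sg k h) x *m z k.
Proof.
rewrite linear_sum; apply: eq_bigr => k _ /=.
by rewrite row_mul row_rowsub.
Qed.

Lemma perm_sum_is_linear : linear perm_sum.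
Proof.
move=> a x y; rewrite /perm_sum scaler_sumr -big_split; apply: eq_bigr => k _ /=.
by rewrite linearP /= mulmxDl scalemxAl.
Qed.

HB.instance Definition _ := GRing.isLinear.Build C _ _ _ perm_sum perm_sum_is_linear.

Lemma perm_sum_selfadjoint x y :
  frob_redot (perm_sum x) y = frob_redot x (perm_sum y).
Proof.
rewrite frob_redot_suml frob_redot_sumr; apply: eq_bigr => k _.
rewrite frob_redot_mulmxr zH /frob_redot (reindex_inj (inv_inj (sgK k))) /=.
apply: eq_bigr => i _; apply: eq_bigr => j _.
rewrite mxE sgK; congr (_ * complex.Re _ + _ * complex.Im _);
  by rewrite !mxE; apply: eq_bigr => l _; rewrite mxE.
Qed.

Definition supported q g (x : 'M[C]_(N, D)) := forall h, ~~ S q g h -> row h x = 0.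

Lemma supported_perm_sum q g x :
  (q < L)%N -> supported q g x -> supported q.+1 g (perm_sum x).
Proof.
move=> qL lx h nS; rewrite row_perm_sum big1 // => k _; rewrite lx ?mul0mx //.
by apply: contra nS => /(SS k qL); rewrite sgK.
Qed.

(** Around h, one edge leads back towards g and the others lead away.  The
    part of the sum over the edges leading back is bounded by zK, since it has
    one term for each h, and the part over the edges leading away by
    [frob_sq_row_bound], since it uses each value of x once; each contributes
    K, and 4 K^2 = (K + K)^2. *)
Lemma perm_sum_tree_bound q g x : (q < L)%N -> supported q g x ->
  frob_sq (perm_sum x) <= 4 * K ^+ 2 * frob_sq x.
Proof.
move=> qL lx.
pose A h := \sum_(k | hd g h == Some k) row (sg k h) x *m z k.
pose B h := \sum_(k | hd g h != Some k) row (sg k h) x *m z k.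
have rT h : row h (perm_sum x) = A h + B h.
  by rewrite row_perm_sum (bigID (fun k => hd g h == Some k)).
have HA : \sum_h frob_sq (A h) <= K ^+ 2 * frob_sq x.
  apply: (@le_trans _ _ (\sum_h \sum_k frob_sq (row (sg k h) x *m z k))).
    apply: ler_sum => h _; rewrite /A; case: (hd g h) => [k|]; last first.
      by rewrite big_pred0 // frob_sq0 sumr_ge0 // => k _; exact: frob_sq_ge0.
    rewrite (eq_bigl (pred1 k)) ?big_pred1_eq; last first.
      by move=> l; rewrite /= eq_sym; apply/eqP/eqP => [[]|->].
    by rewrite (bigD1 k) //= lerDl sumr_ge0 // => l _; exact: frob_sq_ge0.
  rewrite exchange_big /=.
  under eq_bigr => k _ do rewrite (reindex_inj (inv_inj (sgK k))) /=.
  rewrite exchange_big frob_sq_row mulr_sumr; apply: ler_sum => h _ /=.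
  by under eq_bigr do rewrite sgK; exact: zK.
have HB : \sum_h frob_sq (B h) <= K ^+ 2 * frob_sq x.
  apply: (@le_trans _ _ (K ^+ 2 * \sum_h \sum_(k | hd g h != Some k)
      frob_sq (row (sg k h) x))).
    by rewrite mulr_sumr; apply: ler_sum => h _; exact: frob_sq_row_bound.
  rewrite ler_pM2l ?exprn_gt0 // (exchange_big_dep xpredT) //=.
  under eq_bigr => k _ do rewrite (reindex_inj (inv_inj (sgK k))) /=.
  rewrite (exchange_big_dep xpredT) //= frob_sq_row; apply: ler_sum => h _.
  under eq_bigr do rewrite sgK.
  have [Sh|nSh] := boolP (S q g h); last by rewrite lx // frob_sq0 big1.
  have hk k : hd g (sg k h) != Some k -> hd g h == Some k.
    by apply: contraNT => /(hdS qL Sh) ->.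
  rewrite (@le_trans _ _ (\sum_(k | hd g h == Some k) frob_sq (row h x))) //.
    rewrite big_mkcond [leRHS]big_mkcond /=; apply: ler_sum => k _.
    case: ifPn => [/hk ->//|_]; case: ifP => // _; exact: frob_sq_ge0.
  case: (hd g h) => [k|]; last by rewrite big_pred0 // frob_sq_ge0.
  by rewrite (eq_bigl (pred1 k)) ?big_pred1_eq // => l; rewrite /= eq_sym.
have : frob_sq (perm_sum x) <= \sum_h (2 * frob_sq (A h) + 2 * frob_sq (B h)).
  by rewrite frob_sq_row; apply: ler_sum => h _; rewrite rT; exact: frob_sqD_le2.
rewrite big_split /= -!mulr_sumr; lra.
Qed.

(** Starting from a point mass, q <= L steps stay where the tree bound applies. *)
Lemma iter_perm_sum_tree_bound q g (v : 'rV_D) : (q <= L)%N ->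
  frob_sq (iter q perm_sum (delta_mx g (0 : 'I_1) *m v)) <=
    (4 * K ^+ 2) ^+ q * frob_sq v.
Proof.
move=> qL; set x := _ *m v.
suff [] : supported q g (iter q perm_sum x) /\
   frob_sq (iter q perm_sum x) <= (4 * K ^+ 2) ^+ q * frob_sq v by [].
elim: q qL => [_|q IH qL].
  split=> [h|].
    rewrite /= row_mul => hg; rewrite (_ : row h _ = 0) ?mul0mx //.
    apply/rowP => j; rewrite !mxE; case: eqP => [hgE|//].
    by move: hg; rewrite hgE S0.
  rewrite expr0 mul1r frob_sq_row (bigD1 g) //= big1 ?addr0 => [|h hg].
    rewrite row_mul (_ : row g _ = 1%:M) ?mul1mx //.
    by apply/rowP => j; rewrite !mxE !ord1 !eqxx.
  rewrite row_mul (_ : row h _ = 0) ?mul0mx ?frob_sq0 //.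
  by apply/rowP => j; rewrite !mxE (negPf hg).
have [IH1 IH2] := IH (ltnW qL); split; first exact: supported_perm_sum.
rewrite iterS (le_trans (perm_sum_tree_bound qL IH1)) //
  [X in _ <= X * _]exprS -[leRHS]mulrA.
by rewrite ler_pM2l // mulr_gt0 // exprn_gt0.
Qed.

Lemma iter_perm_sum_is_linear q : linear (iter q perm_sum).
Proof. by elim: q => [|q IH] a x y //=; rewrite IH linearP. Qed.

HB.instance Definition _ q :=
  GRing.isLinear.Build C _ _ _ (iter q perm_sum) (iter_perm_sum_is_linear q).

Lemma iter_perm_sum_selfadjoint q x y :
  frob_redot (iter q perm_sum x) y = frob_redot x (iter q perm_sum y).
Proof. by elim: q x y => [|q IH] x y //;
  rewrite iterS perm_sum_selfadjoint IH iterSr. Qed.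

(** Log-convexity: |T^m x|^2 = <x, T^(2m) x> <= |x| |T^(2m) x|; iterate along
    m = 1, 2, 4, ... *)
Lemma perm_sum_moment t x (c : R) : frob_sq x <= c ->
  frob_sq (perm_sum x) ^+ (2 ^ t) <=
    frob_sq (iter (2 ^ t) perm_sum x) * c ^+ (2 ^ t).-1.
Proof.
move=> xc; have c0 := le_trans (frob_sq_ge0 x) xc.
elim: t => [|t IH]; first by rewrite !expn0 /= expr1 expr0 mulr1.
have E : (2 ^ t.+1 = 2 ^ t + 2 ^ t)%N by rewrite expnS mul2n addnn.
have E1 : ((2 ^ t.+1).-1 = (2 ^ t).-1 + (2 ^ t).-1 + 1)%N.
  by have := expn_gt0 2 t; rewrite E; case: (2 ^ t)%N => //= n _; rewrite addnS addn1.
rewrite {1}E exprD E1.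
apply: (@le_trans _ _ ((frob_sq (iter (2 ^ t) perm_sum x) * c ^+ (2 ^ t).-1) ^+ 2)).
  by rewrite -expr2 lerXn2r ?nnegrE ?mulr_ge0 ?exprn_ge0 ?frob_sq_ge0.
have H : frob_sq (iter (2 ^ t) perm_sum x) ^+ 2 <=
  frob_sq (iter (2 ^ t.+1) perm_sum x) * c.
  rewrite -{1}frob_redotxx iter_perm_sum_selfadjoint -iterD -E (le_trans
    (frob_redot_CauchySchwarz _ _)) //.
  by rewrite mulrC ler_wpM2l ?frob_sq_ge0.
rewrite exprMn !exprD expr1 -expr2 [X in _ <= _ * X]mulrC [leRHS]mulrA.
by rewrite ler_wpM2r // exprn_ge0 // exprn_ge0.
Qed.

End PermSum.

(** * Matrices that behave asymptotically as free unitaries *)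

Section AsymptoticallyFree.
Variable R : realType.
Local Notation C := R[i].
Local Notation nc := (@Normc.normc R).

Lemma exp_unbounded (e M : R) : 0 < e -> exists t, M <= (1 + e) ^+ (2 ^ t).
Proof.
move=> e0; have [n Mn] : exists n : nat, M / e <= n%:R.
  by exists (Num.truncn (M / e)).+1; rewrite ltW // truncnS_gt.
exists n; rewrite ler_pdivrMr // in Mn.
apply: (le_trans Mn).
have Bern m : m%:R * e <= (1 + e) ^+ m.
  suff : 1 + m%:R * e <= (1 + e) ^+ m by apply: le_trans; rewrite lerDr.
  elim: m => [|m IH]; first by rewrite mul0r addr0 expr0.
  rewrite exprS (@le_trans _ _ ((1 + e) * (1 + m%:R * e))) //; last first.
    by rewrite ler_wpM2l // addr_ge0 // ltW.
  rewrite -natr1; have := ler0n R m; move=> m0.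
  have := mulr_ge0 m0 (mulr_ge0 (ltW e0) (ltW e0)); lra.
apply: le_trans (Bern _) _; rewrite ler_weXn2l //; first by rewrite lerDl ltW.
exact/ltnW/ltn_expl.
Qed.

(** The matrices are b_k = a_k X with X from [regularised_inverse] applied to
    A_j = T^q (. (x) e_j).  The size D of the coefficients enters only through a
    factor independent of q, which the 2q-th root makes harmless. *)
Lemma asymptotically_free_hermitian (r D : nat) (z : 'I_r -> 'M[C]_D) (K e : R) :
  0 < K -> 0 < e -> (forall k, adjmx (z k) = z k) ->
  (forall v : 'rV_D, \sum_k frob_sq (v *m z k) <= K ^+ 2 * frob_sq v) ->
  exists N (b : 'I_r -> 'M[C]_N), [/\ (0 < N)%N,
    forall x : 'M[C]_(N, D),
      frob_sq (\sum_k b k *m x *m z k) <= 4 * K ^+ 2 * (1 + e) * frob_sq x,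
    forall k (x : 'cV_N), frob_sq (b k *m x) <= frob_sq x
  & forall k l, nc (frob_dot (b k) (b l) - (N * (k == l))%:R) <= e * N%:R].
Proof.
move=> K0 e0 zH zK.
(* Two errors of size sqrt dl enter each trace inner product. *)
pose dl : R := (e / 2) ^+ 2.
have dl0 : 0 < dl by rewrite exprn_gt0 // divr_gt0.
have [t tE] := exp_unbounded (D.+1%:R ^+ 2 / dl) e0.
pose q := (2 ^ t)%N.
have [N [sg [S [hd [N0 sgK S0 SS hdS]]]]] := tree_like_involutions r q.
pose F := 4 * K ^+ 2.
have F0 : 0 < F by rewrite mulr_gt0 // exprn_gt0.
pose Tq := iter q (perm_sum sg z).
have TqL : linear Tq := @iter_perm_sum_is_linear R N D r sg z q.
pose TqM := GRing.isLinear.Build C _ _ _ Tq TqL.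
pose Tl : {linear 'M[C]_(N, D) -> 'M[C]_(N, D)} := HB.pack Tq TqM.
pose ej (j : 'I_D) : 'rV[C]_D := delta_mx 0 j.
pose A (j : 'I_D) : 'M[C]_(N * D, N) :=
  \matrix_(p, h) mxvec (Tq (delta_mx h (0 : 'I_1) *m ej j)) 0 p.
have AE j (xi : 'cV[C]_N) : frob_sq (A j *m xi) = frob_sq (Tq (xi *m ej j)).
  have -> : A j *m xi = (mxvec (Tq (xi *m ej j)))^T.
    have -> : xi *m ej j = \sum_h xi h 0 *: (delta_mx h (0 : 'I_1) *m ej j).
      rewrite {1}(matrix_sum_delta xi) mulmx_suml; apply: eq_bigr => h _.
      by rewrite big_ord1 scalemxAl.
    rewrite -[Tq _]/(Tl _) linear_sum linear_sum /=.
    apply/matrixP => p i; rewrite !mxE summxE ord1; apply: eq_bigr => h _.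
    by rewrite !mxE -[Tq (_ *: _)]/(Tl _) linearZ linearZ mxE mulrC.
  rewrite /frob_sq; set w := Tq _.
  under eq_bigr do rewrite big_ord1 mxE.
  rewrite (reindex _ (curry_mxvec_bij _ _)) /= pair_bigA /=.
  by apply: eq_bigr => -[i j'] _ /=; rewrite mxvecE.
(* m0 bounds the sum of the |A_j delta_g|^2, so X moves delta_g by sqrt dl. *)
pose m0 : R := D.+1%:R * F ^+ q.
have m00 : 0 < m0 by rewrite mulr_gt0 ?ltr0n ?exprn_gt0.
pose s := dl / m0.
have s0 : 0 < s by rewrite divr_gt0.
have [X HX] := regularised_inverse A s0.
have Tdelta g j : frob_sq (Tq (delta_mx g (0 : 'I_1) *m ej j)) <= F ^+ q.
  have sej : frob_sq (ej j) = 1.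
    rewrite /frob_sq big_ord1 (bigD1 j) //= big1 => [|i ij].
      by rewrite !mxE !eqxx Normc.normc1 expr1n addr0.
    by rewrite !mxE (negPf ij) andbF Normc.normc0 expr0n.
  have [S0' _] := all_and2 S0.
  have := @iter_perm_sum_tree_bound R N D r q sg S hd sgK S0' SS hdS z K K0 zH
    zK q g (ej j) (leqnn q).
  by rewrite sej mulr1.
have Xdelta g : frob_sq (X *m delta_mx g (0 : 'I_1) - delta_mx g 0) <= dl.
  have [_ _ H] := HX (delta_mx g 0); apply: le_trans H _.
  rewrite /s -mulrA ler_piMr ?(ltW dl0) // mulrC ler_pdivrMr // mul1r /m0.
  apply: (@le_trans _ _ (\sum_(j < D) F ^+ q)).
    by apply: ler_sum => j _; rewrite AE.
  rewrite sumr_const card_ord -[leLHS]mulr_natl ler_wpM2r ?exprn_ge0 ?(ltW F0) //.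
  by rewrite ler_nat.
have X1 : frob_sq (X - 1%:M) <= N%:R * dl.
  rewrite frob_sq_col (@le_trans _ _ (\sum_(g < N) dl)) //; last first.
    by rewrite sumr_const card_ord -[leLHS]mulr_natl.
  apply: ler_sum => g _; rewrite colE mulmxBl mul1mx; exact: Xdelta.
have XN n (x : 'M[C]_(N, n)) : frob_sq (X *m x) <= frob_sq x.
  rewrite frob_sq_col [leRHS]frob_sq_col; apply: ler_sum => j _.
  by rewrite [col j (X *m x)]colE -mulmxA -colE; have [] := HX (col j x).
pose b k : 'M[C]_N := rowsub (sg k) X.
have sgI k := inv_inj (sgK k).
have bE k n (x : 'M[C]_(N, n)) : b k *m x = rowsub (sg k) (X *m x).
  by rewrite mul_rowsub_mx.
exists N, b; split => //.
- move=> x.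
  have -> : \sum_k b k *m x *m z k = perm_sum sg z (X *m x).
    by apply: eq_bigr => k _; rewrite bE.
  have q0 : (0 < q)%N by rewrite expn_gt0.
  have x0 := frob_sq_ge0 x.
  rewrite -(ler_pXn2r q0) ?nnegrE ?frob_sq_ge0 //; last first.
    by rewrite mulr_ge0 // mulr_ge0 ?(ltW F0) // addr_ge0 // ltW.
  apply: (le_trans (@perm_sum_moment R N D r sg sgK z zH t (X *m x) (frob_sq x)
    (XN _ _))).
  have H : frob_sq (Tq (X *m x)) <= (D.+1%:R ^+ 2 / dl) * F ^+ q * frob_sq x.
    have -> : X *m x = \sum_(j < D) (X *m col j x) *m ej j.
      apply/matrixP => g i; rewrite summxE (bigD1 i) //= big1 => [|j ji].
        by rewrite addr0 mxE [RHS]mxE big_ord1 !mxE !eqxx mulr1;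
          apply: eq_bigr => h _; rewrite mxE.
      by rewrite mxE big_ord1 !mxE [i == j]eq_sym (negPf ji) andbF mulr0.
    rewrite -[Tq _]/(Tl _) linear_sum /=; apply: le_trans (frob_sq_sum_le _) _.
    rewrite card_ord.
    apply: (@le_trans _ _ (D%:R * \sum_(j < D) s^-1 * frob_sq (col j x))).
      rewrite ler_wpM2l //; apply: ler_sum => j _; rewrite ler_pdivlMl //.
      have [_ H _] := HX (col j x); apply: le_trans H; rewrite ler_wpM2l ?(ltW s0) //.
      rewrite (bigD1 j) //= -AE lerDl sumr_ge0 // => i _; exact: frob_sq_ge0.
    rewrite -mulr_sumr -frob_sq_col mulrA ler_wpM2r //.
    rewrite /s invf_div /m0 !mulrA [_ * F ^+ q / dl]mulrAC.
    rewrite ler_wpM2r ?exprn_ge0 ?(ltW F0) // ler_wpM2r ?invr_ge0 ?(ltW dl0) //.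
    by rewrite expr2 ler_wpM2r // ler_nat.
  apply: (@le_trans _ _ ((D.+1%:R ^+ 2 / dl) * F ^+ q * frob_sq x * frob_sq x
    ^+ q.-1)).
    by rewrite ler_wpM2r ?exprn_ge0.
  rewrite -mulrA -exprS prednK // -/F.
  have -> : (F * (1 + e) * frob_sq x) ^+ q = (1 + e) ^+ q * F ^+ q * frob_sq x ^+ q.
    by rewrite exprMn [(F * _) ^+ q]exprMn [X in X * _]mulrC.
  by rewrite ler_wpM2r ?exprn_ge0 // ler_wpM2r ?exprn_ge0 // ltW.
- by move=> k x; rewrite bE frob_sq_rowsub.
move=> k l.
pose I1 k : 'M[C]_N := rowsub (sg k) 1%:M.
have bI j : frob_sq (b j - I1 j) <= N%:R * dl.
  by rewrite -[b j - _]linearB /= frob_sq_rowsub.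
have sI m : frob_sq (1%:M : 'M[C]_m) = m%:R.
  rewrite /frob_sq (eq_bigr (fun=> 1)) ?sumr_const ?card_ord // => i _.
  rewrite (bigD1 i) //= big1 => [|j ji].
    by rewrite mxE eqxx Normc.normc1 expr1n addr0.
  by rewrite mxE eq_sym (negPf ji) Normc.normc0 expr0n.
have hI : frob_dot (I1 k) (I1 l) = (N * (k == l))%:R.
  rewrite /frob_dot (eq_bigr (fun=> (k == l)%:R)) => [|g _].
    by rewrite sumr_const card_ord -[LHS]mulr_natl natrM.
  rewrite (bigD1 (sg k g)) //= big1 => [|j ji]; last first.
    by rewrite !mxE [_ == j]eq_sym (negPf ji) mul0r.
  rewrite !mxE eqxx mul1r addr0 rmorph_nat; congr (_ %:R); congr nat_of_bool.
  have [->|kl] := eqVneq k l; first by rewrite eqxx.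
  apply/negP => /eqP E; have [S0g hdg] := S0 g.
  have q0 : (0 < q)%N by rewrite expn_gt0.
  have nk j : hd g g != Some j by rewrite hdg.
  have := hdS 0%N g g k q0 S0g (nk k).
  rewrite -E (hdS 0%N g g l q0 S0g (nk l)) => -[lk].
  by rewrite lk eqxx in kl.
have -> : frob_dot (b k) (b l) - (N * (k == l))%:R =
    frob_dot (b k - I1 k) (b l) + frob_dot (I1 k) (b l - I1 l).
  by rewrite frob_dotBl frob_dotBr hI; ring.
have Nsq : Num.sqrt N%:R ^+ 2 = N%:R :> R by rewrite sqr_sqrtr.
have rN : 0 <= Num.sqrt (N%:R : R) by exact: sqrtr_ge0.
have e20 : 0 <= e / 2 by rewrite divr_ge0 // ltW.
have sb : frob_sq (b l) <= Num.sqrt N%:R ^+ 2.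
  by rewrite frob_sq_rowsub // -[X]mulmx1 (le_trans (XN _ _)) // sI Nsq.
have dE j : frob_sq (b j - I1 j) <= (Num.sqrt N%:R * (e / 2)) ^+ 2.
  by rewrite exprMn Nsq.
have si : frob_sq (I1 k) <= Num.sqrt N%:R ^+ 2.
  by rewrite frob_sq_rowsub // sI Nsq.
apply: le_trans (normcD _ _) _.
have := frob_dot_le (mulr_ge0 rN e20) rN (dE k) sb.
have := frob_dot_le rN (mulr_ge0 rN e20) si (dE l).
rewrite mulrA -expr2 Nsq (mulrAC _ _ (Num.sqrt N%:R)) -expr2 Nsq; lra.
Qed.

(** Points rounded towards 0, so that the net of the unit ball built from these
    stays in the unit ball. *)
Lemma interval_net (L : nat) (x : R) : (0 < L)%N -> `|x| <= 1 ->
  exists p : bool * 'I_L.+1, let c := (-1) ^+ p.1 * (p.2%:R / L%:R) in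
    `|c| <= `|x| /\ `|x - c| <= L%:R^-1.
Proof.
move=> L0 x1; have L0' : 0 < L%:R :> R by rewrite ltr0n.
have xL : 0 <= `|x| * L%:R by rewrite mulr_ge0.
have /andP[k1 k2] := truncn_itv xL; set k := Num.truncn _ in k1 k2.
have kL : (k < L.+1)%N.
  by rewrite ltnS -(ler_nat R) (le_trans k1) // ler_piMl.
have Nk : `|k%:R / L%:R| = k%:R / L%:R :> R.
  by rewrite ger0_norm // divr_ge0.
exists (x < 0, Ordinal kL) => /=; split.
  by rewrite normrM normr_sign mul1r Nk ler_pdivrMr.
have {1}-> : x = (-1) ^+ (x < 0)%R * `|x|.
  by have [x0|x0] := ltrP x 0; [rewrite ltr0_norm // expr1 mulN1r opprK|
    rewrite ger0_norm // expr0 mul1r].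
rewrite -mulrBr normrM normr_sign mul1r ger0_norm ?subr_ge0 ?ler_pdivrMr //.
by rewrite lerBlDl -[X in _ + X]mul1r -mulrDl natr1 ler_pdivlMr // ltW.
Qed.

Lemma disc_net (tau : R) : 0 < tau ->
  exists (I : finType) (c : I -> C), forall z, nc z <= 1 ->
    exists s, nc (c s) <= nc z /\ nc (z - c s) <= tau.
Proof.
move=> t0; pose L := (Num.truncn (2 / tau)).+1.
have L0 : (0 : R) < L%:R by rewrite ltr0n.
have Lt : 2 * L%:R^-1 <= tau.
  by rewrite ler_pdivrMr // mulrC -ler_pdivrMr // ltW // truncnS_gt.
pose c1 (p : bool * 'I_L.+1) : R := (-1) ^+ p.1 * (p.2%:R / L%:R).
exists ((bool * 'I_L.+1) * (bool * 'I_L.+1))%type.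
exists (fun p => (c1 p.1 +i* c1 p.2)) => -[a b] ab1.
have S (x y : R) : nc (x +i* y) ^+ 2 = `|x| ^+ 2 + `|y| ^+ 2.
  by rewrite normc_sq /= !real_normK ?num_real.
have M (x y x' y' : R) : `|x| <= `|x'| -> `|y| <= `|y'| ->
    nc (x +i* y) <= nc (x' +i* y').
  move=> xx yy; rewrite -(ler_pXn2r (n := 2)) ?nnegrE ?normc_ge0 //.
  by rewrite !S lerD // lerXn2r ?nnegrE.
have a1 : `|a| <= 1.
  apply: le_trans ab1; have := M a 0 a b (lexx _);
    rewrite normr0 => /(_ (normr_ge0 _)).
  by rewrite /= expr0n addr0 sqrtr_sqr.
have b1 : `|b| <= 1.
  apply: le_trans ab1; have := M 0 b a b;
    rewrite normr0 => /(_ (normr_ge0 _) (lexx _)).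
  by rewrite /= expr0n add0r sqrtr_sqr.
have [p [p1 p2]] := interval_net (isT : (0 < L)%N) a1.
have [p' [p1' p2']] := interval_net (isT : (0 < L)%N) b1.
exists (p, p'); split; first exact: M.
rewrite [X in nc X](_ : _ = (a - c1 p)%:C + (0 +i* (b - c1 p')) :> C); last first.
  by apply/eqP; rewrite eq_complex /= addr0 add0r !eqxx.
apply: le_trans (normcD _ _) _ => /=.
rewrite !expr0n /= addr0 add0r !sqrtr_sqr.
by rewrite (le_trans (lerD p2 p2')) // -mulr2n -[leLHS]mulr_natl.
Qed.

Lemma ball_net (r : nat) (tau : R) : 0 < tau ->
  exists m (t : 'I_m -> 'I_r -> C),
    (forall s, \sum_k nc (t s k) ^+ 2 <= 1) /\
    forall u : 'I_r -> C, \sum_k nc (u k) ^+ 2 <= 1 ->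
      exists s, forall k, nc (u k - t s k) <= tau.
Proof.
move=> t0; have [I [c cI]] := disc_net t0.
pose J := {ffun 'I_r -> I}.
pose ok (f : J) := \sum_k nc (c (f k)) ^+ 2 <= 1.
exists #|J|, (fun s k => if ok (enum_val s) then c (enum_val s k) else 0); split.
  move=> s; have [//|_] := boolP (ok _).
  by rewrite big1 // => k _; rewrite Normc.normc0 expr0n.
move=> u u1; have uk k : nc (u k) <= 1.
  rewrite -(ler_pXn2r (n := 2)) ?nnegrE ?normc_ge0 // expr1n (le_trans _ u1) //.
  by rewrite (bigD1 k) //= lerDl sumr_ge0 // => i _; rewrite sqr_ge0.
have [g gP] := fin_all_exists (fun k => cI _ (uk k)).
pose f : J := [ffun k => g k].
have fE k : nc (c (f k)) <= nc (u k) /\ nc (u k - c (f k)) <= tau.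
  by rewrite ffunE; exact: gP.
exists (enum_rank f) => k; rewrite enum_rankK ifT; first by have [] := fE k.
apply: le_trans u1; apply: ler_sum => i _.
by rewrite lerXn2r ?nnegrE ?normc_ge0 //; have [] := fE i.
Qed.

(** Both estimates are instances of [asymptotically_free_hermitian] for one
    family: the coefficients y_k and, on further diagonal blocks, the scalars
    K t_k for t in a finite net of the unit ball of C^r.  The off-diagonal
    block trick makes the coefficients Hermitian. *)
Lemma asymptotically_free_matrices (r d : nat) (y : 'I_r -> 'M[C]_d) (K e : R) :
  0 < K -> 0 < e ->
  (forall v : 'rV_d, \sum_k frob_sq (v *m y k) <= K ^+ 2 * frob_sq v) ->
  (forall v : 'rV_d, \sum_k frob_sq (v *m adjmx (y k)) <= K ^+ 2 * frob_sq v) ->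
  exists N (b : 'I_r -> 'M[C]_N),
    [/\ (0 < N)%N,
        forall x : 'M[C]_(N, d),
          frob_sq (\sum_k b k *m x *m y k) <= 4 * K ^+ 2 * (1 + e) * frob_sq x,
        forall (u : 'I_r -> C) (x : 'cV_N),
          frob_sq (\sum_k u k *: (b k *m x)) <=
            4 * (1 + e) * (\sum_k nc (u k) ^+ 2) * frob_sq x,
        forall k (x : 'cV_N), frob_sq (b k *m x) <= frob_sq x
      & forall k l, nc (frob_dot (b k) (b l) - (N * (k == l))%:R) <= e * N%:R].
Proof.
move=> K0 e0 yK yK'.
have K2 : 0 < K ^+ 2 by rewrite exprn_gt0.
pose e1 : R := Num.min 1 (e / 4).
have e10 : 0 < e1 by rewrite lt_min ltr01 divr_gt0.
have e11 : e1 <= 1 by rewrite ge_min lexx.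
have e1e : e1 <= e / 4 by rewrite ge_min lexx orbT.
pose tau : R := Num.sqrt (e1 / ((1 + e1^-1) * r.+1%:R ^+ 2)).
have ie1 : 0 < 1 + e1^-1 by rewrite addr_gt0 // invr_gt0.
have r1 : 0 < r.+1%:R ^+ 2 :> R by rewrite exprn_gt0 // ltr0n.
have tau0 : 0 < tau by rewrite sqrtr_gt0 divr_gt0 // mulr_gt0.
have tauE : (1 + e1^-1) * (r.+1%:R ^+ 2 * tau ^+ 2) = e1.
  rewrite sqr_sqrtr; last by rewrite divr_ge0 ?ltW // mulr_gt0.
  by field; rewrite gt_eqF // nat1r pnatr_eq0 /= gt_eqF // addr_gt0.
(* tau makes the passage from the net to the whole ball cost at most e1. *)
have [m [t [t1 tnet]]] := ball_net r tau0.
pose td k : 'M[C]_m := diag_mx (\row_s (K%:C * t s k)).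
pose y' k : 'M[C]_(d + m) := block_mx (y k) 0 0 (td k).
pose z k : 'M[C]_(_ + _) := block_mx 0 (y' k) (adjmx (y' k)) 0.
have zH k : adjmx (z k) = z k by rewrite /z adjmx_block !adjmx0 adjmxK.
have tdK (w : 'I_r -> 'I_m -> C) (v : 'rV[C]_m) :
    (forall s, \sum_k nc (w k s) ^+ 2 <= K ^+ 2) ->
    \sum_k frob_sq (v *m diag_mx (\row_s w k s)) <= K ^+ 2 * frob_sq v.
  move=> wK; rewrite {2}/frob_sq big_ord1.
  under eq_bigr do rewrite /frob_sq big_ord1.
  rewrite exchange_big mulr_sumr /=; apply: ler_sum => s _.
  rewrite (eq_bigr (fun k => nc (v 0 s) ^+ 2 * nc (w k s) ^+ 2)); last first.
    by move=> k _; rewrite mul_mx_diag !mxE Normc.normcM exprMn.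
  by rewrite -mulr_sumr mulrC ler_wpM2r ?sqr_ge0.
have nK : nc K%:C ^+ 2 = K ^+ 2 by rewrite normc_sq /= expr0n addr0.
have tK s : \sum_k nc (K%:C * t s k) ^+ 2 <= K ^+ 2.
  rewrite (eq_bigr (fun k => K ^+ 2 * nc (t s k) ^+ 2)); last first.
    by move=> k _; rewrite Normc.normcM exprMn nK.
  by rewrite -mulr_sumr ler_piMr // ltW.
have y'K (v : 'rV_(d + m)) : \sum_k frob_sq (v *m y' k) <= K ^+ 2 * frob_sq v.
  rewrite -[v]hsubmxK; set v1 := lsubmx v; set v2 := rsubmx v.
  rewrite (eq_bigr (fun k => frob_sq (v1 *m y k) + frob_sq (v2 *m td k))); last first.
    by move=> k _; rewrite /y' mul_row_block !mulmx0 addr0 add0r frob_sq_row_mx.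
  by rewrite big_split frob_sq_row_mx mulrDr lerD // tdK.
have adj_td k : adjmx (td k) = diag_mx (\row_s (conjc (K%:C * t s k))).
  apply/matrixP => i j; rewrite !mxE eq_sym.
  by case: eqP => [->|_]; rewrite ?mulr1n ?mulr0n ?conjc0.
have y'K' (v : 'rV_(d + m)) :
  \sum_k frob_sq (v *m adjmx (y' k)) <= K ^+ 2 * frob_sq v.
  rewrite -[v]hsubmxK; set v1 := lsubmx v; set v2 := rsubmx v.
  rewrite (eq_bigr (fun k =>
    frob_sq (v1 *m adjmx (y k)) + frob_sq (v2 *m adjmx (td k)))); last first.
    by move=> k _; rewrite /y' adjmx_block !adjmx0 mul_row_block !mulmx0 addr0
      add0r frob_sq_row_mx.
  rewrite big_split frob_sq_row_mx mulrDr lerD //=.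
  under eq_bigr do rewrite adj_td.
  apply: tdK => s; under eq_bigr do rewrite normc_conj; exact: tK.
have zK (v : 'rV_(_ + _)) : \sum_k frob_sq (v *m z k) <= K ^+ 2 * frob_sq v.
  rewrite -[v]hsubmxK; set v1 := lsubmx v; set v2 := rsubmx v.
  rewrite (eq_bigr (fun k =>
    frob_sq (v2 *m adjmx (y' k)) + frob_sq (v1 *m y' k))); last first.
    by move=> k _; rewrite /z mul_row_block !mulmx0 addr0 add0r frob_sq_row_mx.
  by rewrite big_split frob_sq_row_mx mulrDr addrC lerD.
have [N [b [N0 bz b1 bh]]] := asymptotically_free_hermitian K0 e10 zH zK.
have by' (x : 'M[C]_(N, d + m)) : frob_sq (\sum_k b k *m x *m y' k) <=
    4 * K ^+ 2 * (1 + e1) * frob_sq x.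
  have := bz (row_mx x 0); rewrite frob_sq_row_mx frob_sq0 addr0.
  have -> : \sum_k b k *m row_mx x 0 *m z k = row_mx 0 (\sum_k b k *m x *m y' k).
    rewrite (big_morph (row_mx 0) (id1 := 0) (op1 := +%R)); last 2 first.
    - by move=> p p'; rewrite add_row_mx addr0.
    - by rewrite row_mx0.
    apply: eq_bigr => k _.
    by rewrite mul_mx_row mul_row_block !mulmx0 mul0mx !addr0.
  by rewrite frob_sq_row_mx frob_sq0 add0r.
exists N, b; split => //.
- move=> x; have := by' (row_mx x 0); rewrite frob_sq_row_mx frob_sq0 addr0.
  have -> : \sum_k b k *m row_mx x 0 *m y' k = row_mx (\sum_k b k *m x *m y k) 0.
    rewrite (big_morph (row_mx ^~ 0) (id1 := 0) (op1 := +%R)); last 2 first.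
    - by move=> p p'; rewrite add_row_mx addr0.
    - by rewrite row_mx0.
    apply: eq_bigr => k _.
    by rewrite mul_mx_row mul_row_block !mulmx0 mul0mx !addr0.
  rewrite frob_sq_row_mx frob_sq0 addr0 => /le_trans; apply.
  rewrite ler_wpM2r ?frob_sq_ge0 // ler_pM2l ?mulr_gt0 // lerD2l; lra.
- move=> u x; pose F u := \sum_k u k *: (b k *m x).
  have x0 := frob_sq_ge0 x.
  have Ft s : frob_sq (F (t s)) <= 4 * (1 + e1) * frob_sq x.
    have := by' (row_mx 0 (x *m delta_mx 0 s)); rewrite frob_sq_row_mx frob_sq0 add0r.
    have -> : \sum_k b k *m row_mx 0 (x *m delta_mx (0 : 'I_1) s) *m y' k =
        row_mx 0 ((K%:C *: F (t s)) *m delta_mx 0 s).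
      rewrite scaler_sumr mulmx_suml.
      rewrite (big_morph (row_mx 0) (id1 := 0) (op1 := +%R)); last 2 first.
      - by move=> p p'; rewrite add_row_mx addr0.
      - by rewrite row_mx0.
      apply: eq_bigr => k _.
      rewrite mul_mx_row mul_row_block !mulmx0 mul0mx !add0r; congr row_mx.
      rewrite mulmxA mul_mx_diag scalerA; apply/matrixP => g s'.
      rewrite !mxE !big_ord1 !mxE eqxx /=.
      by case: eqP => [->|_]; rewrite ?mulr1 ?mulr0 ?mul0r // mulrC.
    have sd (w : 'cV[C]_N) : frob_sq (w *m delta_mx (0 : 'I_1) s) = frob_sq w.
      rewrite frob_sq_col (bigD1 s) //= big1 => [|s' ss'].
        rewrite addr0; congr frob_sq; apply/matrixP => g h.
        by rewrite [h]ord1 !mxE big_ord1 !mxE !eqxx mulr1.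
      rewrite (_ : col s' _ = 0) ?frob_sq0 //; apply/matrixP => g h.
      by rewrite !mxE big_ord1 !mxE (negPf ss') andbF mulr0.
    rewrite frob_sq_row_mx frob_sq0 add0r !sd frob_sqZ nK.
    rewrite [X in X <= _ -> _]mulrC -ler_pdivlMr // => /le_trans; apply.
    rewrite ler_pdivrMr //; lra.
  have F1 v : \sum_k nc (v k) ^+ 2 <= 1 -> frob_sq (F v) <= 4 * (1 + e) * frob_sq x.
    move=> /tnet[s st].
    have -> : F v = F (t s) + \sum_k (v k - t s k) *: (b k *m x).
      by rewrite -big_split; apply: eq_bigr => k _ /=; rewrite -scalerDl addrC subrK.
    apply: le_trans (frob_sqD_le _ _ e10) _.
    have H : frob_sq (\sum_k (v k - t s k) *: (b k *m x)) <=
      r.+1%:R ^+ 2 * tau ^+ 2 * frob_sq x.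
      apply: le_trans (frob_sq_sum_le _) _; rewrite card_ord.
      rewrite (@le_trans _ _ (r%:R * \sum_(k < r) tau ^+ 2 * frob_sq x)) //.
        rewrite ler_wpM2l //; apply: ler_sum => k _; rewrite frob_sqZ.
        rewrite ler_pM ?sqr_ge0 ?frob_sq_ge0 //.
        by rewrite lerXn2r ?nnegrE ?normc_ge0 // ltW.
      rewrite sumr_const card_ord -[X in _ * X]mulr_natl.
      have -> : r%:R * (r%:R * (tau ^+ 2 * frob_sq x)) =
        r%:R ^+ 2 * tau ^+ 2 * frob_sq x.
        by ring.
      rewrite ler_wpM2r // ler_wpM2r ?sqr_ge0 //.
      by rewrite lerXn2r ?nnegrE // ler_nat.
    have := Ft s; have : 0 < 1 + e1 by lra.
    move=> a0 /(ler_wpM2l (ltW a0)) FT.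
    apply: le_trans (lerD FT (ler_wpM2l (ltW ie1) H)) _.
    rewrite [X in _ + X]mulrA tauE.
    have -> : (1 + e1) * (4 * (1 + e1) * frob_sq x) + e1 * frob_sq x =
        (4 * (1 + e1) ^+ 2 + e1) * frob_sq x by ring.
    rewrite ler_wpM2r //; have : e1 * e1 <= e1 by rewrite ler_piMl // ltW.
    lra.
  have [u0|] := eqVneq (\sum_k nc (u k) ^+ 2) 0.
    rewrite u0 mulr0 mul0r big1 ?frob_sq0 // => k _.
    have /eqP := u0; rewrite psumr_eq0 => [/allP/(_ k (mem_index_enum k))|i _].
      by rewrite sqrf_eq0 => /eqP/Normc.eq0_normc ->; rewrite scale0r.
    exact: sqr_ge0.
  set c := \sum_k _ => c0.
  have cp : 0 < c by rewrite lt_neqAle eq_sym c0 sumr_ge0 // => k _; rewrite sqr_ge0.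
  have nic : nc (Num.sqrt c^-1)%:C ^+ 2 = c^-1.
    by rewrite normc_sq /= expr0n addr0 sqr_sqrtr // invr_ge0 ltW.
  have := F1 (fun k => (Num.sqrt c^-1)%:C * u k).
  have -> : \sum_k nc ((Num.sqrt c^-1)%:C * u k) ^+ 2 = 1.
    under eq_bigr do rewrite Normc.normcM exprMn nic.
    by rewrite -mulr_sumr mulVf.
  move=> /(_ (lexx _)).
  have -> : F (fun k => (Num.sqrt c^-1)%:C * u k) = (Num.sqrt c^-1)%:C *: F u.
    by rewrite scaler_sumr; apply: eq_bigr => k _; rewrite scalerA.
  by rewrite frob_sqZ nic ler_pdivrMl // mulrA (mulrC c).
- move=> k l; apply: le_trans (bh k l) _; rewrite ler_wpM2r //.
  by lra.
Qed.

End AsymptoticallyFree.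

(** * The 2-summing norm of the identity of a finite dimensional space *)

(** Factor the block matrix (1, -u; v, 1) in two ways. *)
Lemma det_addMrank1 (F : comPzRingType) n (u : 'cV[F]_n) (v : 'rV[F]_n) :
  \det (1%:M + u *m v) = 1 + (v *m u) 0 0.
Proof.
have E1 : block_mx 1%:M 0 v 1%:M *m block_mx 1%:M (- u) 0 (1%:M + v *m u) =
   (block_mx 1%:M (- u) v 1%:M : 'M[F]_(n + 1)).
  rewrite mulmx_block !mul1mx !mul0mx !mulmx1 !addr0 mulmxN.
  by rewrite addrA addrAC addNr add0r.
have E2 : block_mx (1%:M + u *m v) (- u) 0 1%:M *m block_mx 1%:M 0 v 1%:M =
   (block_mx 1%:M (- u) v 1%:M : 'M[F]_(n + 1)).
  rewrite mulmx_block !mul1mx !mul0mx !mulmx0 !mulmx1 !add0r mulNmx.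
  by rewrite addrK.
have := congr1 determinant (etrans E1 (esym E2)).
rewrite !det_mulmx !det_lblock !det_ublock !det1 !mul1r !mulr1 => <-.
by rewrite det_mx11 !mxE.
Qed.

Lemma expr1D_le (R : realFieldType) n : exists2 c : R, 0 <= c &
  forall a, 0 <= a <= 1 -> (1 + a) ^+ n <= 1 + n%:R * a + c * a ^+ 2.
Proof.
elim: n => [|n [c c0 IH]].
  by exists 0 => // a _; rewrite expr0 !mul0r !addr0.
exists (n%:R + 2 * c) => [|a /andP[a0 a1]].
  by rewrite addr_ge0 // mulr_ge0.
have /IH H : 0 <= a <= 1 by rewrite a0.
rewrite exprS; apply: (@le_trans _ _ ((1 + a) * (1 + n%:R * a + c * a ^+ 2))).
  by rewrite ler_wpM2l // addr_ge0.
have : c * a ^+ 3 <= c * a ^+ 2.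
  by rewrite ler_wpM2l // exprS ler_piMl // exprn_ge0.
rewrite -natr1; lra.
Qed.

Section NormEquivalence.
Variables (R : realType) (E : normedModType R[i]).
Local Notation nc := (@Normc.normc R).

Lemma rnorm_sum (I : finType) (f : I -> E) : rnorm (\sum_i f i) <= \sum_i rnorm (f i).
Proof.
elim/big_ind2 : _ => [|x a y b xa yb|//]; first by rewrite rnorm0.
by rewrite (le_trans (ler_rnormD _ _)) // lerD.
Qed.

Lemma rnormB_le (x y : E) : `|rnorm x - rnorm y| <= rnorm (x - y).
Proof.
rewrite ler_norml lerBrDr lerBlDr.
have := ler_rnormD (x - y) y; rewrite subrK => ->; rewrite andbT.
have := ler_rnormD (y - x) x; rewrite subrK -(rnormN (y - x)) opprB; lra.
Qed.

(** The norm is continuous and positive on the compact unit sphere of the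
    coordinate space, regarded as the real space R^(2n). *)
Lemma coord_bounded n (e : 'I_n -> E) :
  (forall z : 'I_n -> R[i], \sum_i z i *: e i = 0 -> forall i, z i = 0) ->
  exists2 c : R, 0 < c & forall z : 'I_n -> R[i], forall i,
    nc (z i) <= c * rnorm (\sum_j z j *: e j).
Proof.
case: n e => [|n] e efree; first by exists 1 => // z [].
pose C (w : 'rV[R]_(n.+1 + n.+1)) (j : 'I_n.+1) : R[i] :=
  w 0 (lshift n.+1 j) +i* w 0 (rshift n.+1 j).
pose g w := \sum_j C w j *: e j.
have gB w w' : g w - g w' = g (w - w').
  rewrite /g -sumrB; apply: eq_bigr => j _; rewrite -scalerBl; congr (_ *: _).
  by rewrite /C !mxE.
have lew (w : 'rV[R]_(n.+1 + n.+1)) i : `|w 0 i| <= `|w|.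
  rewrite [leRHS]/Num.norm /= mx_normrE; apply/bigmax_geP; right => /=.
  by exists (ord0, i).
have Cw w j : nc (C w j) <= 2 * `|w|.
  apply: (@le_trans _ _ (`|w 0 (lshift n.+1 j)| + `|w 0 (rshift n.+1 j)|)).
    rewrite -(ler_pXn2r (n := 2)) ?nnegrE ?normc_ge0 ?addr_ge0 //.
    rewrite normc_sq /= sqrrD !real_normK ?num_real // -addrA lerD2l lerDr.
    by rewrite mulrn_wge0 // mulr_ge0.
  have := lew w (lshift n.+1 j); have := lew w (rshift n.+1 j); lra.
pose B := 1 + 2 * \sum_j rnorm (e j).
have B0 : 0 < B.
  by rewrite ltr_pwDl // mulr_ge0 // sumr_ge0 // => j _; exact: rnorm_ge0.
have gw w : rnorm (g w) <= B * `|w|.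
  apply: le_trans (rnorm_sum _) _.
  rewrite (@le_trans _ _ (\sum_j 2 * `|w| * rnorm (e j))) //.
    by apply: ler_sum => j _; rewrite rnormZ ler_wpM2r ?rnorm_ge0.
  rewrite -mulr_sumr mulrAC ler_wpM2r // /B lerDr //.
have cf : continuous (fun w => rnorm (g w)).
  move=> w; apply/(@cvgrPdist_lt _ _ _ _ (nbhs_filter (w :
    (matrix R 1 (n.+1 + n.+1) : topologicalType)))) => eps eps0.
  apply/nbhs_ballP; exists (B^-1 * eps) => /=; first by rewrite mulr_gt0 // invr_gt0.
  move=> w'; rewrite -ball_normE /= => ww'.
  apply: le_lt_trans (rnormB_le _ _) _; rewrite gB.
  by apply: le_lt_trans (gw _) _; rewrite -ltr_pdivlMl.
pose A : set 'rV[R]_(n.+1 + n.+1) := [set w | `|w| = 1]%classic.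
have A0 : (A !=set0)%classic.
  pose w : 'rV[R]_(n.+1 + n.+1) := const_mx 1.
  have w0 : `|w| != 0.
    by have := lew w (lshift n.+1 0); rewrite mxE normr1; case: eqP => // ->;
      rewrite ler10.
  exists (`|w|^-1 *: w); rewrite /A /= normrZ normfV normr_id mulVf //.
have cA : compact A.
  apply: bounded_closed_compact.
    by exists 1; split; [exact: num_real|move=> M M1 w /= ->; exact: ltW].
  rewrite (_ : A = ((fun w => `|w|) @^-1` [set 1])%classic) //.
  apply: preimage_closed; last exact: closed_eq.
  by move=> w _; exact: norm_continuous.
have [w0 w0A w0min] := EVT_min_rV A0 cA (continuous_subspaceT cf).
rewrite inE /A /= in w0A.
have m0 : 0 < rnorm (g w0).
  rewrite lt_neqAle rnorm_ge0 andbT eq_sym; apply/eqP => /rnorm0_eq0 /efree C0.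
  suff w00 : w0 = 0 by move: w0A; rewrite w00 normr0 => /eqP; rewrite eq_sym oner_eq0.
  apply/rowP => i; rewrite mxE; case: (split_ordP i) => j ->.
    by have := C0 j => /eqP; rewrite eq_complex /= => /andP[/eqP].
  by have := C0 j => /eqP; rewrite eq_complex /= => /andP[_ /eqP].
exists (2 / rnorm (g w0)); first by rewrite divr_gt0.
move=> z i.
pose w : 'rV[R]_(n.+1 + n.+1) :=
  row_mx (\row_j complex.Re (z j)) (\row_j complex.Im (z j)).
have CE j : C w j = z j.
  by rewrite /C row_mxEl row_mxEr !mxE; case: (z j).
have gE : g w = \sum_j z j *: e j by apply: eq_bigr => j _; rewrite CE.
rewrite -gE -CE; apply: le_trans (Cw _ _) _.
have [w00|wn0] := eqVneq `|w| 0.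
  by rewrite w00 mulr0 mulr_ge0 ?rnorm_ge0 // divr_ge0 // rnorm_ge0.
have wp : 0 < `|w| by rewrite lt_neqAle eq_sym wn0 normr_ge0.
have wA : (`|w|^-1 *: w) \in A.
  by rewrite inE /A /= normrZ normfV normr_id mulVf.
have := w0min _ wA.
have -> : g (`|w|^-1 *: w) = (`|w|^-1)%:C *: g w.
  rewrite /g scaler_sumr; apply: eq_bigr => j _; rewrite scalerA; congr (_ *: _).
  by rewrite /C !mxE; apply/eqP; rewrite eq_complex /= !mul0r subr0 addr0 !eqxx.
have -> : rnorm ((`|w|^-1)%:C *: g w) = `|w|^-1 * rnorm (g w).
  by rewrite rnormZ /= expr0n addr0 sqrtr_sqr ger0_norm // invr_ge0.
rewrite ler_pdivlMl // => H.
by rewrite -mulrA ler_pM2l // ler_pdivlMl // mulrC.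
Qed.

End NormEquivalence.

Section GramDeterminant.
Variable R : realType.
Local Notation C := R[i].
Local Notation nc := (@Normc.normc R).

Lemma normc_det_le n (A : 'M[C]_n) (c : R) :
  (forall i j, nc (A i j) <= c) -> nc (\det A) <= (n`!)%:R * c ^+ n.
Proof.
move=> Ac; apply: le_trans (normc_sum _ _ _) _.
rewrite (@le_trans _ _ (\sum_(s : 'S_n) c ^+ n)) //; last first.
  by rewrite sumr_const card_Sn -[leLHS]mulr_natl.
apply: ler_sum => s _; rewrite Normc.normcM normcX.
rewrite (_ : nc (-1) = 1); last by rewrite normcN Normc.normc1.
rewrite expr1n mul1r normc_prod.
have -> : c ^+ n = \prod_(i < n) c by rewrite prodr_const card_ord.
apply: ler_prod => i _; rewrite normc_ge0 /=; exact: Ac.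
Qed.

(** Effect on the Gram determinant of mixing a new vector Y into the family X
    with weights 1/(1+a) and a/(1+a). *)
Lemma det_gram_append n m (X : 'M[C]_(n, m)) (Y : 'cV[C]_n) (a : R) :
  0 <= a -> let G := X *m adjmx X in G \in unitmx ->
  let al := (Num.sqrt (1 + a)^-1)%:C in
  let be := (Num.sqrt (a / (1 + a)))%:C in
  let X' := row_mx (al *: X) (be *: Y) in
  nc (\det (X' *m adjmx X')) = (1 + a) ^- n * nc (\det G) *
    (1 + a * frob_sq (adjmx X *m invmx G *m Y)).
Proof.
move=> a0 G Gu al be X'.
have a1 : 0 < 1 + a by lra.
have GH : adjmx G = G by rewrite /G adjmx_mul adjmxK.
pose c : C := ((1 + a)^-1)%:C.
have sqrtcc (t : R) : 0 <= t ->
    (Num.sqrt t)%:C * conjc (Num.sqrt t)%:C = t%:C :> C.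
  by move=> t0; rewrite conjc_real -rmorphM -expr2 sqr_sqrtr.
have alal : al * conjc al = c by rewrite sqrtcc // invr_ge0 ltW.
have bebe : be * conjc be = c * a%:C.
  by rewrite sqrtcc ?divr_ge0 ?(ltW a1) // -rmorphM mulrC.
have -> : X' *m adjmx X' = c *: (G *m (1%:M + (a%:C *: (invmx G *m Y)) *m adjmx Y)).
  have -> : adjmx X' = col_mx (adjmx (al *: X)) (adjmx (be *: Y)).
    apply/matrixP => i j; rewrite !mxE.
    by case: splitP => k _; rewrite !mxE.
  rewrite mul_row_col !adjmxZ -!scalemxAl -!scalemxAr !scalerA alal bebe.
  rewrite mulmxDr mulmx1 scalerDr; congr (_ + _).
  rewrite -scalemxAr scalerA; congr (_ *: _).
  by rewrite !mulmxA mulmxV // mul1mx.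
rewrite detZ det_mulmx det_addMrank1 -scalemxAr mxE.
have -> : (adjmx Y *m (invmx G *m Y)) 0 0 = (frob_sq (adjmx X *m invmx G *m Y))%:C.
  rewrite -adjmx_mul00 !adjmx_mul adjmxK (adjmx_inv Gu GH) !mulmxA.
  by rewrite -(mulmxA _ X) -/G mulmxKV.
rewrite Normc.normcM normcX normc_real ?invr_ge0 ?(ltW a1) // Normc.normcM.
rewrite -rmorphM -(rmorph1 (real_complex R)) -rmorphD.
rewrite normc_real; last by rewrite addr_ge0 // mulr_ge0 // frob_sq_ge0.
by rewrite exprVn mulrA.
Qed.

End GramDeterminant.

Section TwoSumming.
Variables (R : realType) (E : normedModType R[i]).
Local Notation C := R[i].
Local Notation nc := (@Normc.normc R).

(** Choose a family X of vectors x_k with sum_k |x_k|^2 <= 1 and a nearly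
    maximal determinant of G = X X^*, and put beta_k(y) = (X^* G^-1 y)_k, so
    that sum_k beta_k(x_k) = tr (G^-1 G) = n and
    sum_k |beta_k(y)|^2 = y^* G^-1 y.  Mixing in a unit vector y with weight
    about a multiplies the determinant by
    (1 + a y^* G^-1 y) / (1 + a)^n, which cannot exceed 1 by much; letting a be
    small gives y^* G^-1 y <= n + e. *)
Lemma two_summing_identity n (e : R) : has_dim n E -> 0 < e ->
  exists m (x : 'I_m -> E) (be : 'I_m -> E -> C),
    [/\ forall k a y z, be k (a *: y + z) = a * be k y + be k z,
        \sum_k rnorm (x k) ^+ 2 <= 1,
        \sum_k be k (x k) = n%:R
      & forall y, \sum_k nc (be k y) ^+ 2 <= (n%:R + e) * rnorm y ^+ 2].
Proof.
move=> [[v2r v2rL [r2v v2rK r2vK]]] e0.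
pose v2rM := GRing.isLinear.Build C _ _ _ v2r v2rL.
pose v2rl : {linear E -> 'rV[C]_n} := HB.pack v2r v2rM.
have r2vL : linear r2v.
  move=> a x y; apply: (can_inj v2rK); rewrite r2vK.
  by rewrite v2rL !r2vK.
pose r2vM := GRing.isLinear.Build C _ _ _ r2v r2vL.
pose r2vl : {linear 'rV[C]_n -> E} := HB.pack r2v r2vM.
pose co (y : E) : 'cV[C]_n := (v2r y)^T.
pose ve (Y : 'cV[C]_n) : E := r2v Y^T.
have coK y : ve (co y) = y by rewrite /ve trmxK v2rK.
have veK Y : co (ve Y) = Y by rewrite /co r2vK trmxK.
have veZ a Y : ve (a *: Y) = a *: ve Y.
  by rewrite /ve linearZ -[r2v]/(r2vl : _ -> _) linearZ.
have [cE cE0 coB] : exists2 c : R, 0 < c &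
    forall (Y : 'cV[C]_n) i, nc (Y i 0) <= c * rnorm (ve Y).
  pose ei i := r2v (delta_mx 0 i).
  have vE Y : ve Y = \sum_j Y j 0 *: ei j.
    rewrite /ve (row_sum_delta Y^T) -[r2v]/(r2vl : _ -> _) linear_sum.
    by apply: eq_bigr => j _; rewrite linearZ mxE.
  have [|c c0 H] := @coord_bounded R E n ei.
    move=> z z0 i.
    have := vE (\col_j z j); under eq_bigr do rewrite mxE.
    rewrite z0 => /(congr1 co); rewrite veK => /colP/(_ i).
    rewrite mxE => ->; rewrite /co -[v2r]/(v2rl : _ -> _) linear0.
    by rewrite !mxE.
  by exists c => // Y i; rewrite vE; exact: (H (fun j => Y j 0)).
pose cost m (X : 'M[C]_(n, m)) := \sum_k rnorm (ve (col k X)) ^+ 2.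
pose V : set R := [set v | exists m (X : 'M[C]_(n, m)),
   cost m X <= 1 /\ v = nc (\det (X *m adjmx X))]%classic.
have Vub : ubound V ((n`!)%:R * (cE ^+ 2) ^+ n).
  move=> _ [m [X [X1 ->]]]; apply: normc_det_le => i j.
  rewrite mxE; apply: le_trans (normc_sum _ _ _) _.
  rewrite (@le_trans _ _ (\sum_k cE ^+ 2 * rnorm (ve (col k X)) ^+ 2)) //.
    apply: ler_sum => k _; rewrite mxE Normc.normcM normc_conj -exprMn expr2.
    have := coB (col k X) i; have := coB (col k X) j; rewrite !mxE => hi hj.
    by rewrite ler_pM ?normc_ge0.
  by rewrite -mulr_sumr ler_piMr // sqr_ge0.
have [v0 Vv0 v00] : exists2 v, V v & 0 < v.
  pose t : R := (1 + cost n 1%:M)^-1.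
  have cs0 : 0 <= cost n 1%:M by apply: sumr_ge0 => k _; rewrite sqr_ge0.
  have t0 : 0 < t by rewrite invr_gt0; lra.
  pose st : C := (Num.sqrt t)%:C.
  have nst : nc st ^+ 2 = t by rewrite normc_real ?sqrtr_ge0 // sqr_sqrtr // ltW.
  exists (nc (\det ((st *: 1%:M) *m adjmx (st *: 1%:M : 'M[C]_n)))).
    exists n, (st *: 1%:M); split => //.
    rewrite /cost (eq_bigr (fun k => t * rnorm (ve (col k 1%:M)) ^+ 2)).
      by rewrite -mulr_sumr -/(cost n _) /t mulrC ler_pdivrMr ?mul1r; lra.
    by move=> k _; rewrite linearZ /= veZ rnormZ exprMn nst.
  rewrite adjmxZ -scalemxAl mul1mx scalerA detZ Normc.normcM normcX.
  rewrite Normc.normcM normc_conj -expr2 nst (_ : \det _ = 1).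
    by rewrite Normc.normc1 mulr1 exprn_gt0.
  rewrite (_ : adjmx _ = 1%:M) ?det1 //; apply/matrixP => i j.
  by rewrite !mxE eq_sym rmorph_nat.
have supV : has_sup V by split; [exists v0|exists ((n`!)%:R * (cE ^+ 2) ^+ n)].
pose s := sup V.
have les v : V v -> v <= s by apply: sup_ubound; case: supV.
have s0 : 0 < s by apply: lt_le_trans v00 _; exact: les.
have [c c0 cP] := expr1D_le R n.
(* c' collects the second-order terms of (1 + a^2) (1 + a)^n. *)
pose c' := 2 * c + 1 + n%:R.
have c'0 : 0 < c' by have := ler0n R n; rewrite /c'; lra.
pose a := Num.min 1 (e / c').
have a0 : 0 < a by rewrite lt_min ltr01 divr_gt0.
have a1 : a <= 1 by rewrite ge_min lexx.
have ae : c' * a <= e by rewrite mulrC -ler_pdivlMr // ge_min lexx orbT.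
have a21 : 0 < 1 + a ^+ 2 by rewrite addr_gt0 // exprn_gt0.
have [|v [m [X [X1 vE]]] vs] := @sup_adherent R V (s - s / (1 + a ^+ 2)) _ supV.
  by rewrite subr_gt0 ltr_pdivrMr // ltr_pMr // ltrDl exprn_gt0.
move: vs; rewrite subKr ltr_pdivrMr // => vs.
pose G := X *m adjmx X.
rewrite -/G in vE.
have Gu : G \in unitmx.
  rewrite unitmxE unitfE; apply/eqP => d0.
  move: vs; rewrite vE d0 Normc.normc0 mul0r => /(lt_trans s0).
  by rewrite ltxx.
have vp : 0 < v by rewrite -(pmulr_lgt0 _ a21); exact: lt_trans vs.
have Q Y : rnorm (ve Y) <= 1 -> frob_sq (adjmx X *m invmx G *m Y) <= n%:R + e.
  move=> Y1; set q := frob_sq _.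
  have := det_gram_append Y (ltW a0) Gu; cbv zeta; rewrite -/G -vE -/q.
  set X' := row_mx _ _ => detE.
  have a1' : 0 < 1 + a by lra.
  have : nc (\det (X' *m adjmx X')) <= s.
    apply: les; exists (m + 1)%N, X'; split => //.
    rewrite /cost big_split_ord /= big_ord1.
    have -> : ve (col (rshift m 0) X') = (Num.sqrt (a / (1 + a)))%:C *: ve Y.
      by rewrite -veZ; congr ve; apply/colP => i; rewrite mxE row_mxEr mxE.
    rewrite (eq_bigr (fun k => (1 + a)^-1 * rnorm (ve (col k X)) ^+ 2)); last first.
      move=> k _.
      have -> : ve (col (lshift 1 k) X') = (Num.sqrt (1 + a)^-1)%:C *: ve (col k X).
        by rewrite -veZ; congr ve; apply/colP => i; rewrite mxE row_mxEl !mxE.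
      rewrite rnormZ exprMn normc_real ?sqrtr_ge0 // sqr_sqrtr //.
      by rewrite invr_ge0 ltW.
    rewrite -mulr_sumr -/(cost m X) rnormZ exprMn normc_real ?sqrtr_ge0 //.
    rewrite sqr_sqrtr ?divr_ge0 ?(ltW a0) ?(ltW a1') //.
    have Y2 : rnorm (ve Y) ^+ 2 <= 1 by rewrite exprn_ile1 ?rnorm_ge0.
    have -> : (1 + a)^-1 * cost m X + a / (1 + a) * rnorm (ve Y) ^+ 2 =
       (cost m X + a * rnorm (ve Y) ^+ 2) / (1 + a) by field; rewrite gt_eqF.
        by rewrite ler_pdivrMr // mul1r lerD // ler_piMr // ltW.
  rewrite detE (mulrC _ v) -mulrA (mulrC _ (1 + a * q)) => /le_lt_trans/(_ vs).
  rewrite ltr_pM2l // ltr_pdivrMr ?exprn_gt0 //.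
  have /cP an : 0 <= a <= 1 by rewrite (ltW a0) a1.
  move=> /lt_le_trans/(_ (ler_wpM2l (ltW a21) an)) H.
  have a30 : 0 < a ^+ 2 by rewrite exprn_gt0.
  have h1 : n%:R * a ^+ 3 <= n%:R * a ^+ 2.
    by rewrite ler_wpM2l // exprS ler_piMl // ltW.
  have h2 : c * a ^+ 4 <= c * a ^+ 2.
    have -> : a ^+ 4 = a ^+ 2 * a ^+ 2 by ring.
    rewrite ler_wpM2l // ler_piMl ?(ltW a30) // exprn_ile1 ?(ltW a0) //.
  have : a * q <= a * (n%:R + c' * a).
    by rewrite /c'; lra.
  rewrite ler_pM2l // => /le_trans; apply; rewrite lerD2l //.
exists m, (fun k => ve (col k X)), (fun k y => (adjmx X *m invmx G *m co y) k 0).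
split.
- move=> k b y z; rewrite /co v2rL linearP mulmxDr -scalemxAr !mxE //.
- exact: X1.
- under eq_bigr do rewrite veK.
  transitivity (\tr (adjmx X *m invmx G *m X)).
    by apply: eq_bigr => k _; rewrite [LHS]mxE [RHS]mxE; apply: eq_bigr => j _;
      rewrite [col _ _ _ _]mxE.
  rewrite mxtrace_mulC mulmxA -/G mulmxV // mxtrace1 //.
move=> y; set F := adjmx X *m invmx G.
have sqnE z : \sum_k nc ((F *m co z) k 0) ^+ 2 = frob_sq (F *m co z).
  by apply: eq_bigr => k _; rewrite big_ord1.
rewrite sqnE; have [y0|y0] := eqVneq (rnorm y) 0.
  rewrite (rnorm0_eq0 y0) /co -[v2r]/(v2rl : _ -> _) linear0 trmx0 mulmx0 frob_sq0.
  by rewrite rnorm0 expr0n mulr0.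
have yp : 0 < rnorm y by rewrite lt_neqAle eq_sym y0 rnorm_ge0.
have nV : nc (rnorm y)^-1%:C = (rnorm y)^-1 by rewrite normc_real // invr_ge0 ltW.
have := Q ((rnorm y)^-1%:C *: co y); rewrite veZ coK rnormZ nV mulVf //.
move=> /(_ (lexx _)); rewrite -scalemxAr frob_sqZ nV exprVn.
by rewrite ler_pdivrMl ?exprn_gt0 // mulrC.
Qed.

End TwoSumming.

(** * Coordinates and truncations in l2 *)

Section L2.
Variable R : realType.
Local Notation C := R[i].
Local Notation nc := (@Normc.normc R).
Implicit Types x y : l2 R.

Lemma l2_sqE x : rnorm x ^+ 2 = limn [series nc (x k) ^+ 2]_k.
Proof.
rewrite /rnorm l2_normE /= sqr_sqrtr //; apply: limr_ge; first exact: l2P.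
by apply: nearW => n; rewrite /series /= sumr_ge0 // => k _; exact: sqr_ge0.
Qed.

Lemma l2_cvg x : ([series nc (x k) ^+ 2]_k @ \oo --> rnorm x ^+ 2)%classic.
Proof. by rewrite l2_sqE; exact: l2P. Qed.

Lemma l2_psum_le x n : \sum_(0 <= k < n) nc (x k) ^+ 2 <= rnorm x ^+ 2.
Proof.
rewrite l2_sqE; apply: (nondecreasing_cvgn_le _ (@l2P R x) n).
by apply: nondecreasing_series => k _ _; exact: sqr_ge0.
Qed.

Lemma l2_rnorm2_le x (B : R) :
  (forall n, \sum_(0 <= k < n) nc (x k) ^+ 2 <= B) -> rnorm x ^+ 2 <= B.
Proof.
move=> H; rewrite l2_sqE; apply: limr_le; first exact: l2P.
by apply: nearW => n; exact: H.
Qed.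

Lemma is_l2_bounded (u : nat -> C) (B : R) :
  (forall n, \sum_(0 <= k < n) nc (u k) ^+ 2 <= B) -> (u : nat -> C^o) \in is_l2.
Proof.
move=> H; apply/asboolP; apply: nondecreasing_is_cvgn.
  by apply: nondecreasing_series => k _ _; exact: sqr_ge0.
by exists B => _ [n _ <-]; exact: H.
Qed.

Lemma l2_coord_le x i : nc (x i) <= rnorm x.
Proof.
rewrite -(ler_pXn2r (n := 2)) ?nnegrE ?rnorm_ge0 ?normc_ge0 //.
apply: le_trans (l2_psum_le x i.+1); rewrite big_nat_recr //= lerDr.
by apply: sumr_ge0 => k _; exact: sqr_ge0.
Qed.

Lemma l2_sumE (I : finType) (f : I -> l2 R) k : (\sum_i f i) k = \sum_i f i k.
Proof. by elim/big_rec2 : _ => // i p q _ <-. Qed.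

Definition col_l2_fun N (v : 'cV[C]_N) : nat -> C^o :=
  fun k => if insub k is Some i then v i 0 else 0.

Lemma col_l2_psum N (v : 'cV[C]_N) n : (N <= n)%N ->
  \sum_(0 <= k < n) nc (col_l2_fun v k) ^+ 2 = frob_sq v.
Proof.
move=> Nn; rewrite (big_cat_nat (leq0n N) Nn) /= addrC big_nat big1 =>
  [|k /andP[Nk _]].
  rewrite add0r big_mkord; apply: eq_bigr => i _.
  by rewrite big_ord1 /col_l2_fun valK.
by rewrite /col_l2_fun insubF ?Normc.normc0 ?expr0n // ltnNge Nk.
Qed.

Lemma col_l2_psum_le N (v : 'cV[C]_N) n :
  \sum_(0 <= k < n) nc (col_l2_fun v k) ^+ 2 <= frob_sq v.
Proof.
rewrite -(col_l2_psum v (leq_maxl N n)).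
rewrite (@big_cat_nat _ _ _ n 0 (maxn N n)) ?leq_maxr //= lerDl.
by apply: sumr_ge0 => k _; exact: sqr_ge0.
Qed.

Definition col_l2 N (v : 'cV[C]_N) : l2 R := L2 (is_l2_bounded (col_l2_psum_le v)).

Definition l2_col N x : 'cV[C]_N := \col_i x i.

Lemma col_l2E N (v : 'cV[C]_N) (i : 'I_N) : col_l2 v i = v i 0.
Proof. by rewrite /= /col_l2_fun valK. Qed.

Lemma col_l2_out N (v : 'cV[C]_N) k : (N <= k)%N -> col_l2 v k = 0.
Proof. by move=> Nk; rewrite /= /col_l2_fun insubF // ltnNge Nk. Qed.

Lemma rnorm_col_l2 N (v : 'cV[C]_N) : rnorm (col_l2 v) ^+ 2 = frob_sq v.
Proof.
apply/eqP; rewrite eq_le l2_rnorm2_le; last exact: col_l2_psum_le.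
by rewrite -(col_l2_psum v (leqnn N)); exact: (l2_psum_le (col_l2 v)).
Qed.

Lemma col_l2_is_linear N : linear (@col_l2 N).
Proof.
move=> a u v; apply: l2_inj => k; rewrite l2DE l2ZE.
have [kN|Nk] := ltnP k N; last by rewrite !col_l2_out // mulr0 addr0.
by rewrite -[k]/(val (Ordinal kN)) !col_l2E !mxE.
Qed.
HB.instance Definition _ N :=
  GRing.isLinear.Build C _ _ _ (@col_l2 N) (@col_l2_is_linear N).

Lemma l2_col_is_linear N : linear (@l2_col N).
Proof. by move=> a u v; apply/colP => i; rewrite !mxE. Qed.
HB.instance Definition _ N :=
  GRing.isLinear.Build C _ _ _ (@l2_col N) (@l2_col_is_linear N).

Lemma col_l2K N (v : 'cV[C]_N) : l2_col N (col_l2 v) = v.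
Proof. by apply/colP => i; rewrite mxE col_l2E. Qed.

Lemma frob_sq_l2_col N x : frob_sq (l2_col N x) = \sum_(0 <= k < N) nc (x k) ^+ 2.
Proof. by rewrite big_mkord; apply: eq_bigr => i _; rewrite big_ord1 mxE. Qed.

Lemma frob_sq_l2_col_le N x : frob_sq (l2_col N x) <= rnorm x ^+ 2.
Proof. by rewrite frob_sq_l2_col l2_psum_le. Qed.

Definition l2_trunc N x : l2 R := col_l2 (l2_col N x).

Lemma l2_truncE N x k : l2_trunc N x k = if (k < N)%N then x k else 0.
Proof.
case: ltnP => kN; last by rewrite col_l2_out.
by rewrite -[k in LHS]/(val (Ordinal kN)) col_l2E mxE.
Qed.

Lemma l2_trunc_is_linear N : linear (l2_trunc N).
Proof. by move=> a u v; rewrite /l2_trunc !linearP. Qed.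
HB.instance Definition _ N :=
  GRing.isLinear.Build C _ _ _ (l2_trunc N) (@l2_trunc_is_linear N).

Lemma rnorm_l2_trunc N x : rnorm (l2_trunc N x) <= rnorm x.
Proof.
rewrite -(ler_pXn2r (n := 2)) ?nnegrE ?rnorm_ge0 // rnorm_col_l2;
  exact: frob_sq_l2_col_le.
Qed.

(** The two pieces have disjoint supports. *)
Lemma l2_Pythagoras N x :
  rnorm x ^+ 2 = frob_sq (l2_col N x) + rnorm (x - l2_trunc N x) ^+ 2.
Proof.
have E n : (N <= n)%N -> \sum_(0 <= k < n) nc (x k) ^+ 2 =
    frob_sq (l2_col N x) + \sum_(0 <= k < n) nc ((x - l2_trunc N x) k) ^+ 2.
  move=> Nn.
  have D k : (x - l2_trunc N x) k = if (k < N)%N then 0 else x k.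
    rewrite l2DE -scaleN1r l2ZE l2_truncE mulN1r.
    by case: ifP => _; rewrite ?subrr ?subr0.
  under [in RHS]eq_bigr do rewrite D.
  rewrite !(big_cat_nat (leq0n N) Nn) /= frob_sq_l2_col; congr (_ + _).
  have -> : \sum_(0 <= k < N) nc (if (k < N)%N then 0 else x k) ^+ 2 = 0.
    by rewrite big_nat big1 // => k /andP[_ kN]; rewrite kN Normc.normc0 expr0n.
  by rewrite add0r; apply: eq_big_nat => k /andP[Nk _]; rewrite ltnNge Nk.
have H : ((fun n => frob_sq (l2_col N x) +
   [series nc ((x - l2_trunc N x) k) ^+ 2]_k n) @ \oo -->
     frob_sq (l2_col N x) + rnorm (x - l2_trunc N x) ^+ 2)%classic.
  by apply: cvgD; [exact: cvg_cst|exact: l2_cvg].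
apply: (cvg_unique _ (@l2_cvg x)) => //.
apply: cvg_trans H; apply: near_eq_cvg.
by near=> n; rewrite /series /= E //; near: n; exact: nbhs_infty_ge.
Unshelve. all: by end_near.
Qed.

Lemma rnorm_l2_truncB N x : rnorm (x - l2_trunc N x) <= rnorm x.
Proof.
rewrite -(ler_pXn2r (n := 2)) ?nnegrE ?rnorm_ge0 //.
by rewrite (l2_Pythagoras N x) lerDr frob_sq_ge0.
Qed.

Lemma l2_trunc_mono m n x : (m <= n)%N ->
  rnorm (x - l2_trunc n x) <= rnorm (x - l2_trunc m x).
Proof.
move=> mn; rewrite -(ler_pXn2r (n := 2)) ?nnegrE ?rnorm_ge0 //.
have : frob_sq (l2_col m x) <= frob_sq (l2_col n x).
  rewrite !frob_sq_l2_col (big_cat_nat (leq0n m) mn) /= lerDl.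
  by apply: sumr_ge0 => k _; exact: sqr_ge0.
have := l2_Pythagoras m x; have := l2_Pythagoras n x; lra.
Qed.

Lemma l2_trunc_cvg x (e : R) : 0 < e -> exists n, rnorm (x - l2_trunc n x) < e.
Proof.
move=> e0; have e20 : 0 < e ^+ 2 by rewrite exprn_gt0.
have := @l2_cvg x; move/cvgrPdist_lt => /(_ _ e20) [n _ /(_ n (leqnn n))].
rewrite /series /= -frob_sq_l2_col => H; exists n.
rewrite -(ltr_pXn2r (n := 2)) ?nnegrE ?rnorm_ge0 ?(ltW e0) //.
apply: le_lt_trans H; rewrite (le_trans _ (ler_norm _)) //.
by rewrite {1}(l2_Pythagoras n x) addrAC subrr add0r.
Qed.

End L2.

(** * Compact operators are limits of their finite sections *)

Section Compact.
Local Open Scope classical_set_scope.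
Local Open Scope ring_scope.
Local Open Scope complex_scope.
Variable R : realType.
Local Notation C := R[i].
Local Notation nc := (@Normc.normc R).
Local Notation H := (l2 R).

Lemma rnorm_scale_le (V W : normedModType C) (f : {linear V -> W}) (c : R) :
  0 <= c -> (forall x, rnorm x <= 1 -> rnorm (f x) <= c) ->
  forall x, rnorm (f x) <= c * rnorm x.
Proof.
move=> c0 fc x; have [x0|x0] := eqVneq (rnorm x) 0.
  by rewrite (rnorm0_eq0 x0) linear0 !rnorm0 mulr0.
have xp : 0 < rnorm x by rewrite lt_neqAle eq_sym x0 rnorm_ge0.
have nV : nc (rnorm x)^-1%:C = (rnorm x)^-1 by rewrite normc_real // invr_ge0 ltW.
have := fc ((rnorm x)^-1%:C *: x); rewrite linearZ !rnormZ nV mulVf // lexx.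
by move=> /(_ isT); rewrite ler_pdivrMl // mulrC.
Qed.

Lemma open_l2_trunc_lt n (e : R) : open [set y : H | rnorm (y - l2_trunc n y) < e].
Proof.
rewrite openE => y /= ye; apply/nbhs_ballP.
exists (e - rnorm (y - l2_trunc n y))%:C => /=; first by rewrite ltcR subr_gt0.
move=> y'; rewrite -ball_normE /= -rnormE ltcR => yy'.
have -> : y' - l2_trunc n y' = (y - l2_trunc n y) - ((y - y') - l2_trunc n (y - y')).
  rewrite [l2_trunc n (y - y')]linearB /=;
    move: (l2_trunc n y) (l2_trunc n y') => c d.
  by rewrite !opprB (addrA (y - c)) (addrA (y - c)) subrK addrC addrA subrK.
rewrite (le_lt_trans (ler_rnormD _ _)) // rnormN.
have := rnorm_l2_truncB n (y - y'); lra.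
Qed.

(** The sets of y with |y - P_n y| < e increase with n and cover l2; finitely
    many cover the closure of the image of the unit ball. *)
Lemma compact_op_trunc (f : bop H) (e : R) : compact_op f -> 0 < e ->
  exists d0, forall d, (d0 <= d)%N -> forall x,
    rnorm (f x - l2_trunc d (f x)) <= e * rnorm x.
Proof.
rewrite /compact_op /= precompactE compact_cover => cf e0.
have [||D' _ HD'] := cf nat setT (fun n =>
  [set y : H | rnorm (y - l2_trunc n y) < e]).
- by move=> n _; exact: open_l2_trunc_lt.
- by move=> y _; have [n yn] := l2_trunc_cvg y e0; exists n.
exists (\max_(i <- enum_fset D') i)%N => d dD.
pose g (x : H) := f x - l2_trunc d (f x).
have gL : linear g.
  by move=> a x y; rewrite /g !linearP scalerDr addrACA.
pose gM := GRing.isLinear.Build C _ _ _ g gL.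
pose gl : {linear H -> H} := HB.pack g gM.
apply: (@rnorm_scale_le _ _ gl _ (ltW e0)) => x x1.
have [|n nD xn] := HD' (f x).
  by apply: subset_closure; exists x.
rewrite /= /g; apply: le_trans (ltW xn); apply: l2_trunc_mono.
by apply: leq_trans dD; apply: (@leq_bigmax_seq _ _ xpredT (fun i => i)).
Qed.

Definition l2_basis (j : nat) : H := col_l2 (delta_mx (ord_max : 'I_j.+1) (0 : 'I_1)).

Lemma l2_basisE j k : l2_basis j k = (k == j)%:R.
Proof.
rewrite /l2_basis; have [kj|jk] := ltnP k j.+1.
  by rewrite -[k in LHS]/(val (Ordinal kj)) col_l2E mxE andbT.
by rewrite col_l2_out // gtn_eqF.
Qed.

Lemma col_l2_sum N (v : 'cV[C]_N) : col_l2 v = \sum_j v j 0 *: l2_basis j.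
Proof.
rewrite {1}(matrix_sum_delta v) linear_sum; apply: eq_bigr => j _.
rewrite big_ord1 linearZ; congr (_ *: _); apply: l2_inj => k; rewrite l2_basisE.
have [kN|Nk] := ltnP k N; last by rewrite col_l2_out // gtn_eqF // (leq_trans _ Nk).
by rewrite -[k in LHS]/(val (Ordinal kN)) col_l2E mxE andbT.
Qed.

Lemma bop_col_l2 (f : bop H) N (v : 'cV[C]_N) i :
  f (col_l2 v) i = \sum_j v j 0 * f (l2_basis j) i.
Proof.
rewrite col_l2_sum linear_sum.
have -> (g : 'I_N -> H) : (\sum_j g j) i = \sum_j g j i.
  by elim/big_rec2 : _ => // j a b _ <-.
by apply: eq_bigr => j _; rewrite linearZ.
Qed.

(** The i-th coordinate of f is a functional of norm at most |f|; evaluate it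
    on the vector with coordinates conj(f(e_j)_i), j < n. *)
Lemma bop_row_psum (f : bop H) i n :
  \sum_(0 <= j < n) nc (f (l2_basis j) i) ^+ 2 <= bnorm f ^+ 2.
Proof.
rewrite big_mkord; set S := \sum_j _.
have S0 : 0 <= S by apply: sumr_ge0 => k _; exact: sqr_ge0.
pose v : 'cV[C]_n := \col_j conjc (f (l2_basis j) i).
have vS : frob_sq v = S.
  by apply: eq_bigr => j _; rewrite big_ord1 mxE normc_conj.
have fv : f (col_l2 v) i = S%:C.
  rewrite bop_col_l2 rmorph_sum; apply: eq_bigr => j _; rewrite mxE normc_sq.
  by apply/eqP; rewrite eq_complex; case: (f _ _) => a b /=; apply/andP; split;
    apply/eqP; ring.
have : S ^+ 2 <= bnorm f ^+ 2 * S.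
  have := le_trans (l2_coord_le (f (col_l2 v)) i) (rnorm_bop_le f _).
  rewrite fv normc_real // => h.
  rewrite -[X in _ * X]vS -rnorm_col_l2 -exprMn.
  by rewrite lerXn2r ?nnegrE // mulr_ge0 ?bnorm_ge0 ?rnorm_ge0.
have [->|Sn] := eqVneq S 0; first by rewrite sqr_ge0.
by rewrite expr2 ler_pM2r // lt_neqAle eq_sym Sn.
Qed.

Definition bop_row (f : bop H) i : H := L2 (is_l2_bounded (bop_row_psum f i)).

(** By Cauchy-Schwarz, only the tail of the i-th row of f acts on the tail of
    x. *)
Lemma bop_row_bound (f : bop H) i k x :
  nc (f (x - l2_trunc k x) i) <=
    rnorm (bop_row f i - l2_trunc k (bop_row f i)) * rnorm x.
Proof.
set y := x - l2_trunc k x; set a := bop_row f i; set t := rnorm _.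
have yk j : (j < k)%N -> y j = 0.
  by move=> jk; rewrite /y l2DE -scaleN1r l2ZE l2_truncE jk mulN1r subrr.
apply/ler_addgt0Pr => e e0.
have [l ly] := l2_trunc_cvg y (divr_gt0 e0 (ltr_pwDl ltr01 (bnorm_ge0 f))).
have -> : f y = f (l2_trunc l y) + f (y - l2_trunc l y) by rewrite -linearD
  addrC subrK.
rewrite l2DE; apply: le_trans (normcD _ _) _; apply: lerD.
  rewrite /l2_trunc bop_col_l2.
  have -> : \sum_j l2_col l y j 0 * f (l2_basis j) i =
      frob_dot (l2_col l y) (\col_j conjc ((a - l2_trunc k a) j)).
    apply: eq_bigr => j _; rewrite big_ord1 !mxE conjcK.
    have [jk|kj] := ltnP j k; first by rewrite yk // !mul0r.
    by rewrite l2DE -scaleN1r l2ZE l2_truncE ltnNge kj /= mulr0 addr0.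
  rewrite mulrC; apply: frob_dot_le; rewrite ?rnorm_ge0 //.
    apply: le_trans (frob_sq_l2_col_le _ _) _.
    by rewrite lerXn2r ?nnegrE ?rnorm_ge0 // rnorm_l2_truncB.
  apply: le_trans (frob_sq_l2_col_le l _); rewrite le_eqVlt; apply/orP; left;
    apply/eqP.
  by apply: eq_bigr => j _; rewrite !big_ord1 !mxE normc_conj.
apply: le_trans (l2_coord_le _ _) _; apply: le_trans (rnorm_bop_le _ _) _.
apply: le_trans (_ : (1 + bnorm f) * rnorm (y - l2_trunc l y) <= _).
  by rewrite ler_wpM2r ?rnorm_ge0 // lerDr.
by rewrite mulrC -ler_pdivlMr ?(ltW ly) // ltr_pwDl // bnorm_ge0.
Qed.

Lemma bop_row_trunc (f : bop H) d (e : R) : 0 < e ->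
  exists k0, forall k, (k0 <= k)%N -> forall x,
    rnorm (l2_trunc d (f (x - l2_trunc k x))) <= e * rnorm x.
Proof.
move=> e0; pose e' := e / d.+1%:R.
have e'0 : 0 < e' by rewrite divr_gt0 // ltr0n.
have [h hP] := fin_all_exists (fun i : 'I_d => l2_trunc_cvg (bop_row f i) e'0).
exists (\max_i h i)%N => k kh x.
rewrite -(ler_pXn2r (n := 2)) ?nnegrE ?mulr_ge0 ?rnorm_ge0 ?(ltW e0) //.
rewrite rnorm_col_l2.
apply: (@le_trans _ _ (\sum_(i < d) (e' * rnorm x) ^+ 2)).
  apply: ler_sum => i _; rewrite big_ord1 mxE.
  rewrite lerXn2r ?nnegrE ?normc_ge0 ?mulr_ge0 ?rnorm_ge0 ?(ltW e0) ?(ltW e'0)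
    ?divr_ge0 ?ler0n //.
  apply: le_trans (bop_row_bound _ _ _ _) _; rewrite ler_wpM2r ?rnorm_ge0 //.
  apply: le_trans (ltW (hP i)); apply: l2_trunc_mono; apply: leq_trans kh.
  exact: leq_bigmax.
rewrite sumr_const card_ord -[leLHS]mulr_natl !exprMn mulrA ler_wpM2r ?sqr_ge0 //.
rewrite mulrCA ler_piMr ?sqr_ge0 // exprVn ler_pdivrMr ?exprn_gt0 ?ltr0n //.
rewrite mul1r -natrX ler_nat (leq_trans (leqnSn d)) // expnS expn1.
by rewrite leq_pmulr.
Qed.

(** With P_d the truncation and Q_d = 1 - P_d,
    f - P_d f P_d = Q_d f + P_d (Q_m f) Q_d + P_m f Q_d for m <= d.  The first
    two terms are small by [compact_op_trunc], the last by [bop_row_trunc]. *)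
Lemma compact_op_approx (f : bop H) (e : R) : compact_op f -> 0 < e ->
  exists d0, forall d, (d0 <= d)%N -> forall x,
    rnorm (f x - l2_trunc d (f (l2_trunc d x))) <= e * rnorm x.
Proof.
move=> cf e0; have e30 : 0 < e / 3 by rewrite divr_gt0.
have [m mP] := compact_op_trunc cf e30.
have [k kP] := bop_row_trunc f m e30.
exists (maxn m k) => d; rewrite geq_max => /andP[md kd] x.
pose y := x - l2_trunc d x.
have -> : f x - l2_trunc d (f (l2_trunc d x)) = (f x - l2_trunc d (f x)) +
    ((l2_trunc d (f y - l2_trunc m (f y))) + l2_trunc m (f y)).
  rewrite linearB /= (_ : l2_trunc d (l2_trunc m (f y)) = l2_trunc m (f y)).
    by rewrite subrK /y !linearB /= addrA subrK.
  apply: l2_inj => j; rewrite !l2_truncE; case: ifP => // jd.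
  by rewrite ifF //; apply: contraFF jd => jm; exact: leq_trans md.
apply: le_trans (ler_rnormD _ _) _;
  apply: le_trans (lerD (lexx _) (ler_rnormD _ _)) _.
have h1 := mP d md x.
have h3 := kP d kd x.
have h2 : rnorm (l2_trunc d (f y - l2_trunc m (f y))) <= e / 3 * rnorm x.
  apply: le_trans (rnorm_l2_trunc _ _) _; apply: le_trans (mP m (leqnn m) y) _.
  by rewrite ler_wpM2l ?(ltW e30) // rnorm_l2_truncB.
rewrite -/y in h3; lra.
Qed.

End Compact.

(** * Matrices of operators *)

Section MatrixOperators.
Local Open Scope classical_set_scope.
Local Open Scope ring_scope.
Local Open Scope complex_scope.
Variable R : realType.
Local Notation C := R[i].
Local Notation nc := (@Normc.normc R).
Local Notation H := (l2 R).

Lemma bounded_continuous (V W : normedModType C) (f : {linear V -> W}) (c : R) :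
  (forall x, rnorm (f x) <= c * rnorm x) -> continuous f.
Proof.
move=> fc; apply: bounded_linear_continuous; apply/linear_boundedP.
exists c%:C; split; first by rewrite complex_real.
move=> r cr x; rewrite -!rnormE (@le_trans _ _ (c%:C * (rnorm x)%:C)) //.
  by rewrite -rmorphM lecR.
by rewrite ler_wpM2r ?(ltW cr) // ler0c rnorm_ge0.
Qed.

Section MatrixBop.
Variable N : nat.
Implicit Type B : 'M[C]_N.

Definition matrix_bop_fun B (x : H) : H := col_l2 (B *m l2_col N x).

Lemma matrix_bop_fun_linear B : linear (matrix_bop_fun B).
Proof. by move=> a x y; rewrite /matrix_bop_fun linearP mulmxDr -scalemxAr
  linearP. Qed.

Lemma matrix_bop_fun_bound B x :
  rnorm (matrix_bop_fun B x) <= Num.sqrt (frob_sq B) * rnorm x.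
Proof.
rewrite -(ler_pXn2r (n := 2)) ?nnegrE ?mulr_ge0 ?rnorm_ge0 ?sqrtr_ge0 //.
rewrite rnorm_col_l2 exprMn sqr_sqrtr ?frob_sq_ge0 //
  (le_trans (frob_sq_mulmx_le _ _)) //.
by rewrite ler_wpM2l ?frob_sq_ge0 ?frob_sq_l2_col_le.
Qed.

Lemma matrix_bop_fun_bop B : matrix_bop_fun B \in @is_bop R H.
Proof.
apply/asboolP; split; first exact: matrix_bop_fun_linear.
pose m := GRing.isLinear.Build C _ _ _ (matrix_bop_fun B) (matrix_bop_fun_linear B).
pose f : {linear H -> H} := HB.pack (matrix_bop_fun B) m.
exact: (@bounded_continuous _ _ f _ (matrix_bop_fun_bound B)).
Qed.

Definition matrix_bop B : bop H := Bop (matrix_bop_fun_bop B).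

Lemma matrix_bop_linear : linear matrix_bop.
Proof.
move=> a A B; apply: bopP => x.
by rewrite bopDE bopZE /= /matrix_bop_fun mulmxDl -scalemxAl linearP.
Qed.

(** Apply the contraction in each coordinate of l2 separately. *)
Lemma contraction_l2_amplification B :
  (forall x : 'cV_N, frob_sq (B *m x) <= frob_sq x) ->
  forall z : 'I_N -> H,
    \sum_g rnorm (\sum_h B g h *: z h) ^+ 2 <= \sum_h rnorm (z h) ^+ 2.
Proof.
move=> BC z; pose y g := \sum_h B g h *: z h.
have yE g k : y g k = \sum_h B g h * z h k.
  by rewrite /y; elim/big_rec2 : _ => // h a b _ <-.
have cv : ((fun n => \sum_g [series nc (y g k) ^+ 2]_k n) @ \oo -->
    \sum_g rnorm (y g) ^+ 2).
  by apply: cvg_big => [|i _]; [exact: add_continuous|exact: l2_cvg].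
apply: (cvgr_to_le cv); apply: nearW => n.
rewrite /series /= exchange_big /=.
apply: (@le_trans _ _ (\sum_(0 <= k < n) \sum_h nc (z h k) ^+ 2)).
  apply: ler_sum => k _; have := BC (\col_h z h k); rewrite !frob_sq_cV.
  have -> : \sum_g nc (y g k) ^+ 2 = \sum_g nc ((B *m \col_h z h k) g 0) ^+ 2.
    apply: eq_bigr => g _; rewrite yE mxE.
    by congr (nc _ ^+ 2); apply: eq_bigr => h _; rewrite mxE.
  by move=> /le_trans; apply; apply: ler_sum => h _; rewrite mxE.
by rewrite exchange_big; apply: ler_sum => h _; exact: l2_psum_le.
Qed.

End MatrixBop.

Section MxopNorm.
Variables (K : hilbertType R) (N : nat).
Implicit Type A : 'M[bop K]_N.

Lemma mxop_norm_le A (c : R) :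
  (forall xi : 'I_N -> K, \sum_j rnorm (xi j) ^+ 2 <= 1 ->
     \sum_i rnorm (\sum_j A i j (xi j)) ^+ 2 <= c ^+ 2) -> 0 <= c ->
  mxop_norm A <= c.
Proof.
move=> Ac c0; apply: ge_sup; first by case: (has_sup_mxop_norm A).
move=> _ [xi /= xi1 <-]; rewrite -(ger0_norm c0) -sqrtr_sqr.
by rewrite ler_wsqrtr // Ac.
Qed.

Lemma mxop_norm_ge A (xi : 'I_N -> K) : \sum_j rnorm (xi j) ^+ 2 <= 1 ->
  \sum_i rnorm (\sum_j A i j (xi j)) ^+ 2 <= mxop_norm A ^+ 2.
Proof.
move=> xi1; set S := \sum_i _.
have S0 : 0 <= S by apply: sumr_ge0 => i _; exact: sqr_ge0.
rewrite -(sqr_sqrtr S0).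
have h : Num.sqrt S <= mxop_norm A.
  apply: sup_ubound; first by case: (has_sup_mxop_norm A).
  by exists xi.
by rewrite lerXn2r ?nnegrE ?sqrtr_ge0 // (le_trans _ h) // sqrtr_ge0.
Qed.

Lemma mxop_norm_ge0 A : 0 <= mxop_norm A.
Proof.
have := @mxop_norm_ge A (fun=> 0).
case: (has_sup_mxop_norm A) => _ ub _.
apply: (@le_trans _ _ (Num.sqrt (\sum_i rnorm (\sum_j A i j 0) ^+ 2))).
  exact: sqrtr_ge0.
apply: sup_ubound => //; exists (fun=> 0) => //=.
by rewrite big1 // => j _; rewrite rnorm0 expr0n.
Qed.

Lemma mxop_normZ_le A (t : R) : 0 <= t ->
  mxop_norm (map_mx ( *:%R t%:C) A) <= t * mxop_norm A.
Proof.
move=> t0; apply: mxop_norm_le => [xi xi1|]; last by rewrite mulr_ge0 ?mxop_norm_ge0.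
have h := ler_wpM2l (sqr_ge0 t) (mxop_norm_ge A xi1).
rewrite exprMn; apply: (le_trans _ h).
rewrite mulr_sumr; apply: ler_sum => i _.
under eq_bigr do rewrite mxE bopZE.
by rewrite -scaler_sumr rnormZ exprMn normc_real.
Qed.

End MxopNorm.

Lemma mxop_norm11 (K : hilbertType R) (f : bop K) (x : K) :
  rnorm (f x) <= mxop_norm (const_mx f : 'M[bop K]_1) * rnorm x.
Proof.
have m0 := mxop_norm_ge0 (const_mx f : 'M[bop K]_1).
apply: (@rnorm_scale_le _ _ _ f _ m0) => {}x x1.
rewrite -(ler_pXn2r (n := 2)) ?nnegrE ?rnorm_ge0 //.
have := @mxop_norm_ge K 1 (const_mx f) (fun=> x).
by rewrite !big_ord1 mxE; apply; rewrite exprn_ile1 ?rnorm_ge0.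
Qed.

Lemma mxop_norm11_le (K : hilbertType R) (f : bop K) (c : R) : 0 <= c ->
  (forall x, rnorm (f x) <= c * rnorm x) -> mxop_norm (const_mx f : 'M[bop K]_1) <= c.
Proof.
move=> c0 fc; apply: mxop_norm_le => // xi; rewrite !big_ord1 mxE => xi1.
rewrite lerXn2r ?nnegrE ?rnorm_ge0 //; apply: le_trans (fc _) _.
by rewrite ler_piMr // -(@ler_pXn2r _ 2) ?nnegrE ?rnorm_ge0 // expr1n.
Qed.

Lemma sqrD_le (a b t : R) : 0 < t ->
  (a + b) ^+ 2 <= (1 + t) * a ^+ 2 + (1 + t^-1) * b ^+ 2.
Proof.
move=> t0; rewrite -subr_ge0.
have -> : (1 + t) * a ^+ 2 + (1 + t^-1) * b ^+ 2 - (a + b) ^+ 2 =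
          t^-1 * (t * a - b) ^+ 2 by field; rewrite gt_eqF.
by rewrite mulr_ge0 ?sqr_ge0 // invr_ge0 ltW.
Qed.

Lemma rnormD_sq (V : normedModType C) (x y : V) (t : R) : 0 < t ->
  rnorm (x + y) ^+ 2 <= (1 + t) * rnorm x ^+ 2 + (1 + t^-1) * rnorm y ^+ 2.
Proof.
move=> t0; apply: le_trans (sqrD_le _ _ t0).
by rewrite lerXn2r ?nnegrE ?addr_ge0 ?rnorm_ge0 // ler_rnormD.
Qed.

Lemma rnorm_sum_sq (V : normedModType C) r (x : 'I_r -> V) :
  rnorm (\sum_k x k) ^+ 2 <= r%:R * \sum_k rnorm (x k) ^+ 2.
Proof.
apply: (@le_trans _ _ ((\sum_k 1 * rnorm (x k)) ^+ 2)).
  have s0 : 0 <= \sum_k 1 * rnorm (x k).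
    by apply: sumr_ge0 => k _; rewrite mul1r rnorm_ge0.
  rewrite lerXn2r ?nnegrE ?rnorm_ge0 // (le_trans (rnorm_sum _)) //.
  by apply: ler_sum => k _; rewrite mul1r.
apply: le_trans (sum_CauchySchwarz _ _) _.
rewrite ler_wpM2r //; first by apply: sumr_ge0 => k _; exact: sqr_ge0.
by under eq_bigr do rewrite expr1n; rewrite sumr_const card_ord.
Qed.

(** Replace each f_k by a finite section Z_k, so close that the error, spread
    over the contractions b_k, is of order e.  The order of choices matters: the
    section is fixed first, and b depends on its size.  As
    |Z_k|, |Z_k^*| <= c_k, the row and column bounds of the transposes
    of the Z_k follow from the bound on the sum of the c_k^2. *)
Lemma asymptotically_free_compact r (f : 'I_r -> bop H) (c : 'I_r -> R) (K e d : R) :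
  0 < K -> 0 < e -> e <= 1 -> 0 < d ->
  (forall k, 0 <= c k) ->
  (forall k x, rnorm (f k x) <= c k * rnorm x) ->
  \sum_k c k ^+ 2 <= K ^+ 2 -> (forall k, compact_op (f k)) ->
  exists N (b : 'I_r -> 'M[C]_N), [/\ (0 < N)%N,
    forall xi : 'I_N -> H,
      \sum_g rnorm (\sum_h \sum_k b k g h *: f k (xi h)) ^+ 2 <=
        4 * K ^+ 2 * (1 + e) ^+ 3 * \sum_h rnorm (xi h) ^+ 2,
    forall (t : 'I_r -> C) (x : 'cV_N),
      frob_sq (\sum_k t k *: (b k *m x)) <=
        4 * (1 + e) * (\sum_k nc (t k) ^+ 2) * frob_sq x
  & forall k l, nc (frob_dot (b k) (b l) - (N * (k == l))%:R) <= d * N%:R].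
Proof.
move=> K0 e0 e1 d0 c0 fc cK fco.
(* With this eta the error term (1 + 1/e) r^2 eta^2 stays below 4 K^2 e. *)
pose eta := K * e / r.+1%:R.
have eta0 : 0 < eta by rewrite divr_gt0 ?mulr_gt0 // ltr0n.
have [D0 D0P] := fin_all_exists (fun k => compact_op_approx (fco k) eta0).
pose D := (\max_k D0 k)%N.
have DP k x : rnorm (f k x - l2_trunc D (f k (l2_trunc D x))) <= eta * rnorm x.
  by apply: D0P; exact: leq_bigmax.
pose Z k : 'M[C]_D := \matrix_(i, j) f k (l2_basis R j) i.
have ZE k v : l2_col D (f k (col_l2 v)) = Z k *m v.
  apply/colP => i; rewrite !mxE bop_col_l2; apply: eq_bigr => j _.
  by rewrite mxE mulrC.
have Zc k (v : 'cV_D) : frob_sq (Z k *m v) <= c k ^+ 2 * frob_sq v.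
  rewrite -ZE; apply: le_trans (frob_sq_l2_col_le _ _) _;
    rewrite -rnorm_col_l2 -exprMn.
  by rewrite lerXn2r ?nnegrE ?mulr_ge0 ?rnorm_ge0.
have sT m n (A : 'M[C]_(m, n)) : frob_sq A^T = frob_sq A.
  by rewrite /frob_sq exchange_big; apply: eq_bigr => i _;
    apply: eq_bigr => j _; rewrite mxE.
have sumK (B : 'I_r -> 'M[C]_D) :
    (forall k (v : 'cV_D), frob_sq (B k *m v) <= c k ^+ 2 * frob_sq v) ->
    forall v : 'rV_D, \sum_k frob_sq (v *m (B k)^T) <= K ^+ 2 * frob_sq v.
  move=> Bc v; apply: (@le_trans _ _ (\sum_k c k ^+ 2 * frob_sq v)).
    by apply: ler_sum => k _; rewrite -sT trmx_mul trmxK -(sT _ _ v).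
  by rewrite -mulr_suml ler_wpM2r ?frob_sq_ge0.
have y1 := sumK Z Zc.
have y2 (v : 'rV_D) : \sum_k frob_sq (v *m adjmx (Z k)^T) <= K ^+ 2 * frob_sq v.
  rewrite (eq_bigr (fun k => frob_sq (v *m (adjmx (Z k))^T))).
    by apply: sumK => k; exact: adjmx_bound.
  move=> k _; congr (frob_sq (_ *m _)); apply/matrixP => i j; by rewrite !mxE.
pose e' := Num.min e d.
have e'0 : 0 < e' by rewrite lt_min e0.
have e'e : e' <= e by rewrite ge_min lexx.
have e'd : e' <= d by rewrite ge_min lexx orbT.
have [N [b [N0 b1 b2 b3 b4]]] := asymptotically_free_matrices K0 e'0 y1 y2.
exists N, b; split => //; last 2 first.
- move=> t x; apply: le_trans (b2 t x) _; rewrite ler_wpM2r ?frob_sq_ge0 //.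
  rewrite ler_wpM2r //; first by apply: sumr_ge0 => k _; exact: sqr_ge0.
  lra.
- by move=> k l; apply: le_trans (b4 k l) _; rewrite ler_wpM2r.
move=> xi; set S := \sum_h rnorm (xi h) ^+ 2.
have S0 : 0 <= S by apply: sumr_ge0 => k _; exact: sqr_ge0.
pose er k x := f k x - l2_trunc D (f k (l2_trunc D x)).
pose p g : 'cV[C]_D := \sum_k \sum_h b k g h *: (Z k *m l2_col D (xi h)).
pose q k g := \sum_h b k g h *: er k (xi h).
have E g : \sum_h \sum_k b k g h *: f k (xi h) = col_l2 (p g) + \sum_k q k g.
  rewrite linear_sum exchange_big -big_split; apply: eq_bigr => k _ /=.
  rewrite linear_sum -big_split; apply: eq_bigr => h _ /=.
  by rewrite linearZ /= -scalerDr -ZE addrC subrK.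
have P : \sum_g rnorm (col_l2 (p g)) ^+ 2 <= 4 * K ^+ 2 * (1 + e) * S.
  pose x : 'M[C]_(N, D) := \matrix_(h, j) l2_col D (xi h) j 0.
  have xS : frob_sq x <= S.
    rewrite frob_sq_row; apply: ler_sum => h _;
      apply: le_trans (frob_sq_l2_col_le D _).
    by rewrite -sT frob_sq_cV frob_sq_cV; apply: ler_sum => i _; rewrite !mxE.
  have -> : \sum_g rnorm (col_l2 (p g)) ^+ 2 = frob_sq (\sum_k b k *m x *m (Z k)^T).
    rewrite frob_sq_row; apply: eq_bigr => g _; rewrite rnorm_col_l2 -sT;
      congr frob_sq.
    apply/rowP => i; rewrite /p mxE [RHS]mxE !summxE; apply: eq_bigr => k _.
    rewrite summxE -mulmxA mxE; apply: eq_bigr => h _; rewrite mxE.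
    by congr (_ * _); rewrite !mxE; apply: eq_bigr => j _; rewrite !mxE mulrC.
  apply: le_trans (b1 x) _; apply: ler_pM => //; rewrite ?frob_sq_ge0 //.
    rewrite mulr_ge0 ?mulr_ge0 ?sqr_ge0 //; lra.
  rewrite ler_wpM2l ?mulr_ge0 ?sqr_ge0 //; lra.
have Q : \sum_g rnorm (\sum_k q k g) ^+ 2 <= r%:R * (r%:R * (eta ^+ 2 * S)).
  apply: (@le_trans _ _ (\sum_g r%:R * \sum_k rnorm (q k g) ^+ 2)).
    by apply: ler_sum => g _; exact: rnorm_sum_sq.
  rewrite -mulr_sumr ler_wpM2l // exchange_big /=.
  apply: (@le_trans _ _ (\sum_(k < r) eta ^+ 2 * S)); last first.
    by rewrite sumr_const card_ord -[leLHS]mulr_natl.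
  apply: ler_sum => k _.
  apply: le_trans (contraction_l2_amplification (b3 k) (fun h => er k (xi h))) _.
  rewrite mulr_sumr; apply: ler_sum => h _; rewrite -exprMn.
  have eg : 0 <= eta * rnorm (xi h).
    by apply: mulr_ge0; [exact: ltW|exact: rnorm_ge0].
  by rewrite lerXn2r ?nnegrE ?rnorm_ge0 //; exact: DP.
apply: (@le_trans _ _ (\sum_g ((1 + e) * rnorm (col_l2 (p g)) ^+ 2 +
    (1 + e^-1) * rnorm (\sum_k q k g) ^+ 2))).
  by apply: ler_sum => g _; rewrite E; exact: rnormD_sq.
rewrite big_split -!mulr_sumr /=.
have e10 : 0 < 1 + e by lra.
have ei0 : 0 < 1 + e^-1 by rewrite addr_gt0 // invr_gt0.
apply: le_trans (lerD (ler_wpM2l (ltW e10) P) (ler_wpM2l (ltW ei0) Q)) _.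
have Hq : (1 + e^-1) * (r%:R * (r%:R * eta ^+ 2)) <= 4 * K ^+ 2 * e.
  have rr : (r%:R / r.+1%:R) ^+ 2 <= 1 :> R.
    rewrite exprn_ile1 // ?divr_ge0 // ler_pdivrMr ?ltr0n // mul1r ler_nat.
    exact: leqnSn.
  have -> : (1 + e^-1) * (r%:R * (r%:R * eta ^+ 2)) =
     (1 + e) * e * K ^+ 2 * (r%:R / r.+1%:R) ^+ 2.
    by rewrite /eta; field; rewrite nat1r pnatr_eq0 /= gt_eqF.
  apply: (@le_trans _ _ ((1 + e) * e * K ^+ 2)).
    by rewrite ler_piMr // !mulr_ge0 ?sqr_ge0 // ltW.
  have : (1 + e) * (e * K ^+ 2) <= 4 * (e * K ^+ 2).
    by rewrite ler_wpM2r ?mulr_ge0 ?sqr_ge0 ?(ltW e0) //; lra.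
  lra.
have HS := ler_wpM2r S0 Hq.
have -> : (1 + e^-1) * (r%:R * (r%:R * (eta ^+ 2 * S))) =
  (1 + e^-1) * (r%:R * (r%:R * eta ^+ 2)) * S by ring.
apply: le_trans (lerD (lexx _) HS) _.
have -> : 4 * K ^+ 2 * (1 + e) ^+ 3 * S = (1 + e) * (4 * K ^+ 2 * (1 + e) * S) +
   4 * K ^+ 2 * e * S + 4 * K ^+ 2 * S * (e ^+ 2 * (2 + e)) by ring.
rewrite lerDl !mulr_ge0 ?sqr_ge0 //; lra.
Qed.

End MatrixOperators.

(** * Maps between max(E) and quotients of spaces of compact operators *)

Lemma sub_val0 (K : pzRingType) (V : lmodType K) (S : Defs.subspace V) :
  val (0 : subspace_type S) = 0.
Proof. by []. Qed.

Lemma sub_valD (K : pzRingType) (V : lmodType K) (S : Defs.subspace V)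
    (x y : subspace_type S) : val (x + y) = val x + val y.
Proof. by []. Qed.

Lemma sub_valB (K : pzRingType) (V : lmodType K) (S : Defs.subspace V)
    (x y : subspace_type S) : val (x - y) = val x - val y.
Proof. by []. Qed.

Lemma sub_valZ (K : pzRingType) (V : lmodType K) (S : Defs.subspace V) t
    (x : subspace_type S) : val (t *: x) = t *: val x.
Proof. by []. Qed.

Lemma lin_scale (K : pzRingType) (V W : lmodType K) (f : {linear V -> W}) t x :
  f (t *: x) = t *: f x.
Proof. exact: linearZ. Qed.

Lemma lin_comb (K : pzRingType) (V W : lmodType K) (f : {linear V -> W})
    (I : finType) (t : I -> K) x : f (\sum_i t i *: x i) = \sum_i t i *: f (x i).
Proof. by rewrite linear_sum; apply: eq_bigr => i _; rewrite linearZ. Qed.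

Section MaxQuotient.
Local Open Scope classical_set_scope.
Local Open Scope ring_scope.
Local Open Scope complex_scope.
Variable R : realType.
Local Notation C := R[i].
Local Notation nc := (@Normc.normc R).
Local Notation H := (l2 R).

Lemma predT_submod : submod_closed (predT : {pred bop H}).
Proof. by split. Qed.

Definition all_bop : Defs.subspace (bop H) := Subspace predT_submod.

Lemma all_bop_closed : closed [set` all_bop].
Proof.
rewrite (_ : [set` all_bop] = setT); first exact: closedT.
by rewrite predeqE.
Qed.

Definition bop_space : opspace R := OpSpace all_bop_closed.

Definition to_bop_space (f : bop H) : ops_type bop_space :=
  @SubspaceElt _ _ all_bop f isT.

Lemma map_val11 (K : hilbertType R) (S : Defs.subspace (bop K))
  (A : 'M[subspace_type S]_1) : map_mx val A = const_mx (val (A 0 0)).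
Proof. by apply/matrixP => i j; rewrite !mxE !ord1. Qed.

Lemma cbnorm_ge (V W : lmodType C) (P : mxnorms V) (Q : mxnorms W) (f : V -> W)
  k (A : 'M[V]_k) : P k A <= 1 -> ((Q k (map_mx f A))%:E <= cbnorm P Q f)%E.
Proof. by move=> A1; apply: ereal_sup_ubound; exists k, A. Qed.

Section Factorisation.
Variables (n : nat) (E : normedModType C) (M : mxnorms E).
Variables (E1 E2 : Defs.subspace (bop H)).
Variables (u : {linear E -> op_quot E1 E2}) (v : {linear op_quot E1 E2 -> E}).
Hypothesis dimE : has_dim n E.
Hypothesis maxM : is_max M.
Hypothesis E1c : [set` E1] `<=` @compact_op R H.
Hypothesis uK : cancel u v.

Local Notation QN := (@quot_mxnorms R H E1 E2).
Local Notation pi := (lquot_pi (rel_subspace E1 E2)).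

Lemma piZ (t : C) x : pi (t *: x) = t *: (pi x : op_quot E1 E2).
Proof.
have := lquot_pi_linear (rel_subspace E1 E2) t x 0.
by rewrite (linear0 (lquot_pi (rel_subspace E1 E2))) !addr0.
Qed.

Lemma pi_sum (I : finType) (t : I -> C) x :
  pi (\sum_i t i *: x i) = \sum_i t i *: (pi (x i) : op_quot E1 E2).
Proof.
elim/big_rec2 : _ => [|i p q _ <-]; last exact: lquot_pi_linear.
exact: (linear0 (lquot_pi (rel_subspace E1 E2))).
Qed.

Lemma pi_eqP (x y : subspace_type E1) :
  reflect (pi x = pi y) (val x - val y \in subspace_pred E2).
Proof. by rewrite -sub_valB; exact: (lquot_piP (rel_subspace E1 E2) x y). Qed.

Lemma quot_le k (A : 'M[subspace_type E1]_k) : QN (map_mx pi A) <= sub_mxnorms A.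
Proof.
apply: ge_inf; last by exists A.
by exists 0 => _ [B _ <-]; exact: mxop_norm_ge0.
Qed.

Lemma quot_lift k (B : 'M[op_quot E1 E2]_k) (c : R) : QN B < c ->
  exists2 A : 'M[subspace_type E1]_k, map_mx pi A = B & sub_mxnorms A < c.
Proof.
move=> Bc; have [||] := @inf_adherent R [set sub_mxnorms A | A in
    [set A : 'M[subspace_type E1]_k | map_mx pi A = B]] (c - QN B).
- by rewrite subr_gt0.
- split; last by exists 0 => _ [A _ <-]; exact: mxop_norm_ge0.
  have [f fB] := fin_all_exists (fun i => fin_all_exists (fun j =>
    lquot_pi_surj (B i j))).
  exists (sub_mxnorms (\matrix_(i, j) f i j)), (\matrix_(i, j) f i j) => //.
  by apply/matrixP => i j; rewrite !mxE.
by move=> _ [A /= AB <-]; rewrite -/(QN B) subrKC => Ac; exists A.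
Qed.

Lemma max_scale k (A : 'M[E]_k) (t : R) : 0 <= t ->
  M (map_mx ( *:%R t%:C) A) <= t * M A.
Proof.
move=> t0; case: maxM => -[F [j [_ jM]]] _ _; rewrite !jM.
rewrite /ops_mxnorms /sub_mxnorms.
apply: le_trans (mxop_normZ_le _ t0); rewrite le_eqVlt; apply/orP; left; apply/eqP.
by congr mxop_norm; apply/matrixP => i l; rewrite !mxE linearZ.
Qed.

Lemma max_norm11 (x : E) : M (const_mx x : 'M[E]_1) = rnorm x.
Proof. by case: maxM. Qed.

(** The map u is bounded with constant a, since its completely bounded norm
    dominates its norm on 1 x 1 matrices. *)
Lemma lift_bound (a e : R) : cbnorm M QN u = a%:E -> 0 < e ->
  forall x, exists2 y, pi y = u x &
    forall z, rnorm (val y z) <= (a + e) * rnorm x * rnorm z.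
Proof.
move=> ua e0 x; have [x0|x0] := eqVneq (rnorm x) 0.
  exists 0; first by rewrite (rnorm0_eq0 x0) !linear0.
  by move=> z; rewrite x0 mulr0 mul0r rnorm0.
have xp : 0 < rnorm x by rewrite lt_neqAle eq_sym x0 rnorm_ge0.
pose x' := (rnorm x)^-1%:C *: x.
have x'1 : rnorm x' = 1.
  by rewrite rnormZ normc_real ?invr_ge0 ?(ltW xp) // mulVf.
have Qa : QN (map_mx u (const_mx x' : 'M[E]_1)) <= a.
  by rewrite -lee_fin -ua; apply: cbnorm_ge; rewrite max_norm11 x'1.
have ae : a < a + e by rewrite ltrDl.
have [A AB Ac] := quot_lift (le_lt_trans Qa ae).
exists ((rnorm x)%:C *: A 0 0).
  have piA : pi (A 0 0) = u x' by move/matrixP/(_ 0 0): AB; rewrite !mxE.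
  rewrite piZ piA -linearZ /x'.
  by rewrite scalerA -rmorphM divff // scale1r.
move=> z.
rewrite sub_valZ bopZE rnormZ normc_real ?(ltW xp) //.
rewrite mulrAC [leRHS]mulrC ler_pM2l //.
apply: (le_trans (mxop_norm11 (val (A 0 0)) z)).
apply: ler_wpM2r; first exact: rnorm_ge0.
rewrite -(map_val11 A); exact: (ltW Ac).
Qed.

(** The trace argument described at the top, with all approximations of order e
    kept explicit.  In the proof, T is the matrix sum_k b_k (x) x_k up to
    normalisation, w0 is the map y |-> sum_l beta_l(y) conj(b_l), and xi is the
    maximally entangled vector. *)
Lemma key_inequality (a b e : R) : (0 < n)%N -> 0 <= a -> 0 <= b ->
  cbnorm M QN u = a%:E -> cbnorm QN M v = b%:E -> 0 < e -> e <= 1 ->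
  (n%:R - e) ^+ 2 <=
    16 * (1 + e) ^+ 4 * (n%:R + e) * (a + e) ^+ 2 * (b + e) ^+ 2.
Proof.
move=> n0 a0 b0 ua vb e0 e1.
set K := a + e; set b1 := b + e.
have K0 : 0 < K by rewrite /K; lra.
have b10 : 0 < b1 by rewrite /b1; lra.
have ne0 : 0 < n%:R + e by rewrite addr_gt0 ?ltr0n.
have e10 : 0 < 1 + e by lra.
have [r [x [be [beL x1 bex bebd]]]] := two_summing_identity dimE e0.
have [y yP] := fin_all_exists (fun k =>
  let: ex_intro2 y p q := lift_bound ua e0 (x k) in ex_intro _ y (conj p q)).
pose c k := K * rnorm (x k).
have c0 k : 0 <= c k by rewrite mulr_ge0 ?rnorm_ge0 // ltW.
have cK : \sum_k c k ^+ 2 <= K ^+ 2.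
  under eq_bigr do rewrite exprMn.
  by rewrite -mulr_sumr ler_piMr ?sqr_ge0.
pose S := \sum_k \sum_l nc (be l (x k)).
have S0 : 0 <= S by do 2![apply: sumr_ge0 => ? _]; exact: normc_ge0.
(* Off-diagonal traces of size d perturb the final sum Pi by at most S d N. *)
pose d := e / (1 + S).
have d0 : 0 < d by rewrite divr_gt0 //; lra.
have dS : S * d <= e.
  by rewrite /d mulrCA ler_piMr ?(ltW e0) // ler_pdivrMr; lra.
have fc k z : rnorm (val (y k) z) <= c k * rnorm z by case: (yP k).
have fco k : compact_op (val (y k)) by apply: E1c; exact: (subspace_valP (y k)).
have [N [B [N0 B1 B2 B3]]] := asymptotically_free_compact K0 e0 e1 d0 c0 fc cK fco.
have N0' : 0 < N%:R :> R by rewrite ltr0n.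
pose k2 := 4 * K ^+ 2 * (1 + e) ^+ 3.
have k20 : 0 < k2 by rewrite !mulr_gt0 ?exprn_gt0.
pose kap := Num.sqrt k2.
have kap0 : 0 < kap by rewrite sqrtr_gt0.
have kapE : kap ^+ 2 = k2 by rewrite sqr_sqrtr // ltW.
pose A : 'M[subspace_type E1]_N :=
  \matrix_(g, h) (kap^-1%:C *: \sum_k B k g h *: y k).
have vS (t : 'I_r -> C) z :
    val (\sum_k t k *: y k) z = \sum_k t k *: val (y k) z.
  elim/big_rec2 : _ => [|k p q _ <-]; first by rewrite sub_val0.
  by rewrite sub_valD sub_valZ bopDE bopZE.
have A1 : sub_mxnorms A <= 1.
  apply: mxop_norm_le => // xi xi1; rewrite expr1n.
  have h := le_trans (B1 xi) (ler_piMr (ltW k20) xi1).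
  have -> : \sum_g rnorm (\sum_h map_mx val A g h (xi h)) ^+ 2 =
      k2^-1 * \sum_g rnorm (\sum_h \sum_k B k g h *: val (y k) (xi h)) ^+ 2.
    rewrite mulr_sumr; apply: eq_bigr => g _.
    rewrite -kapE -exprVn -[kap^-1]normc_real ?invr_ge0 ?(ltW kap0) //.
    rewrite -exprMn -rnormZ scaler_sumr; congr (rnorm _ ^+ 2).
    by apply: eq_bigr => h' _; rewrite -vS mxE [A g h']mxE sub_valZ bopZE.
  by rewrite ler_pdivrMl // mulr1.
have A2 : QN (map_mx pi A) <= 1 := le_trans (quot_le A) A1.
pose T := map_mx v (map_mx pi A).
have MT : M T <= b by rewrite -lee_fin -vb; exact: cbnorm_ge.
have TE g h : T g h = kap^-1%:C *: \sum_k B k g h *: x k.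
  rewrite mxE [map_mx pi A g h]mxE [A g h]mxE -[RHS]uK; congr (v _).
  rewrite piZ pi_sum (lin_scale u) (lin_comb u).
  by apply: (congr1 ( *:%R _)); apply: eq_bigr => k _; have [-> _] := yP k.
pose T' := map_mx ( *:%R b1^-1%:C) T.
have MT' : M T' <= 1.
  apply: le_trans (max_scale T _) _; first by rewrite invr_ge0 ltW.
  by rewrite ler_pdivrMl // mulr1 (le_trans MT) // /b1 lerDl ltW.
pose Bc l : 'M[C]_N := map_mx (@conjc R) (B l).
pose w0 z : bop H := matrix_bop (\sum_l be l z *: Bc l).
have w0L : linear w0.
  move=> t z z'; rewrite /w0 -matrix_bop_linear; congr matrix_bop.
  rewrite scaler_sumr -big_split; apply: eq_bigr => l _ /=.
  by rewrite beL scalerDl scalerA.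
pose wl : {linear E -> bop H} :=
  HB.pack w0 (GRing.isLinear.Build C _ _ _ w0 w0L).
pose w z : ops_type bop_space := to_bop_space (w0 z).
have wL : linear w.
  by move=> t z z'; apply: val_inj; rewrite /= w0L.
pose wo : {linear E -> ops_type bop_space} :=
  HB.pack w (GRing.isLinear.Build C _ _ _ w wL).
pose om := Num.sqrt (4 * (1 + e) * (n%:R + e)).
have om2 : om ^+ 2 = 4 * (1 + e) * (n%:R + e).
  by rewrite sqr_sqrtr // !mulr_ge0 ?ltW.
have om0 : 0 <= om by exact: sqrtr_ge0.
have w0b z : rnorm (w0 z) <= om * rnorm z.
  rewrite -[rnorm (w0 z)]/(bnorm (w0 z)); apply: bnorm_le => t t1.
  rewrite -(ler_pXn2r (n := 2)) ?nnegrE ?mulr_ge0 ?rnorm_ge0 //.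
  rewrite rnorm_col_l2 exprMn om2.
  pose X : 'cV[C]_N := map_mx (@conjc R) (l2_col N t).
  have -> : frob_sq ((\sum_l be l z *: Bc l) *m l2_col N t) =
      frob_sq (\sum_l conjc (be l z) *: (B l *m X)).
    rewrite mulmx_suml !frob_sq_cV; apply: eq_bigr => i _.
    rewrite -normc_conj !summxE rmorph_sum; congr (nc _ ^+ 2).
    apply: eq_bigr => l _; rewrite -scalemxAl !mxE rmorphM; congr (_ * _).
    rewrite rmorph_sum; apply: eq_bigr => j _.
    by rewrite !mxE rmorphM /= conjcK.
  apply: le_trans (B2 _ _) _.
  have X1 : frob_sq X <= 1.
    have -> : frob_sq X = frob_sq (l2_col N t).
      by rewrite !frob_sq_cV; apply: eq_bigr => i _; rewrite !mxE normc_conj.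
    by apply: le_trans (frob_sq_l2_col_le _ _) _; rewrite exprn_ile1 ?rnorm_ge0.
  under eq_bigr do rewrite normc_conj.
  set sb := \sum_l _; have sb0 : 0 <= sb by apply: sumr_ge0 => l _; exact: sqr_ge0.
  have h := bebd z; rewrite -/sb in h.
  apply: (@le_trans _ _ (4 * (1 + e) * sb)).
    by rewrite ler_piMr // !mulr_ge0 // ltW.
  by rewrite -mulrA -[leRHS]mulrA -[leRHS]mulrA ler_pM2l // ler_pM2l.
have wc : continuous (fun z => val (w z)) := @bounded_continuous _ _ _ wl _ w0b.
have WT : @ops_mxnorms R bop_space N (map_mx w T') <= om.
  rewrite -lee_fin; case: maxM => _ _ /(_ bop_space wo wc) wE.
  apply: (@le_trans _ _ (cbnorm M (@ops_mxnorms R bop_space) wo)).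
    exact: cbnorm_ge.
  rewrite wE; apply: ge_ereal_sup => _ [z /= z1 <-]; rewrite lee_fin.
  by apply: le_trans (w0b z) _; rewrite ler_piMr.
pose s : R := (Num.sqrt N%:R)^-1.
have s0 : 0 <= s by rewrite invr_ge0 sqrtr_ge0.
have s2 : s ^+ 2 = N%:R^-1 by rewrite exprVn sqr_sqrtr.
pose xi (h : 'I_N) : H := s%:C *: col_l2 (delta_mx h (0 : 'I_1)).
have xi1 : \sum_h rnorm (xi h) ^+ 2 <= 1.
  rewrite (eq_bigr (fun=> N%:R^-1)) ?sumr_const ?card_ord => [|h _].
    by rewrite -[leLHS]mulr_natl divff // gt_eqF.
  by rewrite rnormZ normc_real // exprMn s2 rnorm_col_l2 frob_sq_delta mulr1.
pose out g := \sum_h (w0 (T' g h)) (xi h).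
pose W : 'M[bop H]_N := map_mx val (map_mx w T').
have WE g h : W g h = w0 (T' g h) by rewrite /W 2!mxE.
have Wom : mxop_norm W <= om := WT.
have outb : \sum_g rnorm (out g) ^+ 2 <= om ^+ 2.
  have h := mxop_norm_ge W xi1.
  have -> : \sum_g rnorm (out g) ^+ 2 =
      \sum_g rnorm (\sum_h W g h (xi h)) ^+ 2.
    apply: eq_bigr => g _; congr (rnorm _ ^+ 2).
    by apply: eq_bigr => h' _; rewrite WE.
  apply: (le_trans h); rewrite lerXn2r ?nnegrE //; exact: mxop_norm_ge0.
pose Pi := \sum_k \sum_l be l (x k) * frob_dot (B k) (B l).
have be0 l : be l 0 = 0.
  have := beL l 1 0 0; rewrite scale1r addr0 mul1r => h.
  by apply: (addrI (be l 0)); rewrite -h addr0.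
have beZ l t z : be l (t *: z) = t * be l z.
  by rewrite -[t *: z]addr0 beL be0 addr0.
have beT l g h : be l (T' g h) =
    (kap^-1 * b1^-1)%:C * \sum_k B k g h * be l (x k).
  rewrite mxE TE !beZ mulrA -rmorphM mulrC [b1^-1 * _]mulrC [LHS]mulrC; congr (_ * _).
  elim/big_rec2 : _ => [|k p q _ <-]; first exact: be0.
  by rewrite beL.
(* Pairing with xi keeps the coordinate g of the g-th output vector. *)
have outE : \sum_(g < N) out g g = (s * (kap^-1 * b1^-1))%:C * Pi.
  have outgE g : out g g = (s * (kap^-1 * b1^-1))%:C *
      \sum_h \sum_k \sum_l be l (x k) * (B k g h * conjc (B l g h)).
    rewrite l2_sumE mulr_sumr; apply: eq_bigr => h _.
    rewrite col_l2E linearZ /= col_l2K -scalemxAr mxE -colE [col _ _ _ _]mxE summxE.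
    rewrite rmorphM -mulrA; congr (_ * _).
    rewrite exchange_big mulr_sumr; apply: eq_bigr => l _.
    rewrite [(_ *: Bc l) g h]mxE [Bc l g h]mxE beT -mulrA mulr_suml;
      congr (_ * _); apply: eq_bigr => k _.
    by rewrite mulrAC mulrC.
  under eq_bigr do rewrite outgE.
  rewrite -mulr_sumr; congr (_ * _).
  under eq_bigr do rewrite exchange_big.
  rewrite exchange_big; apply: eq_bigr => k _ /=.
  under eq_bigr do rewrite exchange_big.
  rewrite exchange_big; apply: eq_bigr => l _ /=.
  rewrite /frob_dot mulr_sumr; apply: eq_bigr => g _.
  by rewrite mulr_sumr.
have Pib : (n%:R - e) * N%:R <= nc Pi.
  have nNE : \sum_k \sum_l be l (x k) * (N * (k == l))%:R = n%:R * N%:R.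
    rewrite -bex mulr_suml; apply: eq_bigr => k _.
    rewrite (bigD1 k) //= eqxx muln1 big1 ?addr0 // => l lk.
    by rewrite eq_sym (negPf lk) muln0 mulr0.
  have D : nc (n%:R * N%:R - Pi) <= e * N%:R.
    rewrite normcB -nNE -sumrB; apply: le_trans (normc_sum _ _ _) _.
    apply: (@le_trans _ _ (\sum_k \sum_l nc (be l (x k)) * (d * N%:R))).
      apply: ler_sum => k _; rewrite -sumrB; apply: le_trans (normc_sum _ _ _) _.
      apply: ler_sum => l _; rewrite -mulrBr Normc.normcM ler_wpM2l ?normc_ge0 //.
    under eq_bigr do rewrite -mulr_suml.
    by rewrite -mulr_suml -/S mulrA ler_wpM2r.
  have nN : nc (n%:R * N%:R) = n%:R * N%:R.
    rewrite -natrM -(rmorph_nat (real_complex R)) normc_real //.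
    by rewrite natrM.
  have := normcD (n%:R * N%:R - Pi) Pi; rewrite subrK nN mulrBl => h.
  by rewrite lerBlDl (le_trans h) // lerD2r.
have H1 : nc (\sum_(g < N) out g g) ^+ 2 <= N%:R * om ^+ 2.
  apply: (@le_trans _ _ ((\sum_(g < N) 1 * nc (out g g)) ^+ 2)).
    have h0 : 0 <= \sum_(g < N) 1 * nc (out g g).
      by apply: sumr_ge0 => g _; rewrite mul1r normc_ge0.
    rewrite lerXn2r ?nnegrE ?normc_ge0 // (le_trans (normc_sum _ _ _)) //.
    by apply: ler_sum => g _; rewrite mul1r.
  apply: le_trans (sum_CauchySchwarz _ _) _.
  under eq_bigr do rewrite expr1n.
  rewrite sumr_const card_ord ler_wpM2l // (le_trans _ outb) //.
  apply: ler_sum => g _; rewrite lerXn2r ?nnegrE ?normc_ge0 ?rnorm_ge0 //.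
  exact: l2_coord_le.
have t0 : 0 <= kap^-1 * b1^-1 by apply: mulr_ge0; rewrite invr_ge0 ltW.
rewrite outE Normc.normcM normc_real in H1; last by rewrite mulr_ge0.
have nN0 : 0 <= (n%:R - e) * N%:R.
  by rewrite mulr_ge0 // subr_ge0 (le_trans e1) // ler1n.
have st0 : 0 <= s * (kap^-1 * b1^-1) by rewrite mulr_ge0.
have := ler_wpM2l st0 Pib.
have q1 := mulr_ge0 st0 nN0; have q2 := mulr_ge0 st0 (normc_ge0 Pi).
rewrite -(ler_pXn2r (n := 2)) ?nnegrE // => /le_trans/(_ H1).
rewrite !exprMn s2 om2 !exprVn kapE.
have -> : N%:R^-1 * (k2^-1 / b1 ^+ 2) * ((n%:R - e) ^+ 2 * N%:R ^+ 2) =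
    N%:R * ((n%:R - e) ^+ 2 / (k2 * b1 ^+ 2)).
  by field; rewrite !gt_eqF // exprn_gt0.
rewrite ler_pM2l // ler_pdivrMr ?mulr_gt0 ?exprn_gt0 // /k2 => /le_trans; apply.
by rewrite le_eqVlt; apply/orP; left; apply/eqP; ring.
Qed.

Lemma cbnorm_from_max_ge0 : (0 <= cbnorm M QN u)%E.
Proof.
have h : M (const_mx 0 : 'M[E]_1) <= 1 by rewrite max_norm11 rnorm0.
apply: le_trans (cbnorm_ge QN u h); rewrite lee_fin.
apply: lb_le_inf.
  have [f fB] := lquot_pi_surj (u 0).
  pose F : 'M[subspace_type E1]_1 := const_mx f.
  exists (sub_mxnorms F), F => //.
  by apply/matrixP => i j; rewrite !mxE.
by move=> _ [A _ <-]; exact: mxop_norm_ge0.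
Qed.

Lemma cbnorm_to_max_gt (x : E) :
  exists2 t : R, 0 < t & ((t * rnorm x)%:E <= cbnorm QN M v)%E.
Proof.
have [y yx] := lquot_pi_surj (u x).
pose t := (1 + bnorm (val y))^-1.
have B0 := bnorm_ge0 (val y).
have t0 : 0 < t by rewrite invr_gt0; lra.
exists t => //.
pose A : 'M[subspace_type E1]_1 := const_mx (t%:C *: y).
have A1 : sub_mxnorms A <= 1.
  rewrite /sub_mxnorms map_val11; apply: mxop_norm11_le; first exact: ler01.
  move=> z; rewrite [A 0 0]mxE sub_valZ bopZE rnormZ normc_real ?(ltW t0) //
    mul1r ler_pdivrMl; last by lra.
  apply: le_trans (rnorm_bop_le _ _) _; rewrite ler_wpM2r ?rnorm_ge0 //; lra.
have A2 := le_trans (quot_le A) A1.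
have := cbnorm_ge M v A2.
have -> : map_mx v (map_mx pi A) = const_mx (t%:C *: x).
  by apply/matrixP => i j; rewrite !mxE piZ linearZ yx uK.
by rewrite max_norm11 rnormZ normc_real // ltW.
Qed.

(** If u had norm 0, any lift of u x would be a limit of elements of E2, so u x
    would vanish since E2 is closed.  Together with [cbnorm_to_max_gt] this
    excludes products of the form 0 * +oo in the definition of the distance. *)
Lemma cbnorm_from_max_neq0 (x : E) : closed [set` E2] -> rnorm x != 0 ->
  cbnorm M QN u != 0%E.
Proof.
move=> E2c; apply: contraNneq => u0; apply/eqP.
have [y0 y0x] := lquot_pi_surj (u x).
suff y0E : val y0 \in subspace_pred E2.
  have y00 : pi y0 = pi 0 by apply/pi_eqP; rewrite sub_val0 subr0.
  by rewrite -(uK x) -y0x y00 !linear0 rnorm0.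
suff : [set` E2] (val y0) by [].
apply: E2c => B /nbhs_ballP[e e0 eB].
have eE : e = (complex.Re e)%:C by rewrite RRe_real // gtr0_real.
move: e0; rewrite /= eE (ltcR 0) => e0.
pose d := complex.Re e / 2 / (1 + rnorm x).
have x0 := rnorm_ge0 x.
have d0 : 0 < d by rewrite !divr_gt0 //; lra.
have [y yx yb] := lift_bound u0 d0 x.
exists (val y0 - val y); split.
  exact/pi_eqP/(etrans y0x (esym yx)).
apply: eB; rewrite -ball_normE /= opprB addrC subrK eE -rnormE ltcR.
apply: (@le_lt_trans _ _ (complex.Re e / 2)); last by lra.
rewrite -[rnorm _]/(bnorm (val y)); apply: bnorm_le => z z1.
apply: le_trans (yb z) _.
apply: (@le_trans _ _ (d * rnorm x)).
  by rewrite add0r ler_piMr // mulr_ge0 // ltW.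
rewrite /d mulrAC ler_pdivrMr; last by lra.
by rewrite ler_wpM2l //; lra.
Qed.

End Factorisation.

Lemma limit_inequality (m a b : R) : 0 < m -> 0 <= a -> 0 <= b ->
  (forall e, 0 < e -> e <= 1 -> (m - e) ^+ 2 <=
    16 * (1 + e) ^+ 4 * (m + e) * (a + e) ^+ 2 * (b + e) ^+ 2) ->
  Num.sqrt m / 4 <= a * b.
Proof.
move=> m0 a0 b0 He.
have He0 : m ^+ 2 <= 16 * m * a ^+ 2 * b ^+ 2.
  pose p : {poly R} := 16%:P * (1 + 'X) ^+ 4 * (m%:P + 'X) * (a%:P + 'X) ^+ 2 *
    (b%:P + 'X) ^+ 2 - (m%:P - 'X) ^+ 2.
  have pE e : p.[e] = 16 * (1 + e) ^+ 4 * (m + e) * (a + e) ^+ 2 * (b + e) ^+ 2 -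
      (m - e) ^+ 2 by rewrite /p !hornerE.
  rewrite -subr_ge0.
  have -> : 16 * m * a ^+ 2 * b ^+ 2 - m ^+ 2 = p.[0].
    by rewrite pE; ring.
  have cp : (horner p x @[x --> (0:R)^'+] --> p.[0]).
    by apply: cvg_at_right_filter; exact: continuous_horner.
  apply: (cvgr_to_ge cp); near=> e.
  rewrite pE subr_ge0; apply: He; first by near: e; exact: nbhs_right_gt.
  by near: e; exact: nbhs_right_le.
have h : m <= (4 * (a * b)) ^+ 2.
  rewrite -(ler_pM2l m0) -expr2; apply: le_trans He0 _.
  by rewrite le_eqVlt; apply/orP; left; apply/eqP; ring.
rewrite ler_pdivrMr // mulrC -(ler_pXn2r (n := 2)) ?nnegrE ?sqrtr_ge0 ?mulr_ge0 //.
by rewrite sqr_sqrtr // ltW.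
Unshelve. all: by end_near.
Qed.

End MaxQuotient.

Theorem theorem3p2 (R : realType) (n : nat) (E : completeNormedModType R[i])
    (dimE : has_dim n E) (M : mxnorms E) (maxM : is_max M) :
  ((Num.sqrt n%:R / 4)%:E <= dQSK M)%E.
Proof.
apply: le_ereal_inf_tmp => _ [E1 [E2 [[_ E2c] _ E1c _ ->]]].
apply: le_ereal_inf_tmp => _ [u [v [uK _ ->]]].
have cu0 := cbnorm_from_max_ge0 u maxM.
have cv0 : (0 <= cbnorm (@quot_mxnorms R (l2 R) E1 E2) M v)%E.
  by have [t _] := cbnorm_to_max_gt maxM uK 0; rewrite rnorm0 mulr0.
have [n0|n0] := posnP n.
  by rewrite n0 sqrtr0 mul0r mule_ge0.
have [x x0] : exists x : E, rnorm x != 0.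
  case: n n0 dimE => // m _ [[f fL [g fgK gfK]]].
  exists (g (delta_mx 0 0)); apply/eqP => /rnorm0_eq0 g0.
  have := gfK (delta_mx 0 0); rewrite g0.
  pose fl : {linear E -> 'rV_m.+1} := HB.pack f (GRing.isLinear.Build _ _ _ _ f fL).
  rewrite -[f]/(fl : _ -> _) linear0 => /rowP/(_ 0); rewrite !mxE !eqxx.
  by move/eqP; rewrite eq_sym oner_eq0.
have xp : 0 < rnorm x by rewrite lt_neqAle eq_sym x0 rnorm_ge0.
have cup : (0 < cbnorm M (@quot_mxnorms R (l2 R) E1 E2) u)%E.
  by rewrite lt_neqAle cu0 andbT eq_sym (cbnorm_from_max_neq0 maxM uK E2c x0).
have cvp : (0 < cbnorm (@quot_mxnorms R (l2 R) E1 E2) M v)%E.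
  have [t t0] := cbnorm_to_max_gt maxM uK x.
  by apply: lt_le_trans; rewrite lte_fin mulr_gt0.
case ua : (cbnorm M _ u) cup cu0 => [a| |] // cup cu0; last first.
  by rewrite gt0_mulye // leey.
case vb : (cbnorm _ M v) cvp cv0 => [b| |] // cvp cv0; last first.
  by rewrite gt0_muley // leey.
rewrite -EFinM lee_fin; apply: limit_inequality => //; first by rewrite ltr0n.
move=> e e0 e1.
exact: (key_inequality dimE maxM E1c uK n0 cu0 cv0 ua vb e0 e1).
Qed.
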